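(* Suppose that the following two conditions hold: (i) $\rho_1:= \int_{0}^{\infty} ds \int_{s}^{\infty} \alpha(x-s) g'(x-s,1-) G(dx)< 1$; (ii) there exists a constant $\alpha_{1}\in (0,\infty)$ such that the function $t\mapsto e^{\alpha_{1} t}[1-G(t)]$ is directly Riemann integrable over $[0,\infty)$ and $\int_{0}^{\infty} e^{\alpha_{1} s} ds \int_{s}^{\infty} \alpha(x-s) g'(x-s,1-) G(dx) = 1$. Let $(P_t)_{t\ge0}$ be the transition semigroup of the $(\alpha,g,G,\psi)$-process. Then, for every $\sigma\in\mathfrak{N}(0,\infty)$, $P_t(\sigma,\cdot)$ converges as $t\to\infty$ to a probability measure $\eta$ on $\mathfrak{N}(0,\infty)$ if $$\int_{\mathfrak{N}(0,\infty)^\circ} L(d \nu) \int_{0}^{\infty} e^{\alpha_{1} x} \nu(dx) <\infty.$$ In this case, the Laplace transform of $\eta$ is given by $$\int_{\mathfrak{N}(0,\infty)} e^{-\langle \nu, f\rangle} \eta(d \nu)=\exp \Big\{-\int_0^{\infty} \psi(u_s f)\, d s\Big\},\quad f\in B(0,\infty)^{+}.$$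
   Context: Notation. $\mathbb{N}=\{0,1,2,\ldots\}$; ''positive'' means nonnegative. $\mathfrak{M}(0,\infty)$ is the set of finite Borel measures on $(0,\infty)$ with the weak convergence topology, $\mathfrak{N}(0,\infty)$ its subset of integer-valued measures, $\mathfrak{N}(0,\infty)^\circ=\mathfrak{N}(0,\infty)\setminus\{\mathbf{0}\}$ with $\mathbf{0}$ the null measure. Convergence of $P_t(\sigma,\cdot)$ is weak convergence of probability measures on $\mathfrak{N}(0,\infty)$. $B(0,\infty)$ is the set of bounded Borel functions on $(0,\infty)$; $C^1(0,\infty)$ is the set of bounded continuous functions on $(0,\infty)$ with bounded continuous first derivative; superscript $+$ denotes the positive elements. Any function on $A\subset\mathbb{R}$ is extended by $0$ to $\mathbb{R}\setminus A$. $\langle\nu,f\rangle=\int_{(0,\infty)}f\,d\nu$. $\int_a^b=\int_{(a,b]}$ and $\int_a^\infty=\int_{(a,\infty)}$. Parameters. $\alpha\in C^1(0,\infty)^+$. For each $x\in(0,\infty)$, $\{p(x,i):i\in\mathbb{N}\}$ is a probability distribution, $p(\cdot,i)\in C^1(0,\infty)^+$ for every $i$, and $\sup_{x>0}\sum_{i\ge1}i\,p(x,i)<\infty$; put $g(x,z)=\sum_{i\ge0}p(x,i)z^i$ for $z\in[0,1]$, assume $g(\cdot,z)\in C^1(0,\infty)^+$ for each $z$, and write $g'(x,1-)=\sum_{i\ge1}i\,p(x,i)$. $G$ is a continuous probability distribution on $(0,\infty)$, and $G(t)=G((0,t])$. $L(d\nu)$ is a finite measure on $\mathfrak{N}(0,\infty)^\circ$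 and $\psi(f)=\int_{\mathfrak{N}(0,\infty)^\circ}(1-e^{-\langle\nu,f\rangle})L(d\nu)$ for $f\in B(0,\infty)^+$. The $(\alpha,g,G,\psi)$-process is the Markov process with state space $\mathfrak{N}(0,\infty)$ whose transition semigroup $(P_t)_{t\ge0}$ is determined by $$\int e^{-\langle \nu, f\rangle} P_t(\sigma, d \nu)=\exp \Big\{-\langle\sigma, u_t f\rangle-\int_0^t \psi(u_s f)\, d s\Big\},\quad f \in B(0,\infty)^{+},$$ where $(t,x)\mapsto u_tf(x)$ is the unique locally bounded positive solution of $u_{t}f(x)=f(x-t)+\int_{0}^{t} \alpha(x-s)[1-g(x-s,\langle G,e^{-u_{t-s} f}\rangle)]ds$. A nonnegative function $f$ on $[0,\infty)$ is directly Riemann integrable over $[0,\infty)$ if for any $a>0$, $\sum_{n\ge1}aM_n(a)<\infty$, and $\lim_{a\to0}\sum_{n\ge1}aM_n(a)=\lim_{a\to0}\sum_{n\ge1}am_n(a)$, where $M_n(a)$ and $m_n(a)$ are the supremum and infimum of $f$ over $[(n-1)a,na]$. *)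

(* Defs.v *)
From HB Require Import structures.
From mathcomp Require Import all_boot all_order all_algebra.
From mathcomp Require Import all_classical all_reals all_analysis.
Set Implicit Arguments.
Unset Strict Implicit.
Unset Printing Implicit Defensive.
Import Order.TTheory GRing.Theory Num.Theory.
Import numFieldNormedType.Exports.
Local Open Scope classical_set_scope.
Local Open Scope ring_scope.

(* A function on (0,oo) is encoded as a function R -> R of which only the
   values on `pos` matter; wherever an argument may leave (0,oo), its extension
   by 0 is written explicitly as the restriction `f \_ pos`.  Likewise a measure
   on (0,oo) is a Borel measure on R that does not charge the complement of
   `pos`. *)

Section FunctionSpaces.
Context {R : realType}.

Definition pos : set R := `]0, +oo[.

Definition nonneg_on_pos (f : R -> R) := forall x, pos x -> 0 <= f x.

Definition bounded_borel_pos (f : R -> R) :=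
  [/\ measurable_fun (pos : set (measurableTypeR R)) f,
      [bounded f x | x in pos] & nonneg_on_pos f].

Definition bounded_cont (f : R -> R) :=
  {within pos, continuous f} /\ [bounded f x | x in pos].

Definition C1_pos (f : R -> R) :=
  [/\ bounded_cont f, forall x, pos x -> derivable f x 1,
      bounded_cont (derive1 f) & nonneg_on_pos f].

End FunctionSpaces.

Section IntegerMeasures.
Context (R : realType).

(* N(0,oo).  A library measure is a function on all subsets, constrained on
   measurable ones only; `intmeas_out` normalizes the others, so that Leibniz
   equality of `intmeas R` is equality of Borel measures. *)
Record intmeas := IntMeas {
  intmeas_val :> {finite_measure set (measurableTypeR R) -> \bar R};
  intmeas_out : forall A : set (measurableTypeR R), ~ measurable A ->
    intmeas_val A = 0%E;
  intmeas_pos : intmeas_val (~` pos) = 0%E;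
  intmeas_int : forall A : set (measurableTypeR R), measurable A ->
    exists n : nat, intmeas_val A = n%:R%:E }.

Definition null_intmeas : intmeas.
Proof.
by apply: (@IntMeas mzero) => // A _; exists 0%N.
Defined.

HB.instance Definition _ := gen_eqMixin intmeas.
HB.instance Definition _ := gen_choiceMixin intmeas.
HB.instance Definition _ := isPointed.Build intmeas null_intmeas.

Definition pair (nu : intmeas) (f : R -> R) : R := \int[nu]_(x in pos) f x.

Definition pair_test (nu : intmeas) :
    {ptws set_type [set f : R -> R | bounded_cont f] -> R} :=
  fun f => pair nu (set_val f).

(* Weak convergence topology: the coarsest one making nu |-> <nu, f>
   continuous for every bounded continuous f on (0,oo). *)
HB.instance Definition _ := Topological.copy intmeas (initial_topology pair_test).

Definition borel_intmeas := g_sigma_algebraType (@open intmeas).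

HB.instance Definition _ := Measurable.copy intmeas borel_intmeas.

Definition nonnull_intmeas : set intmeas := ~` [set null_intmeas].

End IntegerMeasures.
Arguments nonnull_intmeas {R} _.

Section Process.
Context {R : realType}.
Implicit Types (f a : R -> R) (p : R -> nat -> R) (z t x : R).
Local Notation N := (intmeas R).
Local Notation lambda := (@lebesgue_measure R).

(* g'(x,1-) *)
Definition mean_offspring p x : \bar R :=
  (\sum_(1 <= i <oo) (i%:R * p x i)%:E)%E.

Definition genfun p x z : R := limn (series (fun i => p x i * z ^+ i)).

Definition offspring_law p :=
  [/\ forall x, pos x -> (forall i, 0 <= p x i) /\ (\sum_(i <oo) (p x i)%:E = 1)%E,
      forall i, C1_pos (fun x => p x i),
      (ereal_sup [set mean_offspring p x | x in pos] < +oo)%E &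
      forall z, 0 <= z <= 1 -> C1_pos (fun x => genfun p x z)].

Definition cdf_pos (G : probability (measurableTypeR R) R) t : R :=
  fine (G `]0, t]%classic).

Definition continuous_law (G : probability (measurableTypeR R) R) :=
  G pos = 1%E /\ continuous (cdf_pos G).

(* The unique locally bounded positive solution; only the defining properties
   are recorded, uniqueness being a consequence of them.  Local boundedness is
   uniform in x on bounded time intervals. *)
Definition is_cumulant a p (G : probability (measurableTypeR R) R) f
    (u : R -> R -> R) :=
  [/\ measurable_fun
        (`[0, +oo[ `*` pos : set (measurableTypeR R * measurableTypeR R))
        (fun tx => u tx.1 tx.2),
      forall t x, 0 <= t -> pos x -> 0 <= u t x,
      forall T, [bounded u tx.1 tx.2 | tx in `[0, T] `*` pos] &
      forall t x, 0 <= t -> pos x ->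
        u t x = (f \_ pos) (x - t) +
          \int[lambda]_(s in `]0, t])
            ((a \_ pos) (x - s) *
             (1 - genfun p (x - s)
                    (\int[G]_(y in pos) expR (- u (t - s) y))))].

Definition psi (L : {finite_measure set N -> \bar R}) f : R :=
  \int[L]_(nu in nonnull_intmeas) (1 - expR (- pair nu f)).

Definition transition_semigroup (P : R -> R.-pker N ~> N) :=
  (forall (sigma : N) (A : set N), measurable A -> P 0 sigma A = \d_sigma A) /\
  (forall s t (sigma : N) (A : set N), 0 <= s -> 0 <= t -> measurable A ->
     P (s + t) sigma A = (\int[P s sigma]_nu P t nu A)%E).

(* P is the transition semigroup of the (a, g, G, psi)-process, with cumulant
   semigroup (t, f) |-> u f t. *)
Definition is_process a p G (L : {finite_measure set N -> \bar R})
    (u : (R -> R) -> R -> R -> R) (P : R -> R.-pker N ~> N) :=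
  [/\ transition_semigroup P,
      forall f, bounded_borel_pos f -> is_cumulant a p G f (u f) &
      forall f t (sigma : N), bounded_borel_pos f -> 0 <= t ->
        \int[P t sigma]_nu expR (- pair nu f) =
        expR (- pair sigma (u f t) -
              \int[lambda]_(s in `]0, t]) psi L (u f s))].

Definition weak_cvg (Q : R -> {measure set N -> \bar R})
    (eta : probability N R) :=
  forall F : N -> R, continuous F -> bounded_fun F ->
    \int[Q t]_nu F nu @[t --> +oo] --> \int[eta]_nu F nu.

Definition mean_birth_rate a p (G : probability (measurableTypeR R) R) (s : R)
    : \bar R :=
  (\int[G]_(x in `]s, +oo[) ((a (x - s))%:E * mean_offspring p (x - s)))%E.

Definition upper_sum (f : R -> R) (h : R) : \bar R :=
  (\sum_(1 <= n <oo)
     (h%:E * ereal_sup [set (f x)%:E | x in `[(n.-1%:R * h)%R, (n%:R * h)%R]]))%E.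

Definition lower_sum (f : R -> R) (h : R) : \bar R :=
  (\sum_(1 <= n <oo)
     (h%:E * ereal_inf [set (f x)%:E | x in `[(n.-1%:R * h)%R, (n%:R * h)%R]]))%E.

Definition directly_Riemann_integrable (f : R -> R) :=
  [/\ forall t, 0 <= t -> 0 <= f t,
      forall h, 0 < h -> (upper_sum f h < +oo)%E &
      exists l : \bar R, upper_sum f h @[h --> 0^'+] --> l /\
                         lower_sum f h @[h --> 0^'+] --> l].

End Process.

(* Main.v *)
From HB Require Import structures.
Require Import Defs.
From mathcomp Require Import all_boot all_order all_algebra.
From mathcomp Require Import all_classical all_reals all_analysis.
From mathcomp Require Import measurable_realfun ring lra zify.
Import Order.TTheory GRing.Theory Num.Theory.
Import numFieldNormedType.Exports.
Local Open Scope classical_set_scope.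
Local Open Scope ring_scope.

Set Implicit Arguments.
Unset Strict Implicit.
Unset Printing Implicit Defensive.

(** Let [I_t] be the law at time [t] of the process started from the null
    measure, that is, of the immigrant population. Read on Laplace transforms,
    the definition of the process says that [P_t(sigma, .)] is the convolution
    of [I_t] with the law of the descendants of [sigma], whose transform is
    [e^{- <sigma, u_t f>}], and that [I_t'], for [t <= t'], is the convolution
    of [I_t] with a law of transform [e^{- \int_t^t' psi (u_s f) ds}]. When a
    factor of a convolution gives mass at least [c] to the null measure, the
    convolution is at least [c] times the other factor. Hence
    [P_t(sigma, .) >= (1 - a_t) I_t] and [I_t' >= (1 - b_t) I_t], and both [a_t]
    and [b_t] tend to [0], as is seen below. The laws [I_n] then form a Cauchy
    sequence in total variation, whose setwise limit [eta] is a probability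
    measure ([limit_probability]), and [P_t(sigma, .)] converges to [eta] in
    total variation, in particular weakly. The transform of [eta] is the limit
    of [e^{- \int_0^n psi (u_s f) ds}].

    The rates [a_t] and [b_t] come from a bound which is uniform in [f], hence
    is a bound on survival probabilities
    ([one_sub_expRN_cumulant_decay]):
      [1 - e^{- u_t f(x)} <= C e^{- (alpha1 / 2) t} e^{alpha1 x}].
    Indeed [v t = <G, 1 - e^{- u_t f}>] satisfies the renewal inequality
    [v t <= 1 - G(t) + \int_0^t v(t - s) m(s) ds], where [m] is the mean birth
    rate. Direct Riemann integrability gives [1 - G(t) = O(e^{- alpha1 t})], and
    the conditions on [m], of mass less than [1] and of mass [1] under the weight
    [e^{alpha1 s}], give it a mass less than [1] under the weight
    [e^{(alpha1 / 2) s}]; so [v t = O(e^{- (alpha1 / 2) t})]. Integrating the bound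
    against an integer-valued measure, and then against [L], involves the
    integral of [e^{alpha1 x}] which is assumed to be finite.

    The convolution factors need not be constructed as measures: domination is
    read off Laplace transforms. If
    [f |-> \int e^{- <nu, f>} Q(d nu) - c \int e^{- <nu, f>} I(d nu)] is
    completely monotone, in the sense that all its iterated differences are
    nonnegative, then [Q >= c I] on Borel sets ([domination_borel]). The reason
    is that multiplication of [Q - c I] by [e^{- <nu, h>}] or by
    [1 - e^{- <nu, h>}] preserves complete monotonicity; with [h = (ln 2) 1_A], a
    limit of products of such factors is the indicator of [nu(A) = n], and the
    counts [nu(A)] generate the Borel sets of the weak topology
    ([borel_count_sets]). For [Q] the convolution of [I] with a factor of
    transform [F >= c], the functional is the product of [F - c] and of the
    transform of [I], so that only the complete monotonicity of [F] is at stake.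
    The equation for [u_t f] is solved by a Picard iteration whose steps
    preserve complete monotonicity of [f |-> e^{- u_t f(x)}]
    ([cm_expRN_cumulant]), and [- psi (u_s f)] is a completely monotone
    functional minus a constant. *)

(** * Completely monotone functionals *)

Section CompleteMonotonicity.
Context {R : realType} {V : zmodType} (B : set V).
Hypothesis BD : forall f h, B f -> B h -> B (f + h).
Implicit Types (F H : V -> R) (f h : V).

(** The sign is such that a Laplace functional, being decreasing, has a
    nonnegative difference. *)
Definition diff h F : V -> R := fun f => F f - F (f + h).

Fixpoint cm_upto n F : Prop :=
  (forall f, B f -> 0 <= F f) /\
  (if n is m.+1 then forall h, B h -> cm_upto m (diff h F) else True).

(** All iterated differences are nonnegative on the cone [B]. This holds for
    the Laplace functional [f |-> \int e^{- <nu, f>} m(d nu)] of a positive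
    measure [m], and it remains meaningful for a signed [m]: there it serves as
    a criterion for positivity. *)
Definition completely_monotone F := forall n, cm_upto n F.

Lemma cm_upto_ge0 n F f : cm_upto n F -> B f -> 0 <= F f.
Proof. by case: n => [|n] [F0 _]; exact: F0. Qed.

Lemma cm_upto_eq n F H : (forall f, B f -> F f = H f) ->
  cm_upto n F -> cm_upto n H.
Proof.
elim: n F H => [|n IH] F H FH [F0 FS]; split=> // f.
- by move=> Bf; rewrite -FH// F0.
- by move=> Bf; rewrite -FH// F0.
- move=> Bh; apply: IH (FS f Bh) => g Bg.
  by rewrite /diff !FH//; exact: BD.
Qed.

Lemma cm_upto_shift n F h : B h ->
  cm_upto n F -> cm_upto n (fun f => F (f + h)).
Proof.
elim: n F => [|n IH] F Bh [F0 FS]; split=> // f Bf; try exact: F0 (BD Bf Bh).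
apply: cm_upto_eq (IH _ Bh (FS f Bf)) => g Bg.
by rewrite /diff addrAC.
Qed.

Lemma cm_upto_le m n F : (m <= n)%N -> cm_upto n F -> cm_upto m F.
Proof.
elim: n m F => [|n IH] [|m] F //=; first by move=> _ [].
by move=> mn [F0 FS]; split=> // h Bh; exact: IH (FS h Bh).
Qed.

Lemma cm_uptoD n F H : cm_upto n F -> cm_upto n H ->
  cm_upto n (fun f => F f + H f).
Proof.
elim: n F H => [|n IH] F H [F0 FS] [H0 HS]; split=> // f Bf;
  try by rewrite addr_ge0 ?F0 ?H0.
apply: cm_upto_eq (IH _ _ (FS f Bf) (HS f Bf)) => g Bg.
by rewrite /diff; lra.
Qed.

(** The Leibniz rule
    [diff h (F * H) = diff h F * H + F (. + h) * diff h H]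
    only has nonnegative terms, so products preserve the class. *)
Lemma cm_uptoM n F H : cm_upto n F -> cm_upto n H ->
  cm_upto n (fun f => F f * H f).
Proof.
elim: n F H => [|n IH] F H cF cH; have [F0 FS] := cF; have [H0 HS] := cH;
  split=> // f Bf; try by rewrite mulr_ge0 ?F0 ?H0.
have cF' := cm_upto_shift Bf (cm_upto_le (leqnSn n) cF).
apply: cm_upto_eq (cm_uptoD (IH _ _ (FS f Bf) (cm_upto_le (leqnSn n) cH))
  (IH _ _ cF' (HS f Bf))) => g Bg.
by rewrite /diff; ring.
Qed.

Lemma cm_upto_cst n c : 0 <= c -> cm_upto n (fun=> c).
Proof.
elim: n c => [|n IH] c c0; split=> // h Bh.
apply: (@cm_upto_eq _ (fun=> 0)) (IH 0 _) => // f Bf.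
by rewrite /diff subrr.
Qed.

Lemma cm_upto_lim n (F_ : nat -> V -> R) F : (forall k, cm_upto n (F_ k)) ->
  (forall f, B f -> F_ k f @[k --> \oo] --> F f) -> cm_upto n F.
Proof.
elim: n F_ F => [|n IH] F_ F cF FF.
  split=> // f Bf; apply: (cvgr_to_ge (FF f Bf)).
  by apply: nearW => k; exact: cm_upto_ge0 (cF k) Bf.
split=> [f Bf|h Bh].
  apply: (cvgr_to_ge (FF f Bf)).
  by apply: nearW => k; exact: cm_upto_ge0 (cF k) Bf.
apply: (IH (fun k => diff h (F_ k))) => [k|f Bf].
  by have [_] := cF k; exact.
by apply: cvgB; apply: FF => //; exact: BD.
Qed.

Lemma cm_upto_integral n d (X : measurableType d)
    (mu : {measure set X -> \bar R}) (D : set X) (F : X -> V -> R) :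
  measurable D -> (forall x, D x -> cm_upto n (F x)) ->
  (forall f, B f -> mu.-integrable D (EFin \o F ^~ f)) ->
  cm_upto n (fun f => \int[mu]_(x in D) F x f).
Proof.
move=> mD; elim: n F => [|n IH] F cF iF.
  split=> // f Bf; apply: Rintegral_ge0 => x Dx.
  exact: cm_upto_ge0 (cF x Dx) Bf.
split=> [f Bf|h Bh].
  by apply: Rintegral_ge0 => x Dx; exact: cm_upto_ge0 (cF x Dx) Bf.
apply: (@cm_upto_eq _ (fun f => \int[mu]_(x in D) diff h (F x) f)).
  move=> f Bf; rewrite /diff RintegralB//; apply: iF => //.
  exact: BD.
apply: IH => [x Dx|f Bf]; first by have [_] := cF x Dx; exact.
rewrite [X in _.-integrable _ X](_ : _ =
  (fun x => (F x f)%:E - (F x (f + h)%R)%:E)%E)//.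
by apply: integrableB => //; apply: iF => //; exact: BD.
Qed.

Lemma cm_ge0 F f : completely_monotone F -> B f -> 0 <= F f.
Proof. by move=> /(_ 0%N); exact: cm_upto_ge0. Qed.

Lemma cm_eq F H : (forall f, B f -> F f = H f) ->
  completely_monotone F -> completely_monotone H.
Proof. by move=> FH cF n; exact: cm_upto_eq (cF n). Qed.

Lemma cm_diff h F : B h ->
  completely_monotone F -> completely_monotone (diff h F).
Proof. by move=> Bh cF n; have [_] := cF n.+1; exact. Qed.

Lemma cmD F H : completely_monotone F -> completely_monotone H ->
  completely_monotone (fun f => F f + H f).
Proof. by move=> cF cH n; exact: cm_uptoD. Qed.

Lemma cmM F H : completely_monotone F -> completely_monotone H ->
  completely_monotone (fun f => F f * H f).
Proof. by move=> cF cH n; exact: cm_uptoM. Qed.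

Lemma cm_cst c : 0 <= c -> completely_monotone (fun=> c).
Proof. by move=> c0 n; exact: cm_upto_cst. Qed.

Lemma cmZ c F : 0 <= c -> completely_monotone F ->
  completely_monotone (fun f => c * F f).
Proof. by move=> c0; apply: cmM; exact: cm_cst. Qed.

Lemma cmX F n : completely_monotone F -> completely_monotone (fun f => F f ^+ n).
Proof.
move=> cF; elim: n => [|n IH].
  by apply: (@cm_eq (fun=> 1)) => //; exact: cm_cst.
apply: cm_eq (cmM cF IH) => f _; by rewrite exprS.
Qed.

Lemma cm_sum (I : Type) (s : seq I) (F : I -> V -> R) :
  (forall i, completely_monotone (F i)) ->
  completely_monotone (fun f => \sum_(i <- s) F i f).
Proof.
move=> cF; elim: s => [|i s IH].
  by apply: (@cm_eq (fun=> 0)) => [f _|]; [rewrite big_nil|exact: cm_cst].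
by apply: cm_eq (cmD (cF i) IH) => f _; rewrite big_cons.
Qed.

Lemma cm_prod (I : eqType) (s : seq I) (F : I -> V -> R) :
  (forall i, i \in s -> completely_monotone (F i)) ->
  completely_monotone (fun f => \prod_(i <- s) F i f).
Proof.
elim: s => [|i s IH] cF.
  by apply: (@cm_eq (fun=> 1)) => [f _|]; [rewrite big_nil|exact: cm_cst].
apply: cm_eq (cmM (cF i (mem_head _ _)) (IH _)) => [f _|j js].
  by rewrite big_cons.
by apply: cF; rewrite inE js orbT.
Qed.

Lemma cm_lim (F_ : nat -> V -> R) F : (forall k, completely_monotone (F_ k)) ->
  (forall f, B f -> F_ k f @[k --> \oo] --> F f) -> completely_monotone F.
Proof. by move=> cF FF n; apply: cm_upto_lim FF => k; exact: cF. Qed.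

Lemma cm_integral d (X : measurableType d)
    (mu : {measure set X -> \bar R}) (D : set X) (F : X -> V -> R) :
  measurable D -> (forall x, D x -> completely_monotone (F x)) ->
  (forall f, B f -> mu.-integrable D (EFin \o F ^~ f)) ->
  completely_monotone (fun f => \int[mu]_(x in D) F x f).
Proof.
by move=> mD cF iF n; apply: cm_upto_integral => // x Dx; exact: cF.
Qed.

(** Subtracting a constant does not change the differences. *)
Lemma cm_subr_cst F c : completely_monotone F ->
  (forall f, B f -> c <= F f) -> completely_monotone (fun f => F f - c).
Proof.
move=> cF cF0 [|n]; split=> // f Bf; rewrite ?subr_ge0 ?cF0//.
apply: cm_upto_eq (cm_diff Bf cF n) => g Bg; rewrite /diff; lra.
Qed.

(** The exponential series has nonnegative coefficients. *)
Lemma cm_expR F : completely_monotone F ->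
  completely_monotone (fun f => expR (F f)).
Proof.
move=> cF; pose F_ k f := series (exp_coeff (F f)) k.
apply: (@cm_lim F_) => [k|f _]; last first.
  exact: (@is_cvg_series_exp_coeff R (F f)).
apply: (@cm_eq (fun f => \sum_(i <- index_iota 0 k) i`!%:R^-1 * F f ^+ i)).
  move=> f _; rewrite /F_ /series/=; apply: eq_bigr => i _.
  by rewrite /exp_coeff/= mulrC.
by apply: cm_sum => i; apply: cmZ (cmX i cF); rewrite invr_ge0.
Qed.

(** A Laplace transform is built from these: [diff h] multiplies [expR (- l)]
    by the nonnegative constant [1 - expR (- l h)]. *)
Lemma cm_expRN_additive (l : V -> R) :
  (forall f, B f -> 0 <= l f) ->
  (forall f h, B f -> B h -> l (f + h) = l f + l h) ->
  completely_monotone (fun f => expR (- l f)).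
Proof.
move=> l0 lD n; apply: (@cm_upto_eq _ (fun f => 1 * expR (- l f))).
  by move=> f _; rewrite mul1r.
elim: n 1 (@ler01 R) => [|n IH] c c0; split=> // f Bf;
  try by rewrite mulr_ge0 ?expR_ge0.
apply: (@cm_upto_eq _ (fun g => c * (1 - expR (- l f)) * expR (- l g))).
  by move=> g Bg; rewrite /diff lD// opprD expRD; ring.
apply: IH; rewrite mulr_ge0// subr_ge0 -expR0 ler_expR oppr_le0; exact: l0.
Qed.

End CompleteMonotonicity.

(** * Bounded integrands on sets of finite measure *)

Section BoundedIntegrands.
Context {R : realType} d {T : measurableType d}.
Variables (mu : {measure set T -> \bar R}) (D : set T).
Hypothesis mD : measurable D.
Hypothesis muD : (mu D < +oo)%E.
Implicit Types (f : T -> R) (M : R).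

Lemma bounded_integrable f M : measurable_fun D f ->
  (forall x, D x -> `|f x| <= M) -> mu.-integrable D (EFin \o f).
Proof.
move=> mf fM; apply: measurable_bounded_integrable => //.
exists M; split; first exact: num_real.
by move=> y My x Dx /=; apply: le_trans (fM x Dx) (ltW My).
Qed.

Lemma ge0_bounded_integrable f M : measurable_fun D f ->
  (forall x, D x -> 0 <= f x <= M) -> mu.-integrable D (EFin \o f).
Proof.
move=> mf fM; apply: (@bounded_integrable _ M) => // x /fM /andP[f0 ?].
by rewrite ger0_norm.
Qed.

Lemma EFin_Rintegral f : mu.-integrable D (EFin \o f) ->
  (\int[mu]_(x in D) f x)%:E = (\int[mu]_(x in D) (f x)%:E)%E.
Proof. by move=> fi; rewrite fineK//; exact: integrable_fin_num. Qed.

Lemma Rintegral_le_cst f M : measurable_fun D f ->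
  (forall x, D x -> 0 <= f x <= M) ->
  \int[mu]_(x in D) f x <= M * fine (mu D).
Proof.
move=> mf fM; rewrite -Rintegral_cst//; apply: le_Rintegral => //.
- exact: ge0_bounded_integrable fM.
- apply: (@bounded_integrable (fun=> M) `|M|) => //; exact: measurable_cst.
- by move=> x /fM /andP[].
Qed.

Lemma bounded_cvg_Rintegral (f_ : nat -> T -> R) f M :
  (forall n, measurable_fun D (f_ n)) ->
  (forall n x, D x -> `|f_ n x| <= M) ->
  (forall x, D x -> f_ n x @[n --> \oo] --> f x) ->
  \int[mu]_(x in D) f_ n x @[n --> \oo] --> \int[mu]_(x in D) f x.
Proof.
move=> mf_ fM ff.
have mf : measurable_fun D f by exact: (measurable_fun_cvg mf_ ff).
have M0 x : D x -> `|f x| <= M.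
  move=> Dx; apply: (cvgr_to_le (cvg_norm (ff x Dx))).
  by apply: nearW => n; exact: fM.
have if_ n : mu.-integrable D (EFin \o f_ n).
  exact: (bounded_integrable (mf_ n) (fM n)).
have if' : mu.-integrable D (EFin \o f) by exact: (bounded_integrable mf M0).
have : (\int[mu]_(x in D) (f_ n x)%:E)%E @[n --> \oo] -->
    (\int[mu]_(x in D) (f x)%:E)%E.
  apply: (@dominated_cvg _ _ _ mu D mD _ _ (EFin \o cst M)).
  - by move=> n; exact/measurable_EFinP.
  - by move=> x Dx; apply: cvg_EFin; [exact: nearW|exact: ff].
  - by [].
  - by apply: (@bounded_integrable (fun=> M) `|M|) => //; exact: measurable_cst.
  - by move=> n x Dx; rewrite /= lee_fin fM.
rewrite -EFin_Rintegral//; under eq_fun do rewrite -EFin_Rintegral//.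
by move/fine_cvgP => [].
Qed.

End BoundedIntegrands.

(** * Atoms of an integer-valued measure *)

Section Atoms.
Context {R : realType}.
Local Notation Rm := (measurableTypeR R).
Implicit Types (A : set Rm) (x y : R) (s : seq R).

Lemma measurable_pos : measurable (pos : set Rm).
Proof. exact: measurable_itv. Qed.
Hint Resolve measurable_pos : core.

(** Without atoms, every point would have a rational neighbourhood of measure
    less than [1], hence null, and countably many of these cover the line. *)
Lemma integer_measure_atom (m : {measure set Rm -> \bar R}) :
  (m setT < +oo)%E ->
  (forall A, measurable A -> exists n : nat, m A = n%:R%:E) ->
  m setT != 0%E -> exists x, m [set x] != 0%E.
Proof.
move=> mfin mint mT; apply: contrapT => noatom.
have atom0 x : m [set x] = 0%E.
  by apply/eqP/negPn/negP => h; apply: noatom; exists x.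
have null_nbhs x : exists ab : rat * rat,
    ratr ab.1 < x < ratr ab.2 /\ m `]ratr ab.1, ratr ab.2[%classic = 0%E.
  pose F n : set Rm := `]x - n.+1%:R^-1, x + n.+1%:R^-1[%classic.
  have mF n : measurable (F n) by exact: measurable_itv.
  have capF : \bigcap_n F n = [set x].
    apply/seteqP; split=> [/= y' Fy|y -> n _]; last first.
      by rewrite /F/= in_itv/= ltrBlDr !ltrDl invr_gt0 ltr0Sn.
    pose y : R := y'; rewrite -[y']/y in Fy *.
    apply/eqP; rewrite -subr_eq0 -normr_le0 leNgt; apply/negP => yx.
    have := archimedean.Num.Theory.truncnS_gt (`|y - x|^-1).
    set n := Num.trunc _ => nyx.
    have := Fy n I; rewrite /F/= in_itv/= => /andP[y1 y2].
    have : `|y - x| < n.+1%:R^-1 by rewrite ltr_norml ltrBrDl y1 ltrBlDl y2.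
    apply/negP; rewrite -leNgt invf_ple ?posrE ?ltr0Sn//.
    exact: ltW.
  have : m \o F @ \oo --> m (\bigcap_n F n).
    apply: nonincreasing_cvg_mu => //.
    - by apply: le_lt_trans mfin; apply: le_measure; rewrite ?inE.
    - by rewrite capF; exact: measurable_set1.
    - move=> i j ij; apply/subsetPset => y; rewrite /F/= !in_itv/=.
      have ji : j.+1%:R^-1 <= i.+1%:R^-1 :> R.
        by rewrite lef_pV2 ?posrE ?ltr0Sn// ler_nat ltnS.
      move=> /andP[y1 y2]; apply/andP; split.
        by apply: le_lt_trans y1; rewrite lerD2l lerN2.
      by apply: lt_le_trans y2 _; rewrite lerD2l.
  rewrite capF atom0 => /fine_cvgP[].
  move=> _ /cvgrPdist_lt /(_ 1 ltr01)[n _ /(_ n (leqnn n))] /=.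
  rewrite sub0r normrN; have [k Fk] := mint (F n) (measurable_itv _).
  rewrite Fk/= ger0_norm// ltrn1 => k0; have {}k0 : k = 0%N by case: k k0 {Fk}.
  rewrite k0 in Fk.
  have xn : x - n.+1%:R^-1 < x by rewrite ltrBlDr ltrDl invr_gt0 ltr0Sn.
  have xn' : x < x + n.+1%:R^-1 by rewrite ltrDl invr_gt0 ltr0Sn.
  have /rat_in_itvoo[a] := xn; rewrite in_itv/= => /andP[a1 a2].
  have /rat_in_itvoo[b] := xn'; rewrite in_itv/= => /andP[b1 b2].
  exists (a, b); split=> /=; first by rewrite a2 b1.
  apply/eqP; rewrite -measure_le0 -[leRHS]Fk; apply: le_measure; rewrite ?inE//.
  move=> y /=; rewrite /F/= !in_itv/= => /andP[y1 y2].
  by rewrite (lt_trans a1 y1) (lt_trans y2 b2).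
pose F n : set Rm := if @unpickle (rat * rat)%type n is Some ab then
  if m `]ratr ab.1, ratr ab.2[%classic == 0%E then `]ratr ab.1, ratr ab.2[%classic
  else set0 else set0.
have F0 n : m.-negligible (F n).
  rewrite /F; case: unpickle => [ab|]; last exact: negligible_set0.
  case: ifPn => [/eqP h|_]; last exact: negligible_set0.
  by apply/negligibleP.
have : m.-negligible setT.
  apply: negligibleS (negligible_bigcup F0) => x _.
  have [ab [abx ab0]] := null_nbhs x.
  have Fab : F (pickle ab) = `]ratr ab.1, ratr ab.2[%classic.
    by rewrite /F pickleK ab0 eqxx.
  exists (pickle ab); first exact: I.
  by rewrite Fab set_itvE.
by move/negligibleP => /(_ measurableT) /eqP; rewrite (negPf mT).
Qed.

(** Each atom carries a mass at least [1], so that removing atoms one after the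
    other exhausts the measure after finitely many steps. *)
Lemma integer_measure_sum_dirac (m : {measure set Rm -> \bar R}) :
  (m setT < +oo)%E ->
  (forall A, measurable A -> exists n : nat, m A = n%:R%:E) ->
  exists s, forall A, measurable A -> m A = (\sum_(x <- s) \1_A x)%:E.
Proof.
move=> mfin mint; have [n mn] := mint setT measurableT.
have {mfin mn} : (m setT <= n%:R%:E)%E by rewrite mn.
elim: n m mint => [|n IH] m mint mn.
  exists [::] => A mA; rewrite big_nil; apply/eqP; rewrite -measure_le0.
  by apply: le_trans mn; apply: le_measure; rewrite ?inE.
have mfin : (m setT < +oo)%E by apply: le_lt_trans mn _; exact: ltry.
have [m0|m0] := eqVneq (m setT) 0%E.
  by apply: IH => //; rewrite m0 lee_fin.
have [x mx] := integer_measure_atom mfin mint m0.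
have mcx : measurable (~` [set x] : set Rm) by exact: measurableC.
have splitx A : measurable A ->
    (m A = m (A `&` [set x]) + m (A `&` ~` [set x]))%E.
  by move=> mA; rewrite -setDE addeC; apply: measureDI; [|exact: measurable_set1].
have [k mk] := mint [set x] (measurable_set1 _).
have k0 : (0 < k)%N by rewrite lt0n; apply: contra mx => /eqP k0; rewrite mk k0.
have [s sP] : exists s, forall A, measurable A ->
    mrestr m mcx A = (\sum_(x <- s) \1_A x)%:E.
  apply: IH => [A mA|]; first by apply: mint; exact: measurableI.
  rewrite /= /mrestr setTI; have := splitx _ measurableT.
  rewrite !setTI mk; have [j ->] := mint (~` [set x]) mcx.
  move=> h; move: mn; rewrite h -EFinD !lee_fin -natrD !ler_nat.
  by move: k0; clear; lia.
exists (nseq k x ++ s) => A mA; rewrite splitx// big_cat/= EFinD -sP//.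
congr (_ + _)%E; rewrite big_nseq iter_addr_0 indicE.
have [xA|xA] := boolP (x \in A).
  by rewrite (_ : A `&` _ = [set x])// setIC; apply/setIidl => _ ->; rewrite inE in xA.
rewrite (_ : A `&` _ = set0) ?measure0 ?mul0rn//.
by apply/seteqP; split=> // y [Ay yx]; move: xA; rewrite notin_setE -yx.
Qed.

Definition atoms (nu : intmeas R) s :=
  (forall x, x \in s -> pos x) /\
  forall A, measurable A -> nu A = (\sum_(x <- s) \1_A x)%:E.

Lemma exists_atoms (nu : intmeas R) : exists s, atoms nu s.
Proof.
have nuint (A : set Rm) : measurable A -> exists n : nat, nu A = n%:R%:E.
  exact: intmeas_int.
have nufin : (nu setT < +oo)%E by have [n ->] := nuint _ measurableT; rewrite ltry.
have [s sP] := integer_measure_sum_dirac nufin nuint.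
exists s; split=> // x xs; apply: contrapT => nx.
have [] := etrans (esym (intmeas_pos nu)) (sP _ (measurableC measurable_pos)).
rewrite (big_rem x)//= indicE mem_set//= => /esym/eqP.
by apply/negP; rewrite gt_eqF// ltr_pwDl// sumr_ge0.
Qed.

Lemma ge0_integral_atoms (nu : intmeas R) s (f : Rm -> \bar R) : atoms nu s ->
  measurable_fun (pos : set Rm) f -> (forall x, pos x -> (0 <= f x)%E) ->
  (\int[nu]_(x in pos) f x = \sum_(x <- s) f x)%E.
Proof.
move=> [spos sP] mf f0.
pose m_ n : {measure set Rm -> \bar R} := @dirac _ Rm (nth 0 s n) R.
rewrite (@eq_measure_integral _ _ _ _ (msum m_ (size s))).
  rewrite ge0_integral_measure_sum// [RHS](big_nth 0) big_mkord.
  apply: eq_bigr => i _; rewrite integral_dirac// diracE mem_set ?mul1e//.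
  by apply: spos; rewrite mem_nth.
move=> A mA _; rewrite [LHS](sP A mA) /msum/= (big_nth 0) big_mkord -sumEFin.
by apply: eq_bigr => i _; rewrite /m_ /= diracE indicE.
Qed.

Lemma pair_atoms (nu : intmeas R) s (f : R -> R) : atoms nu s ->
  measurable_fun (pos : set Rm) f -> pair nu f = \sum_(x <- s) f x.
Proof.
move=> nus mf; rewrite /pair /Rintegral integralE.
have mEf : measurable_fun (pos : set Rm) (EFin \o f) by exact/measurable_EFinP.
rewrite (ge0_integral_atoms nus) ?(ge0_integral_atoms nus)//.
- transitivity (fine (\sum_(x <- s) (Num.max (f x) 0)%:E -
    \sum_(x <- s) (Num.max (- f x) 0)%:E)).
    by congr (fine (_ - _)); apply: eq_bigr => x _;
      rewrite ?funeposE ?funenegE /= EFin_max ?EFinN.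
  rewrite !sumEFin -EFinB /= -sumrB; apply: eq_bigr => x _.
  by case: (leP (f x) 0) => h; [rewrite max_l|rewrite max_r]; lra.
- exact: measurable_funeneg.
- exact: measurable_funepos.
Qed.

End Atoms.
#[local] Hint Resolve measurable_pos : core.

(** * The Borel structure of the space of integer-valued measures *)

Section Grid.
Context {R : realType}.
Local Notation Rm := (measurableTypeR R).
Local Notation N := (intmeas R).
Implicit Types (nu : N) (M : nat) (k : int).

Definition cell_index M (x : R) : int := Num.floor (x * M.+1%:R).

Definition cell M k : set R := [set x | cell_index M x = k].

Lemma cell_index_dist M (x y : R) :
  cell_index M x = cell_index M y -> `|x - y| < M.+1%:R^-1.
Proof.
rewrite /cell_index => xy.
have M0 : 0 < M.+1%:R :> R by rewrite ltr0Sn.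
have := archimedean.Num.Theory.floor_itv (x * M.+1%:R).
have := archimedean.Num.Theory.floor_itv (y * M.+1%:R).
rewrite xy intrD => /andP[y1 y2] /andP[x1 x2].
rewrite -(ltr_pM2r M0) mulVf ?gt_eqF// -[in ltLHS](gtr0_norm M0) -normrM.
by rewrite mulrBl ltr_norml; lra.
Qed.

Lemma measurable_cell M k : measurable (cell M k : set Rm).
Proof.
have M0 : 0 < M.+1%:R :> R by rewrite ltr0Sn.
rewrite (_ : cell M k = `[k%:~R / M.+1%:R, (k + 1)%:~R / M.+1%:R[%classic).
  exact: measurable_itv.
apply/seteqP; split=> x /=; rewrite /cell/= in_itv/= ler_pdivrMr// ltr_pdivlMr//.
  by move=> <-; exact: archimedean.Num.Theory.floor_itv.
exact: archimedean.Num.Theory.floor_def.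
Qed.

Definition grid_class M (t : seq int) : set N :=
  [set nu | forall k, nu (cell M k) = (count_mem k t)%:R%:E].

Lemma atoms_cell nu s M k : atoms nu s ->
  nu (cell M k) = (count_mem k (map (cell_index M) s))%:R%:E.
Proof.
move=> [_ sP]; rewrite sP; last exact: measurable_cell.
congr _%:E; elim: s {sP} => [|x s IH]; first by rewrite big_nil.
rewrite big_cons IH /= natrD indicE; congr (_%:R + _); congr nat_of_bool.
by apply/idP/eqP; rewrite inE.
Qed.

(** Two measures with the same counts on a fine grid are close in the weak
    topology: their atoms can be paired within the cells. *)
Lemma grid_class_pair nu s (f : R -> R) e : atoms nu s -> bounded_cont f ->
  0 < e ->
  \forall M \near \oo, forall nu', grid_class M (map (cell_index M) s) nu' ->
    `|pair nu' f - pair nu f| < e.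
Proof.
move=> nus [cf _] e0.
have mf : measurable_fun (pos : set Rm) f.
  by apply: subspace_continuous_measurable_fun => //; exact: measurable_pos.
pose d := e / (size s).+1%:R.
have d0 : 0 < d by rewrite divr_gt0// ltr0Sn.
have near_s : \forall M \near \oo, forall x, x \in s ->
    forall y, `|y - x| < M.+1%:R^-1 -> `|f y - f x| < d.
  have spos := nus.1.
  elim: s spos {nus d0 e0} d d0 => [|x s IH] spos d d0.
    by apply: nearW => M x; rewrite in_nil.
  have xpos : pos x by apply: spos; rewrite mem_head.
  have cfx : {for x, continuous f}.
    move: cf; rewrite continuous_open_subspace; last exact: interval_open.
    by apply; rewrite inE.
  have sp y : y \in s -> pos y by move=> ys; apply: spos; rewrite inE ys orbT.
  move: cfx => /cvgrPdist_lt /(_ d d0) [r /= r0 rP].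
  near=> M => z; rewrite inE => /predU1P[->|zs] y yz.
    rewrite distrC; apply: rP; rewrite /= distrC (lt_trans yz)//.
    by near: M; exact: (near_infty_natSinv_lt (PosNum r0)).
  by move: z zs y yz; near: M; exact: IH.
near=> M => nu' nu's.
have nM : forall x, x \in s ->
  forall y, `|y - x| < M.+1%:R^-1 -> `|f y - f x| < d by near: M.
have [s' s'P] := exists_atoms nu'.
have : perm_eq (map (cell_index M) s) (map (cell_index M) s').
  apply/allP => k _ /=; rewrite -(eqr_nat R) -eqe.
  by rewrite -(atoms_cell _ _ s'P) nu's.
move=> /(perm_iotaP 0)[Is]; rewrite size_map => IsP sIs.
pose s'' := [seq nth 0 s' i | i <- Is].
have s''s' : perm_eq s'' s' by apply/(perm_iotaP 0); exists Is.
have sizes'' : size s'' = size s.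
  by rewrite -(size_map (cell_index M) s) sIs !size_map.
have close i : (i < size s)%N -> `|nth 0 s'' i - nth 0 s i| < M.+1%:R^-1.
  move=> is_; apply: cell_index_dist.
  have is'' : (i < size Is)%N by rewrite -(size_map (nth 0 s')) sizes''.
  have i' : (nth 0%N Is i < size s')%N.
    have : nth 0%N Is i \in iota 0 (size s').
      by rewrite -(perm_mem IsP) mem_nth.
    by rewrite mem_iota add0n => /andP[].
  rewrite -(nth_map 0 0%:Z (cell_index M) is_) sIs.
  by rewrite (nth_map 0%N)// (nth_map 0%N)// (nth_map 0).
rewrite (pair_atoms s'P mf) (pair_atoms nus mf) -(perm_big _ s''s')/=.
rewrite (big_nth 0) [X in _ - X](big_nth 0) sizes'' -sumrB.
apply: le_lt_trans (ler_norm_sum _ _ _) _.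
apply: (@le_lt_trans _ _ (\sum_(0 <= i < size s) d)).
  rewrite big_seq [leRHS]big_seq; apply: ler_sum => i.
  rewrite mem_index_iota => /andP[_ is_]; apply/ltW.
  by apply: nM; [exact: mem_nth|exact: close].
rewrite sumr_const_nat subn0 -mulr_natr /d -mulrA gtr_pMr//.
by rewrite mulrC ltr_pdivrMr ?ltr0Sn// mul1r ltr_nat.
Unshelve. all: by end_near. Qed.

Lemma grid_class_nbhs nu s (U : set N) : atoms nu s -> open U -> U nu ->
  exists M, grid_class M (map (cell_index M) s) `<=` U.
Proof.
move=> nus [V oV VU] Unu.
pose E M := grid_class M (map (cell_index M) s).
pose F := filter_from setT
  (fun M0 => [set nu' | exists2 M, (M0 <= M)%N & E M nu']).
have FF : Filter F.
  apply: filter_from_filter; first by exists 0%N.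
  move=> i j _ _; exists (maxn i j) => // nu' [M].
  by rewrite geq_max => /andP[iM jM] EM; split; exists M.
have : @pair_test R @ F --> @pair_test R nu.
  apply/cvg_sup => f; rewrite cvg_image; last first.
    by apply/seteqP; split=> // v _; exists (fun=> v).
  move=> W nW; exists (@^~ f @^-1` W); last first.
    by apply/seteqP; split=> [_ [g Wg <-]//|v Wv]; exists (fun=> v).
  have [e e0 eW] := nW.
  have [M0 _ M0P] := grid_class_pair nus (set_mem (valP f)) e0.
  exists M0 => // nu' [M M0M EM]; apply: eW => /=.
  by rewrite distrC; exact: M0P EM.
move=> /(_ V)[]; first by apply: open_nbhs_nbhs; split=> //; rewrite -VU in Unu.
move=> M _ MV; exists M => nu' EM; rewrite -VU.
by apply: MV; exists M.
Qed.

Definition count_sets : set (set N) :=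
  [set C | exists A : set Rm, measurable A /\
     exists n : nat, C = [set nu : N | nu A = n%:R%:E]].

(** The weak topology has the countably many grid classes as a network, so
    its open sets, hence its Borel sets, are generated by the counts. *)
Lemma borel_count_sets (A : set N) : measurable A -> <<s count_sets >> A.
Proof.
apply: smallest_sub; first exact: smallest_sigma_algebra.
move=> U oU.
have mgrid M t : measurable (grid_class M t : set (g_sigma_algebraType count_sets)).
  rewrite (_ : grid_class M t = ~` \bigcup_k
      ~` [set nu : N | nu (cell M k) = (count_mem k t)%:R%:E]); last first.
    apply/seteqP; split=> nu h; first by move=> [k _]; apply; exact: h.
    by move=> k; apply: contrapT => nh; apply: h; exists k.
  apply: measurableC; apply: countable_bigcupT_measurable => // k.
  apply: measurableC; apply: sub_sigma_algebra.
  by exists (cell M k); split; [exact: measurable_cell|exists (count_mem k t)].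
pose F (Mt : nat * seq int) := if `[< grid_class Mt.1 Mt.2 `<=` U >]
  then grid_class Mt.1 Mt.2 else set0.
suff -> : U = \bigcup_Mt F Mt.
  apply: (@countable_bigcupT_measurable _ (g_sigma_algebraType count_sets)) => //.
  by move=> Mt; rewrite /F; case: ifP => // _; exact: measurable0.
apply/seteqP; split=> [nu Unu|nu [Mt _]]; last first.
  by rewrite /F; case: asboolP => // h /h.
have [s nus] := exists_atoms nu.
have [M MU] := grid_class_nbhs nus oU Unu.
exists (M, map (cell_index M) s) => //; rewrite /F; case: asboolP => //= _.
by move=> k; exact: atoms_cell.
Qed.

End Grid.

Lemma cvg_sumr {R : realType} (T I : Type) (F : set_system T) (s : seq I)
    (f : I -> T -> R) (l : I -> R) : Filter F ->
  (forall i, f i x @[x --> F] --> l i) ->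
  \sum_(i <- s) f i x @[x --> F] --> \sum_(i <- s) l i.
Proof.
move=> FF fl; elim: s => [|i s IH].
  by rewrite big_nil; under eq_fun do rewrite big_nil; exact: cvg_cst.
by rewrite big_cons; under eq_fun do rewrite big_cons; exact: cvgD.
Qed.

Section MeasurableEvaluation.
Context {R : realType}.
Local Notation Rm := (measurableTypeR R).
Local Notation N := (intmeas R).
Implicit Types (nu : N).

Lemma continuous_intmeas_measurable (F : N -> R) : continuous F ->
  measurable_fun setT F.
Proof.
move=> cF; apply: (@measurability _ _ N Rm setT F (@RGenOInfty.G R)
  (RGenOInfty.measurableE R)).
move=> _ [_ [a ->] <-]; rewrite setTI.
apply: sub_sigma_algebra; apply: open_comp; first by move=> ? _; exact: cF.
exact: interval_open.
Qed.

Lemma continuous_pair (f : R -> R) : bounded_cont f ->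
  continuous (fun nu => pair nu f).
Proof.
move=> bf nu.
have bf' : f \in [set f : R -> R | bounded_cont f] by rewrite inE.
have h1 := @initial_continuous N _ (@pair_test R) nu.
have h2 := @proj_continuous _ (fun=> R) (SigSub bf') (pair_test nu).
exact: (cvg_comp _ _ h1 h2).
Qed.

(** The indicator of an open half-line is an increasing limit of continuous
    functions, which settles half-lines; a Dynkin argument does the rest. *)
Lemma measurable_intmeas (A : set Rm) : measurable A ->
  measurable_fun setT (fun nu => nu A).
Proof.
have mT : measurable_fun setT (fun nu => nu setT).
  pose one : R -> R := fun=> 1.
  have b1 : bounded_cont one.
    by split; [move=> x; exact: cvg_cst|exists 1; split=> // y y1 x _;
      rewrite /= normr1 ltW].
  rewrite (_ : (fun nu => nu setT) = EFin \o (fun nu => pair nu one)).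
    by apply/measurable_EFinP; apply: continuous_intmeas_measurable;
      exact: continuous_pair.
  apply/funext => nu /=; have [s nus] := exists_atoms nu.
  rewrite (pair_atoms nus)//; last exact: measurable_cst.
  rewrite nus.2//; congr _%:E; apply: eq_bigr => x _.
  by rewrite indicE in_setT.
have RG : @measurable _ Rm = <<s @RGenOInfty.G R >>.
  exact: RGenOInfty.measurableE.
rewrite RG; move: A.
apply: (@dynkin_induction _ Rm (@RGenOInfty.G R)
  (fun A => measurable_fun setT (fun nu => nu A)) RG).
- move=> _ _ [a ->] [b ->]; exists (Num.max a b).
  by apply/seteqP; split=> x /=; rewrite !in_itv/= !andbT gt_max => /andP.
- exact: mT.
- move=> _ [a ->].
  pose f k x : R := Num.min 1 (k%:R * Num.max 0 (x - a)).
  have cf k : continuous (f k).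
    move=> x; apply: (@continuous_min _ _ (fun=> 1) (fun y => k%:R * Num.max 0 (y - a))).
      exact: cvg_cst.
    apply: cvgM; first exact: cvg_cst.
    apply: (@continuous_max _ _ (fun=> 0) (fun y => y - a)); first exact: cvg_cst.
    by apply: cvgB; [exact: cvg_id|exact: cvg_cst].
  have mf k : measurable_fun (pos : set Rm) (f k).
    by apply: measurable_funTS; exact: continuous_measurable_fun.
  have bf k : bounded_cont (f k).
    split; first exact: continuous_subspaceT.
    exists 1; split=> // y y1 x _ /=; apply: le_trans (ltW y1).
    rewrite ger0_norm ?ge_min ?lexx// le_min ler01 /=.
    by rewrite mulr_ge0// le_max lexx.
  apply: (emeasurable_fun_cvg (fun k nu => (pair nu (f k))%:E)).
    move=> k; apply/measurable_EFinP; apply: continuous_intmeas_measurable.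
    exact: continuous_pair.
  move=> nu _; have [s nus] := exists_atoms nu.
  rewrite nus.2; last exact: measurable_itv.
  under eq_fun do rewrite (pair_atoms nus (mf _)).
  apply: cvg_EFin; first exact: nearW.
  apply: cvg_sumr => x; rewrite indicE.
  have [xa|xa] := ltP a x.
    rewrite mem_set/=; last by rewrite in_itv/= xa.
    apply: cvg_near_cst; near=> k; rewrite /f /= max_r; last first.
      by rewrite subr_ge0 ltW.
    rewrite min_l// -ler_pdivrMr ?subr_gt0//; near: k.
    exact: nbhs_infty_ger.
  rewrite memNset; last by rewrite /= in_itv/= andbT; apply/negP; rewrite -leNgt.
  apply: cvg_near_cst; near=> k; rewrite /f max_l ?subr_le0//.
  by rewrite mulr0 min_r.
- move=> S mS IH.
  rewrite (_ : (fun nu => nu (~` S)) = (fun nu => nu setT - nu S)%E).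
    by apply: emeasurable_funB => //; exact: mT.
  apply/funext => nu; have [s nus] := exists_atoms nu.
  rewrite !nus.2//; last exact: measurableC.
  rewrite -EFinB -sumrB; congr _%:E; apply: eq_bigr => x _.
  by rewrite !indicE in_setT in_setC; case: (x \in S); rewrite ?subrr ?subr0.
- move=> F mF tF IH.
  rewrite (_ : (fun nu => nu (\bigcup_k F k)) = (fun nu => \sum_(k <oo) nu (F k))%E).
    by apply: ge0_emeasurable_sum => // k nu _ _; exact: measure_ge0.
  apply/funext => nu; apply: measure_semi_bigcup => //.
  exact: bigcup_measurable.
Unshelve. all: by end_near. Qed.

Lemma measurable_integral_intmeas (f : Rm -> \bar R) :
  measurable_fun (pos : set Rm) f -> (forall x, pos x -> (0 <= f x)%E) ->
  measurable_fun setT (fun nu => \int[nu]_(x in pos) f x)%E.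
Proof.
move=> mf f0; under eq_fun do rewrite integral_mkcond.
apply: measurable_fun_integral_kernel.
- by move=> U mU; exact: measurable_intmeas.
- by move=> x; rewrite patchE; case: ifPn => // /set_mem; exact: f0.
- by apply/(measurable_restrictT _ measurable_pos).
Qed.

Lemma measurable_pair (f : R -> R) :
  measurable_fun (pos : set Rm) f -> nonneg_on_pos f ->
  measurable_fun setT (fun nu => pair nu f).
Proof.
move=> mf f0; apply: measurableT_comp; first exact: fine_measurable.
apply: measurable_integral_intmeas; first exact/measurable_EFinP.
by move=> x px; rewrite lee_fin f0.
Qed.

(** The counts make [nu |-> nu] a transition kernel, finite but not uniformly
    so: the sections of a measurable set are treated by a Dynkin argument. *)
Lemma measurable_intmeas_xsection d (T : measurableType d)
    (C : set (T * N * Rm)) : measurable C ->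
  measurable_fun setT (fun z : T * N => z.2 (xsection C z)).
Proof.
have PM := @measurable_prod_measurableType _ _ (T * N)%type Rm.
rewrite PM; move: C; apply: (@dynkin_induction _ (T * N * Rm)%type _
  (fun C => measurable_fun setT (fun z : T * N => z.2 (xsection C z))) PM).
- move=> _ _ [A1 mA1 [B1 mB1 <-]] [A2 mA2 [B2 mB2 <-]].
  exists (A1 `&` A2); first exact: measurableI.
  by exists (B1 `&` B2); [exact: measurableI|rewrite setXI].
- rewrite (_ : (fun _ => _) = (fun nu : N => nu setT) \o snd).
    exact: (measurableT_comp (measurable_intmeas measurableT) measurable_snd).
  by apply/funext => z /=; congr (z.2 _); apply/seteqP; split=> // x _;
    rewrite /xsection/= inE.
- move=> _ [A mA [B mB <-]].
  rewrite (_ : (fun _ => _) = (fun z : T * N => z.2 B * (\1_A z)%:E)%E).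
    apply: emeasurable_funM.
      exact: (measurableT_comp (measurable_intmeas mB) measurable_snd).
    by apply/measurable_EFinP; exact: measurable_indic.
  apply/funext => z; rewrite indicE.
  have [zA|zA] := boolP (z \in A).
    by rewrite in_xsectionX// mule1.
  by rewrite notin_xsectionX// measure0 mule0.
- move=> S mS IH.
  rewrite (_ : (fun _ => _) =
      (fun z : T * N => z.2 setT - z.2 (xsection S z))%E).
    apply: emeasurable_funB => //.
    exact: (measurableT_comp (measurable_intmeas measurableT) measurable_snd).
  apply/funext => z; have [s nus] := exists_atoms z.2.
  have mSz := measurable_xsection z mS.
  have -> : xsection (~` S) z = ~` xsection S z by rewrite !xsectionE.
  rewrite !nus.2//; last exact: measurableC.
  rewrite -EFinB -sumrB; congr _%:E; apply: eq_bigr => x _.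
  by rewrite !indicE in_setT in_setC; case: (x \in _); rewrite ?subrr ?subr0.
- move=> F mF tF IH.
  rewrite (_ : (fun _ => _) =
      (fun z : T * N => \sum_(k <oo) z.2 (xsection (F k) z))%E).
    by apply: ge0_emeasurable_sum => // k z _ _; exact: measure_ge0.
  apply/funext => z; rewrite xsection_bigcup; apply: measure_semi_bigcup => //.
  - by move=> k; exact: measurable_xsection.
  - exact: trivIset_xsection.
  - by apply: bigcup_measurable => k _; exact: measurable_xsection.
Qed.

Import HBNNSimple.

Lemma measurable_integral_intmeas2 d (T : measurableType d)
    (k : T * Rm -> \bar R) :
  measurable_fun (setT `*` pos) k -> (forall y x, pos x -> (0 <= k (y, x))%E) ->
  measurable_fun setT (fun z : T * N => \int[z.2]_(x in pos) k (z.1, x))%E.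
Proof.
move=> mk k0.
pose k' (w : (T * N) * Rm) := ((k \_ (setT `*` pos)) (w.1.1, w.2)).
have mTpos : measurable (setT `*` pos : set (T * Rm)) by exact: measurableX.
have mk' : measurable_fun setT k'.
  apply: measurableT_comp; first by apply/(measurable_restrictT _ mTpos).
  apply/measurable_fun_pairP; split => /=.
    exact: (measurableT_comp measurable_fst measurable_fst).
  exact: measurable_snd.
have k'0 w : (0 <= k' w)%E.
  by rewrite /k' patchE; case: ifPn => // /set_mem[_]; exact: k0.
rewrite (_ : (fun _ => _) = (fun z : T * N => \int[z.2]_x k' (z, x))%E).
  pose k_ := nnsfun_approx measurableT mk'.
  apply: (@measurable_fun_xsection_integral _ _ (T * N)%type Rm R k' _ k_).
  - by move=> a b ab; exact/nd_nnsfun_approx.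
  - by move=> z; exact/cvg_nnsfun_approx.
  - move=> n r.
    have mkr : measurable (k_ n @^-1` [set r]).
      exact: measurable_funPTI.
    exact: (measurable_intmeas_xsection mkr).
apply/funext => z; rewrite integral_mkcond; apply: eq_integral => x _.
rewrite /k' !patchE; congr (if _ then _ else _).
by apply/idP/idP; rewrite !inE /=; [split|case].
Qed.

End MeasurableEvaluation.

(** * Domination of measures through their Laplace transforms *)

Section Peak.
Context {R : realType}.
Implicit Types (x : R) (b n k : nat).

(** With [y = (b + 1) x], the quotient of the two sides is at most
    [y e^{1 - y}], which is less than [1] for [y] other than [1]. *)
Lemma strict_peak b x : 0 < x <= 1 -> x != b.+1%:R^-1 ->
  x * (1 - x) ^+ b < b.+1%:R^-1 * (1 - b.+1%:R^-1) ^+ b.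
Proof.
case: b => [|b] /andP[x0 x1] xb.
  by rewrite !expr0 !mulr1 invr1 lt_neqAle x1 andbT; rewrite invr1 in xb.
set c : R := b.+2%:R; have c0 : 0 < c by rewrite ltr0Sn.
have cd : c = b.+1%:R + 1 by rewrite /c natr1.
have d0 : 0 < b.+1%:R :> R by rewrite ltr0Sn.
have d1 : b.+1%:R != 0 :> R by rewrite gt_eqF.
have c1 : b.+1%:R + 1 != 0 :> R by rewrite -cd gt_eqF.
pose y := c * x.
have y0 : 0 < y by rewrite mulr_gt0.
have y1 : y - 1 != 0.
  rewrite subr_eq0; apply: contra xb => /eqP h.
  by rewrite -(mulKf (lt0r_neq0 c0) x) -/y h mulr1.
have -> : x = c^-1 * y by rewrite /y mulKf// gt_eqF.
have -> : 1 - c^-1 * y = (1 - c^-1) * (1 + (1 - y) / b.+1%:R).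
  by rewrite cd; field; rewrite nat1r d1 c1.
have cc : 0 < 1 - c^-1.
  by rewrite subr_gt0 invf_lt1// cd ltrDr.
rewrite exprMn mulrACA -[ltRHS]mulr1 ltr_pM2l; last first.
  by rewrite mulr_gt0 ?invr_gt0// exprn_gt0.
apply: (@le_lt_trans _ _ (y * expR (1 - y))).
  apply: ler_wpM2l; first exact: ltW.
  have -> : expR (1 - y) = expR ((1 - y) / b.+1%:R) ^+ b.+1.
    by rewrite -expRM_natl mulrCA divff ?mulr1.
  apply: lerXn2r; rewrite ?nnegrE ?expR_ge0 ?expR_ge1Dx//.
  have : c * x <= c by rewrite ler_piMr// ltW.
  rewrite -/y cd => yc.
  rewrite -lerBlDl sub0r ler_pdivlMr// mulN1r.
  lra.
have := expR_gt1Dx y1; rewrite addrCA subrr addr0 -(opprB y 1) expRN => h.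
by rewrite ltr_pdivrMr ?expR_gt0// mul1r.
Qed.

(** Among the points [2^- k], the powers of [peak n] single out [2^- n] in the
    limit. It is a positive multiple of a product of factors [x] and [1 - x]: at
    [x = e^{- <nu, h>}], multiplication by either of these preserves complete
    monotonicity of Laplace functionals. *)
Definition peak n x : R := x * (1 - x) ^+ (2 ^ n).-1 /
  (2 ^- n * (1 - 2 ^- n) ^+ (2 ^ n).-1).

Lemma peak_den_gt0 n : 0 < 2 ^- n * (1 - 2 ^- n) ^+ (2 ^ n).-1 :> R.
Proof.
apply: mulr_gt0; first by rewrite invr_gt0 exprn_gt0.
case: n => [|n]; first by rewrite expn0 /= expr0.
by rewrite exprn_gt0// subr_gt0 invf_lt1 ?exprn_gt0// exprn_egt1 ?ltr1n.
Qed.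

Lemma peak_pow2 n k : k != n -> 0 <= peak n (2 ^- k) < 1.
Proof.
move=> kn; rewrite /peak ltr_pdivrMr ?peak_den_gt0// mul1r.
have x01 : 0 < (2 ^- k : R) <= 1.
  by rewrite invr_gt0 exprn_gt0//= invf_le1 ?exprn_gt0// exprn_ege1// ler1n.
have /andP[x0 x1] := x01; apply/andP; split.
  by rewrite divr_ge0 ?(ltW (peak_den_gt0 n))// mulr_ge0 ?(ltW x0)//
    exprn_ge0// subr_ge0.
have e : ((2 ^ n).-1.+1%:R^-1 : R) = 2 ^- n.
  by rewrite prednK ?expn_gt0// natrX.
rewrite -e; apply: strict_peak => //; rewrite e.
apply: contra kn => /eqP/invr_inj/ieexprIn -> //.
by rewrite gt_eqF// ltr1n.
Qed.

Lemma peak_id n : peak n (2 ^- n) = 1.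
Proof. by rewrite /peak divff// gt_eqF// peak_den_gt0. Qed.

Lemma cvg_peak n k : peak n (2 ^- k) ^+ m @[m --> \oo] --> ((k == n)%:R : R).
Proof.
have [->|kn] := eqVneq k n.
  by rewrite peak_id; under eq_fun do rewrite expr1n; exact: cvg_cst.
by have /andP[p0 p1] := peak_pow2 kn; apply: cvg_expr; rewrite ger0_norm.
Qed.

Lemma peak_le1 n k : 0 <= peak n (2 ^- k) <= 1.
Proof.
have [->|kn] := eqVneq k n; first by rewrite peak_id ler01 lexx.
by have /andP[-> /ltW ->] := peak_pow2 kn.
Qed.

End Peak.

Section Domination.
Context {R : realType}.
Local Notation Rm := (measurableTypeR R).
Local Notation N := (intmeas R).
Local Notation Bp := (@bounded_borel_pos R).
Local Notation cm := (completely_monotone Bp).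
Implicit Types (nu : N) (f h : R -> R).

Lemma bounded_borel_pos_measurable f : Bp f -> measurable_fun (pos : set Rm) f.
Proof. by case. Qed.

Lemma bounded_borel_posD f h : Bp f -> Bp h -> Bp (f + h).
Proof.
move=> [mf [M [M0 bf]] f0] [mh [K [K0 bh]] h0]; split.
- exact: measurable_funD.
- exists (M + 1 + (K + 1)); split; first exact: num_real.
  move=> y yMK x px /=; rewrite (le_trans (ler_normD _ _))//.
  by rewrite (le_trans _ (ltW yMK))// lerD// ?bf ?bh// ltrDl.
- by move=> x px; rewrite addr_ge0 ?f0 ?h0.
Qed.

Lemma bounded_borel_pos_const (c : R) : 0 <= c -> Bp (fun=> c).
Proof.
move=> c0; split => //.
by exists `|c|; split; [exact: num_real|move=> y yc x _ /=; exact: ltW].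
Qed.

Lemma bounded_borel_pos_indic (A : set Rm) (c : R) : 0 <= c -> measurable A ->
  Bp (fun x => c * \1_A x).
Proof.
move=> c0 mA; split.
- apply: measurable_funTS; apply: (measurable_funM (@measurable_cst _ _ _ _ _ c)).
  exact: measurable_indic.
- exists c; split; first exact: num_real.
  move=> y yc x _ /=; rewrite ger0_norm ?mulr_ge0// (le_trans _ (ltW yc))//.
  by rewrite ler_piMr// indicE; case: (_ \in _).
- by move=> x _; rewrite mulr_ge0.
Qed.

Lemma pair_ge0 nu f : nonneg_on_pos f -> 0 <= pair nu f.
Proof. by move=> f0; apply: Rintegral_ge0 => x; exact: f0. Qed.

Lemma pairD nu f h : Bp f -> Bp h -> pair nu (f + h) = pair nu f + pair nu h.
Proof.
move=> Bf Bh; have [s nus] := exists_atoms nu.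
have Bfh := bounded_borel_posD Bf Bh.
by rewrite !(pair_atoms nus) -?big_split//=; exact: bounded_borel_pos_measurable.
Qed.

Definition expN_pair f nu : R := expR (- pair nu f).

Lemma expN_pairD f h nu : Bp f -> Bp h -> expN_pair (f + h) nu = expN_pair f nu * expN_pair h nu.
Proof. by move=> Bf Bh; rewrite /expN_pair pairD// opprD expRD. Qed.

Lemma expN_pair_itv f nu : Bp f -> 0 <= expN_pair f nu <= 1.
Proof.
by move=> [_ _ f0]; rewrite /expN_pair expR_ge0 expR_le1 oppr_le0 pair_ge0.
Qed.

Lemma measurable_expN_pair f : Bp f -> measurable_fun setT (expN_pair f).
Proof.
move=> [mf _ f0]; apply: measurableT_comp; first exact: measurable_expR.
by apply: measurableT_comp => //; exact: measurable_pair.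
Qed.

Variables (Q I : probability N R) (c : R).

(** Densities [T] for which [T d(Q - c I)] still has a completely monotone
    Laplace transform. The class is stable under the operations that turn the
    density [1] into the indicator of a cylinder. *)
Definition cm_multiplier (T : N -> R) :=
  [/\ measurable_fun setT T, exists M, forall nu, `|T nu| <= M &
      cm (fun f => \int[Q]_nu (expN_pair f nu * T nu)
                   - c * \int[I]_nu (expN_pair f nu * T nu))].

Lemma integrable_expN_pairM (P : probability N R) f (T : N -> R) : Bp f ->
  measurable_fun setT T -> (exists M, forall nu, `|T nu| <= M) ->
  P.-integrable setT (EFin \o (fun nu => expN_pair f nu * T nu)).
Proof.
move=> Bf mT [M TM]; apply: (@bounded_integrable _ _ _ _ _ _ _ _ M) => //.
- by rewrite [X in (X < _)%E]probability_setT ltry.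
- by apply: measurable_funM => //; exact: measurable_expN_pair.
- move=> nu _; rewrite normrM; have /andP[e0 e1] := expN_pair_itv nu Bf.
  by rewrite (ger0_norm e0) (le_trans _ (TM nu))// ler_piMl.
Qed.

(** Multiplying the density by [e^{- <nu, h>}] shifts the functional by [h]. *)
Lemma cm_multiplierM_expN_pair T h : Bp h -> cm_multiplier T ->
  cm_multiplier (fun nu => expN_pair h nu * T nu).
Proof.
move=> Bh [mT [M TM] cT]; split.
- by apply: measurable_funM => //; exact: measurable_expN_pair.
- exists M => nu; rewrite normrM; have /andP[e0 e1] := expN_pair_itv nu Bh.
  by rewrite (ger0_norm e0) (le_trans _ (TM nu))// ler_piMl.
- move=> n; apply: cm_upto_eq (cm_upto_shift bounded_borel_posD Bh (cT n)).
    exact: bounded_borel_posD.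
  move=> f Bf; congr (_ - c * _); apply: eq_Rintegral => nu _;
    by rewrite expN_pairD// mulrA.
Qed.

(** Multiplying the density by [1 - e^{- <nu, h>}] takes the difference
    [diff h] of the functional. *)
Lemma cm_multiplierM_onem T h : Bp h -> cm_multiplier T ->
  cm_multiplier (fun nu => (1 - expN_pair h nu) * T nu).
Proof.
move=> Bh [mT bT cT]; have [M TM] := bT; split.
- apply: measurable_funM => //; apply: measurable_funB; first exact: measurable_cst.
  exact: measurable_expN_pair.
- exists M => nu; rewrite normrM; have /andP[e0 e1] := expN_pair_itv nu Bh.
  rewrite ger0_norm ?subr_ge0// (le_trans _ (TM nu))// ler_piMl//.
  by rewrite lerBlDr lerDl.
- apply: cm_eq (cm_diff Bh cT); first exact: bounded_borel_posD.
  move=> f Bf; rewrite /diff.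
  have split (P : probability N R) :
      \int[P]_nu (expN_pair f nu * ((1 - expN_pair h nu) * T nu)) =
      \int[P]_nu (expN_pair f nu * T nu) - \int[P]_nu (expN_pair (f + h) nu * T nu).
    rewrite -RintegralB//; try exact: integrable_expN_pairM.
      by apply: eq_Rintegral => nu _; rewrite expN_pairD//; ring.
    by apply: integrable_expN_pairM => //; exact: bounded_borel_posD.
  have alg (a b a' b' : R) :
    a - c * b - (a' - c * b') = a - a' - c * (b - b') by ring.
  by rewrite (split Q) (split I); exact: alg.
Qed.

Lemma cm_multiplierZ T k : 0 <= k -> cm_multiplier T ->
  cm_multiplier (fun nu => k * T nu).
Proof.
move=> k0 [mT bT cT]; have [M TM] := bT; split.
- by apply: measurable_funM => //; exact: measurable_cst.
- exists (k * M) => nu; rewrite normrM ger0_norm//.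
  exact: ler_wpM2l.
- apply: cm_eq (cmZ _ k0 cT); try exact: bounded_borel_posD.
  move=> f Bf; have split (P : probability N R) :
      \int[P]_nu (expN_pair f nu * (k * T nu)) = k * \int[P]_nu (expN_pair f nu * T nu).
    rewrite -RintegralZl//; last exact: integrable_expN_pairM.
    by apply: eq_Rintegral => nu _; rewrite mulrCA.
  by rewrite (split Q) (split I) mulrBr mulrCA.
Qed.

Lemma cm_multiplier_cvg (T_ : nat -> N -> R) T M :
  (forall n, cm_multiplier (T_ n)) -> (forall n nu, `|T_ n nu| <= M) ->
  (forall nu, T_ n nu @[n --> \oo] --> T nu) -> cm_multiplier T.
Proof.
move=> cT TM TT; split.
- by apply: (measurable_fun_cvg (h := T_)) => [n|nu _]; [case: (cT n)|exact: TT].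
- exists M => nu; apply: (cvgr_to_le (cvg_norm (TT nu))).
  by apply: nearW => n; exact: TM.
- apply: (@cm_lim _ _ _ bounded_borel_posD (fun n f => \int[Q]_nu (expN_pair f nu * T_ n nu) -
      c * \int[I]_nu (expN_pair f nu * T_ n nu))) => [n|f Bf]; first by case: (cT n).
  have cvgP (P : probability N R) :
      \int[P]_nu (expN_pair f nu * T_ n nu) @[n --> \oo] -->
      \int[P]_nu (expN_pair f nu * T nu).
    apply: (@bounded_cvg_Rintegral _ _ _ _ _ _ _ _ _ M) => //.
    + by rewrite [X in (X < _)%E]probability_setT ltry.
    + move=> n; apply: measurable_funM; first exact: measurable_expN_pair.
      by case: (cT n).
    + move=> n nu _; rewrite normrM; have /andP[e0 e1] := expN_pair_itv nu Bf.
      by rewrite (ger0_norm e0) (le_trans _ (TM n nu))// ler_piMl.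
    + by move=> nu _; apply: cvgM; [exact: cvg_cst|exact: TT].
  by apply: cvgB; [exact: cvgP|apply: cvgM; [exact: cvg_cst|exact: cvgP]].
Qed.

Definition point_count nu (A : set Rm) : nat := Num.trunc (fine (nu A)).

Lemma point_countE nu A : measurable A -> nu A = (point_count nu A)%:R%:E.
Proof.
move=> mA; have [k] := @intmeas_int _ nu A mA; rewrite /point_count => ->.
by rewrite /= natrK.
Qed.

Lemma expN_pair_pow2 nu (A : set Rm) : measurable A ->
  expN_pair (fun x => ln 2 * \1_A x) nu = 2 ^- point_count nu A.
Proof.
move=> mA; have [s nus] := exists_atoms nu.
rewrite /expN_pair (pair_atoms nus); last first.
  by apply: bounded_borel_pos_measurable; apply: bounded_borel_pos_indic => //;
    apply: ln_ge0; rewrite ler1n.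
have := nus.2 _ mA; rewrite point_countE// => -[cntA].
rewrite -mulr_sumr -cntA expRN expRM_natr lnK ?posrE//.
Qed.

(** For [h = ln 2] on [A], the value of [e^{- <nu, h>}] is [2] to the power
    minus the number of points in [A], which the peak functions identify. *)
Lemma cm_multiplier_point_count T A n : measurable A -> cm_multiplier T ->
  cm_multiplier (fun nu => (point_count nu A == n)%:R * T nu).
Proof.
move=> mA cT; pose h (x : R) := ln 2 * \1_A x : R.
have Bh : Bp h.
  by apply: bounded_borel_pos_indic => //; apply: ln_ge0; rewrite ler1n.
have cX m S : cm_multiplier S ->
    cm_multiplier (fun nu => (1 - expN_pair h nu) ^+ m * S nu).
  move=> cS; elim: m => [|m IH].
    by rewrite (_ : (fun _ => _) = S)//; apply/funext => nu; rewrite mul1r.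
  have := cm_multiplierM_onem Bh IH; congr cm_multiplier.
  by apply/funext => nu; rewrite mulrA -exprS.
have cP m : cm_multiplier (fun nu => peak n (expN_pair h nu) ^+ m * T nu).
  elim: m => [|m IH].
    by rewrite (_ : (fun _ => _) = T)//; apply/funext => nu; rewrite mul1r.
  pose k : R := (2 ^- n * (1 - 2 ^- n) ^+ (2 ^ n).-1)^-1.
  have k0 : 0 <= k by rewrite invr_ge0 ltW// peak_den_gt0.
  have := cm_multiplierZ k0 (cm_multiplierM_expN_pair Bh (cX (2 ^ n).-1 _ IH)).
  congr cm_multiplier; apply/funext => nu.
  by rewrite exprS [X in (X * _) * _]/peak -/k; ring.
have [_ [M TM] _] := cT.
apply: (cm_multiplier_cvg (M := M) cP) => [m nu|nu].
  rewrite expN_pair_pow2// normrM normrX.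
  have /andP[p0 p1] := @peak_le1 R n (point_count nu A).
  rewrite (le_trans _ (TM nu))// ler_piMl// exprn_ile1//.
  by rewrite ger0_norm.
by rewrite expN_pair_pow2//; apply: cvgM; [exact: cvg_peak|exact: cvg_cst].
Qed.

Definition cylinder (As : seq (set Rm)) (S : set (seq nat)) : set N :=
  [set nu | S (map (point_count nu) As)].

Lemma measurable_point_count_eq A n : measurable A -> measurable [set nu | point_count nu A = n].
Proof.
move=> mA; rewrite (_ : mkset _ = (fun nu : N => nu A) @^-1` [set n%:R%:E]).
  by rewrite -[X in measurable X]setTI; exact: measurable_intmeas.
apply/seteqP; split=> nu /=; rewrite point_countE//; first by move=> ->.
by move=> -[/eqP]; rewrite eqr_nat => /eqP.
Qed.

Lemma measurable_cylinder_atom As ns : (forall A, A \in As -> measurable A) ->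
  measurable (cylinder As [set ns]).
Proof.
elim: As ns => [|A As IH] ns mAs.
  case: ns => [|k ns]; last first.
    by rewrite (_ : cylinder _ _ = set0); [exact: measurable0|
      apply/seteqP; split=> nu].
  by rewrite (_ : cylinder _ _ = setT); [exact: measurableT|
    apply/seteqP; split=> nu].
case: ns => [|k ns].
  by rewrite (_ : cylinder _ _ = set0); [exact: measurable0|
    apply/seteqP; split=> nu].
rewrite (_ : cylinder _ _ = [set nu | point_count nu A = k] `&` cylinder As [set ns]).
  apply: measurableI; first by apply: measurable_point_count_eq; apply: mAs; rewrite mem_head.
  by apply: IH => B BAs; apply: mAs; rewrite inE BAs orbT.
by apply/seteqP; split=> nu; rewrite /cylinder/= => -[-> ->].
Qed.

Hypothesis cmQI : cm (fun f => \int[Q]_nu expN_pair f nu - c * \int[I]_nu expN_pair f nu).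

Lemma cm_multiplier_atom As ns : (forall A, A \in As -> measurable A) ->
  cm_multiplier \1_(cylinder As [set ns]).
Proof.
have c1 : cm_multiplier (fun=> 1).
  split; first exact: measurable_cst.
    by exists 1 => nu; rewrite normr1.
  apply: cm_eq cmQI; first exact: bounded_borel_posD.
  by move=> f Bf; congr (_ - c * _); apply: eq_Rintegral => nu _; rewrite mulr1.
have c0 : cm_multiplier (fun=> 0).
  have := cm_multiplierZ (lexx 0) c1; congr cm_multiplier.
  by apply/funext => nu; rewrite mul0r.
elim: As ns => [|A As IH] ns mAs.
  case: ns => [|k ns].
    move: c1; congr cm_multiplier; apply/funext => nu.
    by rewrite indicE mem_set.
  move: c0; congr cm_multiplier; apply/funext => nu.
  by rewrite indicE memNset.
case: ns => [|k ns].
  move: c0; congr cm_multiplier; apply/funext => nu.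
  by rewrite indicE memNset.
have mA : measurable A by apply: mAs; rewrite mem_head.
have mAs' B : B \in As -> measurable B by move=> BAs; apply: mAs; rewrite inE BAs orbT.
have := cm_multiplier_point_count k mA (IH ns mAs'); congr cm_multiplier.
apply/funext => nu; rewrite !indicE -natrM mulnb; congr (nat_of_bool _)%:R.
apply/andP/idP => [[/eqP kA]|]; rewrite !inE /cylinder /=; first by rewrite kA => ->.
by move=> -[-> ->].
Qed.

Hypothesis c_gt0 : 0 < c.

Lemma domination_atom As ns : (forall A, A \in As -> measurable A) ->
  (c%:E * I (cylinder As [set ns]) <= Q (cylinder As [set ns]))%E.
Proof.
move=> mAs; have mC := measurable_cylinder_atom ns mAs.
have [_ _ cA] := cm_multiplier_atom ns mAs.
have := cm_ge0 cA (bounded_borel_pos_const (lexx 0)).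
have e1 nu : expN_pair (fun=> 0) nu = 1.
  by rewrite /expN_pair /pair Rintegral_cst// mul0r oppr0 expR0.
have int1 (P : probability N R) :
    \int[P]_nu (expN_pair (fun=> 0) nu * \1_(cylinder As [set ns]) nu) =
    fine (P (cylinder As [set ns])).
  by under eq_Rintegral do rewrite e1 mul1r; rewrite /Rintegral integral_indic// setIT.
rewrite !int1 subr_ge0 -lee_fin EFinM !fineK//; exact: fin_num_measure.
Qed.

Lemma cylinder_bigcup As (S : set (seq nat)) : cylinder As S =
  \bigcup_k (if pickle_inv k is Some ns then
    if ns \in S then cylinder As [set ns] else set0 else set0).
Proof.
apply/seteqP; split=> [nu Snu|nu [k _]]; last first.
  by case: pickle_inv => // ns; case: ifPn => //; rewrite inE /cylinder/= => Sns ->.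
by exists (pickle (map (point_count nu) As)) => //; rewrite pickleK_inv mem_set.
Qed.

Lemma measurable_cylinder As S : (forall A, A \in As -> measurable A) ->
  measurable (cylinder As S).
Proof.
move=> mAs; rewrite cylinder_bigcup; apply: bigcupT_measurable => k.
case: pickle_inv => [ns|//]; case: ifP => // _; exact: measurable_cylinder_atom.
Qed.

Lemma domination_cylinder As S : (forall A, A \in As -> measurable A) ->
  (c%:E * I (cylinder As S) <= Q (cylinder As S))%E.
Proof.
move=> mAs; rewrite cylinder_bigcup; set F := fun k => _.
have mF k : measurable (F k).
  by rewrite /F; case: pickle_inv => [ns|//]; case: ifP => // _;
    exact: measurable_cylinder_atom.
have tF : trivIset setT F.
  apply/trivIsetP => i j _ _ ij; apply/seteqP; split=> // nu [].
  have Fi k : F k nu -> k = pickle (map (point_count nu) As).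
    rewrite /F; have := @pickle_invK (seq nat) k.
    by case: pickle_inv => [ns /= <-|//]; case: ifP => // _ <-.
  by move=> /Fi iE /Fi jE; move: ij; rewrite iE jE eqxx.
have sumE (P : probability N R) :
    P (\bigcup_k F k) = (\sum_(k <oo) P (F k))%E.
  by apply: measure_semi_bigcup => //; exact: bigcupT_measurable.
rewrite (sumE I) (sumE Q) -nneseriesZl//.
apply: lee_nneseries => [k * |k *].
  by rewrite mule_ge0// lee_fin ltW.
rewrite /F; case: pickle_inv => [ns|]; last by rewrite !measure0 mule0.
by case: ifP => _; [exact: domination_atom|rewrite !measure0 mule0].
Qed.

Definition cylinders : set (set N) := [set C | exists As S,
  (forall A, A \in As -> measurable A) /\ C = cylinder As S].

Lemma setring_cylinders : setring cylinders.
Proof.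
have op (f : Prop -> Prop -> Prop) As S Bs S' :
    (forall A, A \in As -> measurable A) -> (forall A, A \in Bs -> measurable A) ->
    cylinders [set nu | f (cylinder As S nu) (cylinder Bs S' nu)].
  move=> mAs mBs; exists (As ++ Bs).
  exists [set ns | f (S (take (size As) ns)) (S' (drop (size As) ns))]; split.
    by move=> A; rewrite mem_cat => /orP[/mAs|/mBs].
  apply/seteqP; split=> nu; rewrite /cylinder/= map_cat.
    by rewrite take_size_cat ?size_map// drop_size_cat ?size_map.
  by rewrite take_size_cat ?size_map// drop_size_cat ?size_map.
split.
- by exists [::], set0; split=> //; apply/seteqP; split.
- move=> _ _ [As [S [mAs ->]]] [Bs [S' [mBs ->]]].
  exact: (op (fun P P' => P \/ P')).
- move=> _ _ [As [S [mAs ->]]] [Bs [S' [mBs ->]]].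
  exact: (op (fun P P' => P /\ ~ P')).
Qed.

(** A difference of two measures with a completely monotone Laplace functional
    is positive. The inequality holds on the ring of cylinders of counts and
    passes to monotone limits, but not to complements: hence the detour through
    the generated sigma-ring. *)
Lemma domination_borel (C : set N) : measurable C -> (c%:E * I C <= Q C)%E.
Proof.
move=> mC; pose H := [set C : set N | measurable C /\ (c%:E * I C <= Q C)%E].
suff : H C by case.
have cylC : <<sr cylinders>> C.
  have [sr0 srD srU] := smallest_sigma_ring cylinders.
  have srT : <<sr cylinders>> setT.
    by apply: sub_g_sigma_ring; exists [::], setT; split=> //; apply/seteqP; split.
  have := borel_count_sets mC; apply: smallest_sub.
    by split=> // A mA; exact: srD.
  move=> _ [A [mA [n ->]]]; apply: sub_g_sigma_ring.
  exists [:: A], [set [:: n]]; split=> [B|]; first by rewrite inE => /eqP ->.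
  apply/seteqP; split=> nu; rewrite /cylinder/= point_countE//.
    by move=> -[/eqP]; rewrite eqr_nat => /eqP ->.
  by move=> -[->].
have cvgI (F : nat -> set N) U : I \o F @ \oo --> I U ->
    (c%:E * I (F k))%E @[k --> \oo] --> (c%:E * I U)%E.
  by move=> h; apply: cvgeZl.
apply: monotone_setring_sub_g_sigma_ring cylC.
- split=> F ndF HF; have mF k : measurable (F k) by case: (HF k).
  + have mU : measurable (\bigcup_k F k) by exact: bigcupT_measurable.
    have cvgP (P : probability N R) : P \o F @ \oo --> P (\bigcup_k F k).
      exact: nondecreasing_cvg_mu.
    split=> //.
    by apply: (lee_cvg_to (cvgI F _ (cvgP I)) (cvgP Q)); apply: nearW => k; case: (HF k).
  + have mU : measurable (\bigcap_k F k) by exact: bigcapT_measurable.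
    have fin (P : probability N R) : (P (F 0%N) < +oo)%E.
      by apply: (@le_lt_trans _ _ 1%E); [exact: probability_le1|exact: ltry].
    have cvgP (P : probability N R) : P \o F @ \oo --> P (\bigcap_k F k).
      by apply: nonincreasing_cvg_mu => //; exact: fin.
    split=> //.
    by apply: (lee_cvg_to (cvgI F _ (cvgP I)) (cvgP Q)); apply: nearW => k; case: (HF k).
- exact: setring_cylinders.
- move=> _ [As [S [mAs ->]]]; split; first exact: measurable_cylinder.
  exact: domination_cylinder.
Qed.

End Domination.

(** * Dominated sequences of probability measures *)

Section DominatedIntegral.
Context {R : realType} d {T : measurableType d}.
Variables (P I : probability T R) (c : R).
Hypothesis c_ge0 : 0 <= c.
Hypothesis cIP : forall C, measurable C -> (c%:E * I C <= P C)%E.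

Lemma domination_le1 : c <= 1.
Proof.
by have := cIP measurableT; rewrite !probability_setT mule1 lee_fin.
Qed.

Let ge0_domination (f : T -> R) M : measurable_fun setT f ->
  (forall x, 0 <= f x <= M) -> c * \int[I]_x f x <= \int[P]_x f x.
Proof.
move=> mf fM.
have fin (Q : probability T R) : Q.-integrable setT (EFin \o f).
  apply: (@ge0_bounded_integrable _ _ _ _ _ _ _ _ M) => //.
  by rewrite [X in (X < _)%E]probability_setT ltry.
have f0 x : (0 <= (f x)%:E)%E by rewrite lee_fin; case/andP: (fM x).
have mEf : measurable_fun setT (EFin \o f) by exact/measurable_EFinP.
rewrite -lee_fin EFinM (EFin_Rintegral measurableT (fin P))
  (EFin_Rintegral measurableT (fin I)).
have := @ge0_le_measure_integral _ _ _ (mscale (NngNum c_ge0) I) P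
  (fun S mS => cIP mS) (EFin \o f) setT measurableT f0 mEf.
by rewrite ge0_integral_mscale// => x _; exact: f0.
Qed.

(** [P - c I] is a positive measure of mass [1 - c]. *)
Lemma dominated_Rintegral (f : T -> R) M : measurable_fun setT f ->
  (forall x, `|f x| <= M) ->
  `|\int[P]_x f x - \int[I]_x f x| <= 2 * M * (1 - c).
Proof.
move=> mf fM.
have PT (Q : probability T R) : (Q setT < +oo)%E.
  by rewrite [X in (X < _)%E]probability_setT ltry.
have fin (Q : probability T R) : Q.-integrable setT (EFin \o f).
  exact: (bounded_integrable measurableT (PT Q) mf (fun x _ => fM x)).
have finM (Q : probability T R) : Q.-integrable setT (EFin \o (fun=> M)).
  apply: (bounded_integrable (M := `|M|) measurableT (PT Q)) => //.
have M1 (Q : probability T R) : \int[Q]_x M = M.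
  by rewrite Rintegral_cst// [X in fine X]probability_setT mulr1.
have mM : measurable_fun [set: T] (fun=> M) by exact: measurable_cst.
have fM' x : - M <= f x <= M by rewrite -ler_norml.
have up : c * \int[I]_x (M + f x) <= \int[P]_x (M + f x).
  apply: (@ge0_domination _ (M + M)); first exact: measurable_funD.
  by move=> x; have := fM' x; lra.
have dn : c * \int[I]_x (M - f x) <= \int[P]_x (M - f x).
  apply: (@ge0_domination _ (M + M)); first exact: measurable_funB.
  by move=> x; have := fM' x; lra.
have up0 : 0 <= \int[I]_x (M + f x).
  by apply: Rintegral_ge0 => x _; have := fM' x; lra.
have dn0 : 0 <= \int[I]_x (M - f x).
  by apply: Rintegral_ge0 => x _; have := fM' x; lra.
have c1 := domination_le1.
have sD (Q : probability T R) : \int[Q]_x (M + f x) = M + \int[Q]_x f x.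
  by rewrite (RintegralD measurableT (finM Q) (fin Q)) M1.
have sB (Q : probability T R) : \int[Q]_x (M - f x) = M - \int[Q]_x f x.
  by rewrite (RintegralB measurableT (finM Q) (fin Q)) M1.
move: up dn up0 dn0; rewrite !sD !sB.
set p := \int[P]_x f x; set i := \int[I]_x f x => up dn up0 dn0.
by rewrite ler_norml; apply/andP; split; nra.
Qed.

End DominatedIntegral.

Section LimitProbability.
Context {R : realType} d {T : measurableType d}.
Variables (I_ : nat -> probability T R) (c_ : nat -> R).
Hypothesis c_cvg : c_ n @[n --> \oo] --> (1 : R).
Hypothesis I_dom : forall n m C, (n <= m)%N -> measurable C ->
  ((c_ n)%:E * I_ n C <= I_ m C)%E.
Implicit Types C : set T.

Let fineI n C : measurable C -> I_ n C = (fine (I_ n C))%:E.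
Proof. by move=> mC; rewrite fineK//; exact: fin_num_measure. Qed.

Let c_le1 n : c_ n <= 1.
Proof.
by have := I_dom (leqnn n) measurableT; rewrite probability_setT mule1 lee_fin.
Qed.

Let fineI_itv n C : measurable C -> 0 <= fine (I_ n C) <= 1.
Proof.
move=> mC; rewrite fine_ge0 ?measure_ge0//= -lee_fin -fineI//.
exact: probability_le1.
Qed.

Let fineIC n C : measurable C -> fine (I_ n (~` C)) = 1 - fine (I_ n C).
Proof.
move=> mC; rewrite probability_setC// fineB//; exact: fin_num_measure.
Qed.

Let I_dist n m C : (n <= m)%N -> measurable C ->
  `|fine (I_ m C) - fine (I_ n C)| <= 1 - c_ n.
Proof.
move=> nm mC; have mC' := measurableC mC.
have := I_dom nm mC; have := I_dom nm mC'.
rewrite (fineI n mC) (fineI m mC) (fineI n mC') (fineI m mC') !fineIC//.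
rewrite -!EFinM !lee_fin ler_norml.
have /andP[] := fineI_itv n mC; have /andP[] := fineI_itv m mC.
have := c_le1 n.
by move=> *; apply/andP; split; nra.
Qed.

Let cvgI C : measurable C -> cvgn (fun n => fine (I_ n C)).
Proof.
move=> mC; apply/cauchy_cvgP/cauchy_exP => e e0.
move/cvgrPdist_lt : c_cvg => /(_ e e0)[n _ nP].
exists (fine (I_ n C)).
suff : \forall m \near \oo, ball (fine (I_ n C)) e (fine (I_ m C)) by [].
near=> m; rewrite -ball_normE /= distrC.
apply: le_lt_trans (I_dist _ mC) _; first by near: m; exact: nbhs_infty_ge.
by have := nP n (leqnn n); apply: le_lt_trans; exact: ler_norm.
Unshelve. all: by end_near. Qed.

Definition lim_prob C : \bar R :=
  if `[< measurable C >] then (limn (fun n => fine (I_ n C)))%:E else 0%E.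

Let e C := limn (fun n => fine (I_ n C)).

Let lim_probE C : measurable C -> lim_prob C = (e C)%:E.
Proof. by rewrite /lim_prob; case: asboolP. Qed.

Let e_ge0 C : measurable C -> 0 <= e C.
Proof.
move=> mC; apply: limr_ge; first exact: cvgI.
by apply: nearW => n; case/andP: (fineI_itv n mC).
Qed.

Let e_dist n C : measurable C -> `|e C - fine (I_ n C)| <= 1 - c_ n.
Proof.
move=> mC.
have : (fun m => `|fine (I_ m C) - fine (I_ n C)|) @ \oo -->
    `|e C - fine (I_ n C)|.
  by apply: cvg_norm; apply: cvgB; [exact: cvgI|exact: cvg_cst].
move=> /cvgr_to_le; apply; near=> m; apply: I_dist => //.
by near: m; exact: nbhs_infty_ge.
Unshelve. all: by end_near. Qed.

Let lim_prob0 : lim_prob set0 = 0%E.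
Proof.
rewrite lim_probE// /e; under eq_fun do rewrite measure0.
by rewrite lim_cst.
Qed.

Let lim_prob_ge0 C : (0 <= lim_prob C)%E.
Proof.
by rewrite /lim_prob; case: asboolP => // mC; rewrite lee_fin; exact: e_ge0.
Qed.

Let e_sum (F : nat -> set T) k : (forall i, measurable (F i)) ->
  trivIset setT F -> \sum_(0 <= i < k) e (F i) = e (\big[setU/set0]_(i < k) F i).
Proof.
move=> mF tF; rewrite {2}/e (_ : (fun _ => _) =
    (fun n => \sum_(0 <= i < k) fine (I_ n (F i)))).
  apply/esym/cvg_lim => //; apply: cvg_sumr => i; exact: cvgI.
apply/funext => n; apply: EFin_inj; rewrite -fineI; last exact: bigsetU_measurable.
rewrite measure_semi_additive//; last exact: bigsetU_measurable.
by rewrite -sumEFin big_mkord; apply: eq_bigr => i _; rewrite -fineI.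
Qed.

Let lim_prob_sigma_additive : semi_sigma_additive lim_prob.
Proof.
move=> F mF tF mUF; rewrite lim_probE//.
rewrite (_ : (fun k => _) = EFin \o (fun k => \sum_(0 <= i < k) e (F i))); last first.
  apply/funext => k /=; rewrite -sumEFin; apply: eq_bigr => i _.
  exact: lim_probE.
apply: cvg_EFin; first exact: nearW.
apply/cvgrPdist_lt => eps eps0.
have eps3 : 0 < eps / 3 by rewrite divr_gt0.
move/cvgrPdist_lt : c_cvg => /(_ _ eps3)[n _ nP].
have cn : 1 - c_ n < eps / 3.
  by have := nP n (leqnn n); apply: le_lt_trans; exact: ler_norm.
have : (fun k => \sum_(0 <= i < k) I_ n (F i))%E @ \oo -->
    (fine (I_ n (\bigcup_i F i)))%:E.
  by rewrite -fineI//; exact: measure_semi_sigma_additive.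
move=> /fine_cvgP[_ /cvgrPdist_lt/(_ _ eps3)].
apply: filterS => k /=; rewrite e_sum//.
set Bk := \big[setU/set0]_(i < k) F i.
have mBk : measurable Bk by exact: bigsetU_measurable.
have -> : fine (\sum_(0 <= i < k) I_ n (F i))%E = fine (I_ n Bk).
  by rewrite big_mkord -measure_semi_additive.
have := e_dist n mUF; have := e_dist n mBk; rewrite !ltr_norml !ler_norml.
by move=> /andP[? ?] /andP[? ?] /andP[? ?]; apply/andP; split; lra.
Qed.

HB.instance Definition _ := isMeasure.Build _ _ _ lim_prob
  lim_prob0 lim_prob_ge0 lim_prob_sigma_additive.

Let lim_prob_setT : lim_prob setT = 1%E.
Proof.
rewrite lim_probE// /e; under eq_fun do rewrite probability_setT.
by rewrite lim_cst.
Qed.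

HB.instance Definition _ := Measure_isProbability.Build _ _ _ lim_prob
  lim_prob_setT.

(** Domination with constants tending to [1] makes the sequence Cauchy in total
    variation, so that the setwise limit is countably additive. *)
Lemma limit_probability : exists eta : probability T R,
  forall n C, measurable C -> ((c_ n)%:E * I_ n C <= eta C)%E.
Proof.
exists (lim_prob : probability T R) => n C mC.
rewrite [X in (_ <= X)%E]lim_probE// fineI// -EFinM lee_fin.
apply: limr_ge; first exact: cvgI.
near=> m; rewrite -lee_fin EFinM -!fineI//; apply: I_dom => //.
by near: m; exact: nbhs_infty_ge.
Unshelve. all: by end_near. Qed.

End LimitProbability.

(** * The cumulant semigroup through Picard iteration *)

Section GeneratingFunction.
Context {R : realType}.
Variable p : R -> nat -> R.
Hypothesis hp : offspring_law p.
Implicit Types (x z : R).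

Definition real_mean_offspring x : R := fine (mean_offspring p x).

Let p_ge0 x i : pos x -> 0 <= p x i.
Proof. by case: hp => + _ _ _ => /[apply] -[]. Qed.

Let p_sum x : pos x -> (\sum_(i <oo) (p x i)%:E = 1)%E.
Proof. by case: hp => + _ _ _ => /[apply] -[]. Qed.

Lemma mean_offspring_bounded :
  exists2 M : R, 0 <= M & forall x, pos x -> (mean_offspring p x <= M%:E)%E.
Proof.
have [_ _ + _] := hp; set s := ereal_sup _ => sfin.
have s0 x : pos x -> (0 <= mean_offspring p x)%E.
  by move=> px; apply: nneseries_ge0 => i _ _; rewrite lee_fin mulr_ge0// p_ge0.
have us x : pos x -> (mean_offspring p x <= s)%E.
  by move=> px; apply: ereal_sup_ubound; exists x.
have p1 : pos (1 : R) by rewrite /pos/= in_itv/= ltr01.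
have s0' : (0 <= s)%E by apply: le_trans (us _ p1); exact: s0.
exists (fine s); first exact: fine_ge0.
by move=> x px; rewrite fineK ?us// ge0_fin_numE.
Qed.

Lemma mean_offspringE x : pos x -> mean_offspring p x = (real_mean_offspring x)%:E.
Proof.
move=> px; have [M M0 /(_ x px) xM] := mean_offspring_bounded.
rewrite /real_mean_offspring fineK// ge0_fin_numE; first by apply: le_lt_trans xM (ltry _).
by apply: nneseries_ge0 => i _ _; rewrite lee_fin mulr_ge0// p_ge0.
Qed.

Lemma real_mean_offspring_ge0 x : pos x -> 0 <= real_mean_offspring x.
Proof.
move=> px; apply: fine_ge0; apply: nneseries_ge0 => i _ _.
by rewrite lee_fin mulr_ge0// p_ge0.
Qed.

Let psum_le1 x n : pos x -> \sum_(0 <= i < n) p x i <= 1.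
Proof.
move=> px; rewrite -lee_fin -sumEFin -(p_sum px).
by apply: nneseries_lim_ge => i _ _; rewrite lee_fin p_ge0.
Qed.

Let msum_le x n : pos x -> \sum_(0 <= i < n) i%:R * p x i <= real_mean_offspring x.
Proof.
move=> px; rewrite -lee_fin -mean_offspringE// -sumEFin.
case: n => [|n].
  rewrite big_nil; apply: nneseries_ge0 => i _ _.
  by rewrite lee_fin mulr_ge0// p_ge0.
rewrite big_nat_recl// mul0r add0e.
rewrite -(big_add1 _ _ 0 n.+1 xpredT (fun i => (i%:R * p x i)%:E)).
by apply: nneseries_lim_ge => i _ _; rewrite lee_fin mulr_ge0// p_ge0.
Qed.

Lemma cvg_genfun x z : pos x -> 0 <= z <= 1 ->
  series (fun i => p x i * z ^+ i) @ \oo --> genfun p x z.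
Proof.
move=> px /andP[z0 z1]; apply: nondecreasing_is_cvgn.
  apply/nondecreasing_seqP => n; rewrite -subr_ge0 seriesSB.
  by rewrite mulr_ge0 ?p_ge0// exprn_ge0.
exists 1 => _ [n _ <-]; apply: le_trans (psum_le1 n px).
by apply: ler_sum => i _; rewrite ler_piMr ?p_ge0// exprn_ile1.
Qed.

Lemma genfun_itv x z : pos x -> 0 <= z <= 1 -> 0 <= genfun p x z <= 1.
Proof.
move=> px zz; have h := cvg_genfun px zz; have /andP[z0 z1] := zz.
apply/andP; split.
  apply: (cvgr_to_ge h); apply: nearW => n; apply: sumr_ge0 => i _.
  by rewrite mulr_ge0 ?p_ge0// exprn_ge0.
apply: (cvgr_to_le h); apply: nearW => n; apply: le_trans (psum_le1 n px).
by apply: ler_sum => i _; rewrite ler_piMr ?p_ge0// exprn_ile1.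
Qed.

Lemma genfun1 x : pos x -> genfun p x 1 = 1.
Proof.
move=> px; have := cvg_genfun px; move=> /(_ 1); rewrite ler01 lexx => /(_ isT) h.
apply: (cvg_unique _ h) => //.
rewrite /series/=; under eq_fun do under eq_bigr do rewrite expr1n mulr1.
have : (fun n => \sum_(0 <= i < n) (p x i)%:E)%E @ \oo --> 1%:E.
  rewrite -[X in _ --> X](p_sum px); apply: is_cvg_ereal_nneg_natsum => i _.
  by rewrite lee_fin p_ge0.
under eq_fun do rewrite sumEFin.
by move/fine_cvgP => [].
Qed.

(** Termwise, [z^i - y^i <= i (z - y)]. *)
Lemma genfun_lipschitz x y z : pos x -> 0 <= y -> y <= z -> z <= 1 ->
  0 <= genfun p x z - genfun p x y <= real_mean_offspring x * (z - y).
Proof.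
move=> px y0 yz z1.
have z0 := le_trans y0 yz; have y1 := le_trans yz z1.
have h : (fun n => series (fun i => p x i * z ^+ i) n -
    series (fun i => p x i * y ^+ i) n) @ \oo --> genfun p x z - genfun p x y.
  by apply: cvgB; apply: cvg_genfun; rewrite ?y0 ?z0.
have Xle i : y ^+ i <= z ^+ i by rewrite lerXn2r.
have Xlip i : z ^+ i - y ^+ i <= i%:R * (z - y).
  elim: i => [|i IH]; first by rewrite !expr0 mul0r subrr.
  have : 0 <= y ^+ i <= 1 by rewrite exprn_ge0// exprn_ile1.
  have : 0 <= z ^+ i - y ^+ i by rewrite subr_ge0.
  rewrite !exprS -natr1; move: IH; nra.
apply/andP; split.
  apply: (cvgr_to_ge h); apply: nearW => n; rewrite /= subr_ge0.
  by apply: ler_sum => i _; rewrite ler_wpM2l// p_ge0.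
apply: (cvgr_to_le h); apply: nearW => n /=.
apply: (@le_trans _ _ (\sum_(0 <= i < n) (i%:R * p x i) * (z - y))).
  rewrite /series/= -sumrB; apply: ler_sum => i _.
  by rewrite -mulrBr mulrAC mulrC ler_wpM2r// p_ge0.
by rewrite -mulr_suml ler_wpM2r ?subr_ge0// msum_le.
Qed.

End GeneratingFunction.

Section FubiniMeasurability.
Context {R : realType} d1 d2 {X : measurableType d1} {Y : measurableType d2}.

Lemma measurable_param_integral (mu : {sigma_finite_measure set Y -> \bar R})
    (D : set Y) (k : X * Y -> \bar R) : measurable D ->
  (forall x y, D y -> (0 <= k (x, y))%E) -> measurable_fun (setT `*` D) k ->
  measurable_fun setT (fun x => \int[mu]_(y in D) k (x, y))%E.
Proof.
move=> mD k0 mk; pose k' := (k \_ (setT `*` D)).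
have mTD : measurable (setT `*` D : set (X * Y)) by exact: measurableX.
have mk' : measurable_fun setT k' by apply/(measurable_restrictT _ mTD).
have k'0 z : (0 <= k' z)%E.
  by case: z => x y; rewrite /k' patchE; case: ifPn => // /set_mem[_]; exact: k0.
have := measurable_fun_fubini_tonelli_F (m2 := mu) k' mk' k'0.
rewrite /fubini_F; congr measurable_fun; apply/funext => x.
rewrite [RHS]integral_mkcond; apply: eq_integral => y _.
rewrite /k' !patchE; congr (if _ then _ else _).
by apply/idP/idP; rewrite !inE /=; [case|split].
Qed.

Lemma measurable_param_Rintegral (mu : {sigma_finite_measure set Y -> \bar R})
    (D : set Y) (k : X * Y -> R) : measurable D ->
  (forall x y, D y -> 0 <= k (x, y)) -> measurable_fun (setT `*` D) k ->
  measurable_fun setT (fun x => \int[mu]_(y in D) k (x, y)).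
Proof.
move=> mD k0 mk; apply: measurableT_comp; first exact: fine_measurable.
apply: (@measurable_param_integral mu D (EFin \o k)) => //.
exact/measurable_EFinP.
Qed.

End FubiniMeasurability.

Section Rates.
Context {R : realType}.
Local Notation Rm := (measurableTypeR R).
Variables (alpha : R -> R) (p : R -> nat -> R).
Hypothesis ha : C1_pos alpha.
Hypothesis hp : offspring_law p.
Implicit Types (x z t s : R).

Definition clip z : R := Num.max 0 (Num.min 1 z).

Lemma clip_itv z : 0 <= clip z <= 1.
Proof. by rewrite /clip le_max lexx/= ge_max ler01 ge_min lexx. Qed.

Lemma clip_id z : 0 <= z <= 1 -> clip z = z.
Proof. by move=> /andP[z0 z1]; rewrite /clip min_r// max_r. Qed.

Lemma measurable_clip : measurable_fun setT clip.
Proof.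
apply: measurable_maxr; first exact: measurable_cst.
by apply: measurable_minr; [exact: measurable_cst|exact: measurable_id].
Qed.

Definition death_rate x : R := (alpha \_ pos) x.

(** Birth rate of an individual with remaining lifetime [x], weighted by the
    generating function; it vanishes off [pos] and [clip] makes it total. *)
Definition birth_rate (yz : Rm * Rm) : R :=
  ((fun yz => alpha yz.1 * genfun p yz.1 (clip yz.2)) \_ (pos `*` setT)) yz.

Lemma alpha_bound : exists2 A, 0 < A & forall x, pos x -> 0 <= alpha x <= A.
Proof.
have [[_ [M [M0 Mb]]] _ _ a0] := ha; exists (Num.max 1 (M + 1)).
  by rewrite lt_max ltr01.
move=> x px; rewrite a0//= le_max; apply/orP; right.
by apply: le_trans (ler_norm _) _; apply: (Mb (M + 1)) => //; rewrite ltrDl.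
Qed.

Lemma bounded_cont_measurable (f : R -> R) : bounded_cont f ->
  measurable_fun (pos : set Rm) f.
Proof.
by move=> [cf _]; apply: subspace_continuous_measurable_fun; first exact: measurable_pos.
Qed.

Lemma measurable_alpha : measurable_fun (pos : set Rm) alpha.
Proof. by apply: bounded_cont_measurable; case: ha. Qed.

Lemma measurable_offspring i : measurable_fun (pos : set Rm) (p ^~ i).
Proof.
by apply: bounded_cont_measurable; have [_ /(_ i)[]] := hp.
Qed.

Lemma measurable_death_rate : measurable_fun setT (death_rate : Rm -> R).
Proof. by apply/(measurable_restrictT _ measurable_pos); exact: measurable_alpha. Qed.

Lemma measurable_birth_rate : measurable_fun setT birth_rate.
Proof.
have mpT : measurable (pos `*` setT : set (Rm * Rm)).
  by apply: measurableX => //; exact: measurable_pos.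
apply/(measurable_restrictT _ mpT).
have mfst (f : R -> R) : measurable_fun (pos : set Rm) f ->
    measurable_fun (pos `*` setT : set (Rm * Rm)) (fun yz => f yz.1).
  move=> mf; apply: (measurable_comp (F := (pos : set Rm))).
  - exact: measurable_pos.
  - by move=> _ [[y z] [py _] <-].
  - exact: mf.
  - exact: measurable_funTS.
have mclip : measurable_fun (pos `*` setT : set (Rm * Rm)) (fun yz => clip yz.2).
  apply: measurable_funTS; apply: measurableT_comp => //.
  exact: measurable_clip.
apply: measurable_funM; first by apply: mfst; exact: measurable_alpha.
apply: (measurable_fun_cvg (h := fun n (yz : Rm * Rm) =>
    series (fun i => p yz.1 i * clip yz.2 ^+ i) n)).
  move=> n; rewrite /series/=; apply: measurable_sum => i.
  apply: measurable_funM; first by apply: (mfst (p ^~ i)); exact: measurable_offspring.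
  exact: measurable_funX.
move=> [y z] [py _] /=; exact: (cvg_genfun hp py (clip_itv z)).
Qed.

Lemma death_rate_bound : exists2 A, 0 < A & forall x, 0 <= death_rate x <= A.
Proof.
have [A A0 aA] := alpha_bound; exists A => // x; rewrite /death_rate patchE.
by case: ifPn => [/set_mem/aA//|_]; rewrite lexx ltW.
Qed.

Lemma birth_rate_le x z : 0 <= birth_rate (x, z) <= death_rate x.
Proof.
have [px|px] := pselect (pos x); last first.
  rewrite /birth_rate /death_rate !patchE !memNset; first by rewrite lexx.
  - exact: px.
  - by case.
have [A _ /(_ x px)/andP[a0 _]] := alpha_bound.
rewrite /birth_rate /death_rate !patchE !mem_set//=.
have /andP[g0 g1] := genfun_itv hp px (clip_itv z).
by rewrite mulr_ge0//= ler_piMr.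
Qed.

Lemma birth_rateE x z : 0 <= z <= 1 ->
  death_rate x - birth_rate (x, z) = (alpha \_ pos) x * (1 - genfun p x z).
Proof.
move=> z01; have [px|px] := pselect (pos x); last first.
  rewrite /birth_rate /death_rate !patchE !memNset ?subrr ?mul0r//.
  by case.
rewrite /birth_rate /death_rate !patchE !mem_set//= clip_id//.
by rewrite mulrBr mulr1.
Qed.

Lemma birth_rate_lipschitz : exists2 K, 0 < K &
  forall x y z, 0 <= y <= 1 -> 0 <= z <= 1 ->
  `|birth_rate (x, y) - birth_rate (x, z)| <= K * `|y - z|.
Proof.
have [A A0 aA] := alpha_bound; have [M M0 mM] := mean_offspring_bounded hp.
have K0 : 0 < A * (M + 1) by rewrite mulr_gt0// ltr_wpDl.
exists (A * (M + 1)) => // x y z y01 z01.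
wlog yz : y z y01 z01 / y <= z.
  move=> h; have [|/ltW] := leP y z; first exact: h.
  by rewrite distrC (distrC y); exact: h.
rewrite distrC (distrC y) (ger0_norm (x := z - y)) ?subr_ge0//.
have [px|px] := pselect (pos x); last first.
  rewrite /birth_rate !patchE !memNset ?subrr ?normr0/=; try by case.
  by rewrite mulr_ge0 ?(ltW K0)// subr_ge0.
have /andP[a0 a1] := aA x px.
rewrite /birth_rate !patchE !mem_set//= !clip_id// -mulrBr.
have /andP[y0 _] := y01; have /andP[_ z1] := z01.
have /andP[g0 g1] := genfun_lipschitz hp px y0 yz z1.
rewrite ger0_norm ?mulr_ge0// -mulrA ler_pM//.
apply: le_trans g1 _; rewrite ler_wpM2r ?subr_ge0//.
have := mM x px; rewrite (mean_offspringE hp px) lee_fin => /le_trans; apply.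
by rewrite lerDl.
Qed.

End Rates.

Section ExponentialIntegral.
Context {R : realType}.
Local Notation lambda := (@lebesgue_measure R).

Lemma integral_expRN_le (k : R) (D : set R) : 0 < k -> measurable D ->
  D `<=` `[0, +oo[ ->
  (\int[lambda]_(s in D) (expR (- (k * s)))%:E <= (k^-1)%:E)%E.
Proof.
move=> k0 mD D0.
have mE : measurable_fun setT (fun s : R => (expR (- (k * s)))%:E).
  apply/measurable_EFinP; apply: measurableT_comp; first exact: measurable_expR.
  by apply: measurable_funN; apply: mulrl_measurable.
have h := integral_exponential_pdf k0.
have -> : (k^-1)%:E = (k^-1%:E * \int[lambda]_s (exponential_pdf k s)%:E)%E.
  by rewrite h mule1.
rewrite -ge0_integralZl//; last 3 first.
- by apply/measurable_EFinP; exact: measurable_exponential_pdf.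
- by move=> x _; rewrite lee_fin exponential_pdf_ge0// ltW.
- by rewrite lee_fin invr_ge0 ltW.
rewrite [leLHS]integral_mkcond; apply: ge0_le_integral => //.
- by move=> x _; rewrite patchE; case: ifPn => // _; rewrite lee_fin expR_ge0.
- by apply/(measurable_restrictT _ mD); exact: measurable_funTS.
- apply: measurable_funeM; apply/measurable_EFinP; exact: measurable_exponential_pdf.
- move=> x _; rewrite patchE; case: ifPn => [/set_mem Dx|_].
    have := D0 x Dx; rewrite /= in_itv/= andbT => x0.
    rewrite /exponential_pdf patchE mem_set/= ?in_itv/= ?x0//.
    by rewrite -EFinM lee_fin mulKf ?gt_eqF// mulNr.
  by rewrite -EFinM lee_fin mulr_ge0 ?invr_ge0 ?exponential_pdf_ge0 ?ltW.
Qed.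

End ExponentialIntegral.

Section Picard.
Context {R : realType}.
Local Notation Rm := (measurableTypeR R).
Local Notation lambda := (@lebesgue_measure R).
Local Notation Bp := (@bounded_borel_pos R).
Local Notation cm := (completely_monotone Bp).
Variables (alpha : R -> R) (p : R -> nat -> R) (G : probability Rm R).
Hypothesis ha : C1_pos alpha.
Hypothesis hp : offspring_law p.
Hypothesis hG : continuous_law G.
Implicit Types (f w : R -> R) (t x s : R).

Local Notation death := (death_rate alpha).
Local Notation birth := (birth_rate alpha p).

(** Candidate values of [t |-> <G, e^{- u_t}>], the Laplace transform of one
    newborn individual; the iteration runs on these functions of time only. *)
Definition unit_fun w := measurable_fun setT (w : Rm -> R) /\ forall t, 0 <= w t <= 1.

(** The integral term of the cumulant equation. The death and birth parts of
    [alpha (1 - g)] are kept apart: only the second depends on [w], and it is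
    the one with nonnegative coefficients. *)
Definition branching_term w t x : R :=
  \int[lambda]_(s in `]0, t]) (death (x - s) - birth (x - s, w (t - s))).

Definition branching_laplace f w t x : R :=
  expR (- ((f \_ pos) (x - t) + branching_term w t x)).

Definition picard_step f w t : R :=
  \int[G]_(y in pos) branching_laplace f w t y.

Definition picard f n : R -> R := iter n (picard_step f) (fun=> 1).

Let mI t : measurable (`]0, t] : set Rm).
Proof. exact: measurable_itv. Qed.

Let muI t : (lambda `]0%R, t]%classic < +oo)%E.
Proof. by rewrite lebesgue_measure_itv/=; case: ifP => _; rewrite ?ltry. Qed.

Lemma measurable_death_shift x : measurable_fun setT (fun s : Rm => death (x - s)).
Proof.
apply: measurableT_comp; first exact: measurable_death_rate.
by apply: measurable_funB; [exact: measurable_cst|exact: measurable_id].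
Qed.

Lemma measurable_birth_shift w t x : unit_fun w ->
  measurable_fun setT (fun s : Rm => birth (x - s, w (t - s))).
Proof.
move=> [mw _]; apply: measurableT_comp; first exact: measurable_birth_rate.
apply/measurable_fun_pairP; split => /=.
  by apply: measurable_funB; [exact: measurable_cst|exact: measurable_id].
apply: (measurableT_comp mw).
by apply: measurable_funB; [exact: measurable_cst|exact: measurable_id].
Qed.

Lemma integrable_death t x :
  lambda.-integrable `]0, t]%classic (EFin \o (fun s => death (x - s))).
Proof.
have [A A0 aA] := death_rate_bound ha.
apply: (ge0_bounded_integrable (M := A) (mI t) (muI t)) => //.
exact: measurable_funTS (measurable_death_shift x).
Qed.

Lemma integrable_birth w t x : unit_fun w ->
  lambda.-integrable `]0, t]%classic (EFin \o (fun s => birth (x - s, w (t - s)))).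
Proof.
have [A A0 aA] := death_rate_bound ha.
move=> uw; apply: (ge0_bounded_integrable (M := A) (mI t) (muI t)) => //.
  exact: measurable_funTS (measurable_birth_shift t x uw).
move=> s _; have /andP[-> b1] := birth_rate_le ha hp (x - s) (w (t - s)).
by apply: le_trans b1 _; have /andP[] := aA (x - s).
Qed.

Lemma branching_term_ge0 w t x : 0 <= branching_term w t x.
Proof.
apply: Rintegral_ge0 => s _; rewrite subr_ge0.
by have /andP[] := birth_rate_le ha hp (x - s) (w (t - s)).
Qed.

Lemma measurable_branching_term w : unit_fun w ->
  measurable_fun setT (fun tx : Rm * Rm => branching_term w tx.1 tx.2).
Proof.
move=> [mw _].
pose k (z : (Rm * Rm) * Rm) : R := if (0 < z.2) && (z.2 <= z.1.1) then
  death (z.1.2 - z.2) - birth (z.1.2 - z.2, w (z.1.1 - z.2)) else 0.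
rewrite (_ : (fun _ => _) = (fun tx : Rm * Rm => \int[lambda]_(s in setT) k (tx, s))).
  apply: measurable_param_Rintegral => //.
    move=> x y _; rewrite /k; case: ifP => // _; rewrite subr_ge0.
    by case/andP: (birth_rate_le ha hp (x.2 - y) (w (x.1 - y))).
  rewrite setXTT; apply: measurable_fun_ifT; last exact: measurable_cst.
    apply: measurable_and.
      by apply: measurable_fun_ltr; [exact: measurable_cst|exact: measurable_snd].
    apply: measurable_fun_ler; first exact: measurable_snd.
    exact: (measurableT_comp measurable_fst measurable_fst).
  have m1 : measurable_fun setT (fun z : (Rm * Rm) * Rm => z.1.1 - z.2).
    apply: measurable_funB; last exact: measurable_snd.
    exact: (measurableT_comp measurable_fst measurable_fst).
  have m2 : measurable_fun setT (fun z : (Rm * Rm) * Rm => z.1.2 - z.2).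
    apply: measurable_funB; last exact: measurable_snd.
    exact: (measurableT_comp measurable_snd measurable_fst).
  apply: measurable_funB.
    exact: (measurableT_comp (measurable_death_rate ha) m2).
  apply: (measurableT_comp (measurable_birth_rate ha hp)).
  by apply/measurable_fun_pairP; split; [exact: m2|exact: (measurableT_comp mw m1)].
apply/funext => -[t x]; rewrite /branching_term Rintegral_mkcond.
apply: eq_Rintegral => s _; rewrite /k patchE /=.
by rewrite mem_setE in_itv.
Qed.

Lemma branching_laplace_itv f w t x : nonneg_on_pos f ->
  0 <= branching_laplace f w t x <= 1.
Proof.
move=> f0; rewrite /branching_laplace expR_ge0 expR_le1 oppr_le0 addr_ge0//.
  by rewrite patchE; case: ifPn => // /set_mem; exact: f0.
exact: branching_term_ge0.
Qed.

Lemma measurable_branching_laplace f w : measurable_fun (pos : set Rm) f ->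
  unit_fun w ->
  measurable_fun setT (fun tx : Rm * Rm => branching_laplace f w tx.1 tx.2).
Proof.
move=> mf uw; apply: measurableT_comp; first exact: measurable_expR.
apply: measurable_funN; apply: measurable_funD; last exact: measurable_branching_term.
have mfp : measurable_fun setT (f \_ pos : Rm -> R).
  exact/(measurable_restrictT _ measurable_pos).
apply: (measurableT_comp mfp).
by apply: measurable_funB; [exact: measurable_snd|exact: measurable_fst].
Qed.

Let Gpos : (G pos < +oo)%E.
Proof. by rewrite (hG.1) ltry. Qed.

Let Gpos1 : fine (G pos) = 1.
Proof. by rewrite (hG.1). Qed.

Lemma unit_integral (k : R -> R -> R) :
  measurable_fun setT (fun tx : Rm * Rm => k tx.1 tx.2) ->
  (forall t x, 0 <= k t x <= 1) ->
  unit_fun (fun t => \int[G]_(x in pos) k t x).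
Proof.
move=> mk k01; split.
  apply: (@measurable_param_Rintegral R _ _ Rm Rm G pos (fun tx => k tx.1 tx.2)).
  - exact: measurable_pos.
  - by move=> t x _; case/andP: (k01 t x).
  - exact: measurable_funTS.
move=> t; rewrite Rintegral_ge0 => [|x _]; last by case/andP: (k01 t x).
have mkt : measurable_fun (pos : set Rm) (k t).
  by apply: measurable_funTS; apply: (measurableT_comp mk (pair1_measurable t)).
have := Rintegral_le_cst measurable_pos Gpos mkt (fun x _ => k01 t x).
by rewrite Gpos1 mulr1.
Qed.

Lemma unit_picard_step f w : Bp f -> unit_fun w -> unit_fun (picard_step f w).
Proof.
move=> [mf _ f0] uw; apply: unit_integral; first exact: measurable_branching_laplace.
by move=> t x; exact: branching_laplace_itv.
Qed.

Lemma unit_picard f n : Bp f -> unit_fun (picard f n).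
Proof.
move=> Bf; elim: n => [|n IH]; last exact: unit_picard_step.
by split=> [|t]; [exact: measurable_cst|rewrite ler01 lexx].
Qed.

Lemma ler_dist_expRN (a b : R) : 0 <= a -> 0 <= b ->
  `|expR (- a) - expR (- b)| <= `|a - b|.
Proof.
wlog ab : a b / a <= b.
  move=> h a0 b0; have [ab|/ltW ba] := leP a b; first exact: h.
  by rewrite distrC (distrC a); exact: h.
move=> a0 b0; rewrite ger0_norm ?subr_ge0 ?ler_expR ?lerN2//.
rewrite ler0_norm ?subr_le0// opprB.
have -> : expR (- b) = expR (- a) * expR (- (b - a)).
  by rewrite -expRD; congr expR; ring.
rewrite -[X in X - _]mulr1 -mulrBr.
have e1 : expR (- a) <= 1 by rewrite expR_le1 oppr_le0.
have e0 := expR_ge0 (- a).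
have d0 : 0 <= 1 - expR (- (b - a)) by rewrite subr_ge0 expR_le1 oppr_le0 subr_ge0.
have d1 : 1 - expR (- (b - a)) <= b - a.
  by have := expR_ge1Dx (- (b - a)); lra.
nra.
Qed.

(** In the norm [sup_t e^{- k t} |w t|] the map [w |-> branching_term w]
    is Lipschitz with a constant [K / k], as small as desired for large [k]. *)
Lemma branching_term_dist : exists2 K, 0 < K & forall w w' c k t x,
  unit_fun w -> unit_fun w' -> 0 <= c -> 0 < k ->
  (forall s, 0 <= s -> `|w s - w' s| <= c * expR (k * s)) ->
  `|branching_term w t x - branching_term w' t x| <= K * c / k * expR (k * t).
Proof.
have [K K0 lipK] := birth_rate_lipschitz ha hp; exists K => // w w' c k t x uw uw' c0 k0 ww'.
have mexp : measurable_fun setT (fun s : Rm => K * (c * expR (k * (t - s)))).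
  apply: measurable_funM; first exact: measurable_cst.
  apply: measurable_funM; first exact: measurable_cst.
  apply: measurableT_comp; first exact: measurable_expR.
  apply: measurable_funM; first exact: measurable_cst.
  by apply: measurable_funB; [exact: measurable_cst|exact: measurable_id].
have iexp : lambda.-integrable `]0, t]%classic
    (EFin \o (fun s => K * (c * expR (k * (t - s))))).
  apply: (ge0_bounded_integrable (M := K * (c * expR (k * t))) (mI t) (muI t)).
    exact: measurable_funTS mexp.
  move=> s; rewrite /= in_itv/= => /andP[s0 st].
  rewrite !mulr_ge0 ?expR_ge0 ?(ltW K0)//= ler_wpM2l ?(ltW K0)// ler_wpM2l//.
  by rewrite ler_expR ler_wpM2l ?(ltW k0)// gerBl ltW.
have iB := integrable_birth; have iD := integrable_death.
have mww : measurable_fun setT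
    (fun s : Rm => birth (x - s, w' (t - s)) - birth (x - s, w (t - s))).
  by apply: measurable_funB; exact: measurable_birth_shift.
have -> : branching_term w t x - branching_term w' t x = \int[lambda]_(s in `]0, t])
    (birth (x - s, w' (t - s)) - birth (x - s, w (t - s))).
  rewrite /branching_term (RintegralB (mI t) (iD t x) (iB w t x uw)).
  rewrite (RintegralB (mI t) (iD t x) (iB w' t x uw')).
  rewrite (RintegralB (mI t) (iB w' t x uw') (iB w t x uw)).
  have alg (a b b' : R) : a - b - (a - b') = b' - b by ring.
  exact: alg.
have ptw s : `]0, t]%classic s ->
    `|birth (x - s, w' (t - s)) - birth (x - s, w (t - s))| <=
    K * (c * expR (k * (t - s))).
  rewrite /= in_itv/= => /andP[s0 st]; rewrite distrC.
  apply: le_trans (lipK _ _ _ (uw.2 _) (uw'.2 _)) _.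
  by rewrite ler_wpM2l ?(ltW K0)// ww'// subr_ge0.
have iww : lambda.-integrable `]0, t]%classic
    (EFin \o (fun s => birth (x - s, w' (t - s)) - birth (x - s, w (t - s)))).
  apply: (bounded_integrable (M := K * (c * expR (k * t))) (mI t) (muI t)).
    exact: measurable_funTS mww.
  move=> s st; apply: le_trans (ptw s st) _.
  move: st; rewrite /= in_itv/= => /andP[s0 _].
  rewrite ler_wpM2l ?(ltW K0)// ler_wpM2l// ler_expR ler_wpM2l ?(ltW k0)//.
  by rewrite gerBl ltW.
apply: le_trans (le_normr_Rintegral (mI t) iww) _.
have inww : lambda.-integrable `]0, t]%classic
    (EFin \o (fun s => `|birth (x - s, w' (t - s)) - birth (x - s, w (t - s))|)).
  apply: (bounded_integrable (M := K * (c * expR (k * t))) (mI t) (muI t)).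
    by apply: measurable_funTS; exact: measurableT_comp mww.
  move=> s st; rewrite normr_id; apply: le_trans (ptw s st) _.
  move: st; rewrite /= in_itv/= => /andP[s0 _].
  rewrite ler_wpM2l ?(ltW K0)// ler_wpM2l// ler_expR ler_wpM2l ?(ltW k0)//.
  by rewrite gerBl ltW.
apply: le_trans (le_Rintegral (mI t) inww iexp ptw) _.
have mexpN : measurable_fun setT (fun s : Rm => expR (- (k * s))).
  apply: measurableT_comp; first exact: measurable_expR.
  by apply: measurable_funN; exact: mulrl_measurable.
have iexpN : lambda.-integrable `]0, t]%classic (EFin \o (fun s => expR (- (k * s)))).
  apply: (ge0_bounded_integrable (M := 1) (mI t) (muI t)).
    exact: measurable_funTS mexpN.
  move=> s; rewrite /= in_itv/= => /andP[s0 _].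
  by rewrite expR_ge0 expR_le1 oppr_le0 mulr_ge0 ?ltW.
have -> : \int[lambda]_(s in `]0, t]) (K * (c * expR (k * (t - s)))) =
    K * c * expR (k * t) * \int[lambda]_(s in `]0, t]) expR (- (k * s)).
  rewrite -(RintegralZl _ (mI t) iexpN); apply: eq_Rintegral => s _.
  by rewrite mulrBr expRD !mulrA.
have -> : K * c / k * expR (k * t) = K * c * expR (k * t) * k^-1 by rewrite mulrAC.
rewrite ler_wpM2l ?mulr_ge0 ?expR_ge0 ?(ltW K0)//.
rewrite -lee_fin EFin_Rintegral//; apply: integral_expRN_le => //.
by move=> s; rewrite /= !in_itv/= andbT => /andP[/ltW].
Qed.

Section Solution.
Variables (f : R -> R) (u : R -> R -> R).
Hypothesis Bf : Bp f.
Hypothesis hu : is_cumulant alpha p G f u.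

(** The one-variable function [w] determines the cumulant: [e^{- u}] is
    [branching_laplace f w], and [w] is a fixed point of [picard_step f]. *)
Definition offspring_laplace t : R :=
  if 0 <= t then \int[G]_(y in pos) expR (- u t y) else 1.

Lemma unit_offspring_laplace : unit_fun offspring_laplace.
Proof.
have [mu u0 _ _] := hu.
pose k t x : R := if (0 <= t) && (x \in (pos : set R)) then expR (- u t x) else 1.
have k01 t x : 0 <= k t x <= 1.
  rewrite /k; case: ifPn => [/andP[t0]|_]; last by rewrite ler01 lexx.
  by rewrite inE => px; rewrite expR_ge0 expR_le1 oppr_le0 u0.
have mk : measurable_fun setT (fun tx : Rm * Rm => k tx.1 tx.2).
  have mD : measurable (`[0, +oo[ `*` pos : set (Rm * Rm)).
    by apply: measurableX; [exact: measurable_itv|exact: measurable_pos].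
  have mE : measurable_fun setT (((fun tx : Rm * Rm => expR (- u tx.1 tx.2) - 1)
      \_ (`[0, +oo[ `*` pos)) : Rm * Rm -> R).
    apply/(measurable_restrictT _ mD); apply: measurable_funB; last exact: measurable_cst.
    by apply: measurableT_comp; [exact: measurable_expR|exact: measurable_funN].
  have := measurable_funD mE (@measurable_cst _ _ _ _ setT (1 : R)).
  congr measurable_fun; apply/funext => -[t x]; rewrite /k /= patchE.
  rewrite (_ : (_ \in _) = (0 <= t) && (x \in (pos : set R))).
    by case: ifP => _; rewrite ?subrK//; exact: add0r.
  by apply/idP/andP; rewrite !inE /= in_itv/= andbT.
have := unit_integral mk k01; congr unit_fun; apply/funext => t.
rewrite /offspring_laplace /k; case: leP => t0.
  by apply: eq_Rintegral => x ->.
by rewrite Rintegral_cst ?Gpos1 ?mulr1//; exact: measurable_pos.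
Qed.

Lemma cumulant_branching t x : 0 <= t -> pos x ->
  u t x = (f \_ pos) (x - t) + branching_term offspring_laplace t x.
Proof.
move=> t0 px; have [_ _ _ ->//] := hu; congr (_ + _).
apply: eq_Rintegral => s; rewrite mem_setE in_itv/= => /andP[s0 st].
rewrite birth_rateE; last exact: unit_offspring_laplace.2.
by rewrite /offspring_laplace subr_ge0 st.
Qed.

Lemma expRN_cumulant t x : 0 <= t -> pos x ->
  expR (- u t x) = branching_laplace f offspring_laplace t x.
Proof. by move=> t0 px; rewrite cumulant_branching. Qed.

(** The exponent [k] is chosen to make each step contract by [1 / 2]. *)
Lemma picard_dist : exists2 k, 0 < k & forall n t x, 0 <= t -> pos x ->
  `|branching_laplace f (picard f n) t x - expR (- u t x)| <=
    2^-1 ^+ n * expR (k * t).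
Proof.
have [K K0 branchK] := branching_term_dist; pose k := K * 2.
have k0 : 0 < k by rewrite mulr_gt0.
have Kk c : K * c / k = c / 2 by rewrite /k; field; rewrite gt_eqF.
have uw := unit_offspring_laplace.
have f0 y : 0 <= (f \_ pos) y.
  by rewrite patchE; case: ifPn => // /set_mem; have [_ _] := Bf; exact.
exists k => //.
have step n : (forall t, 0 <= t -> `|picard f n t - offspring_laplace t| <=
      2^-1 ^+ n * expR (k * t)) -> forall t x, 0 <= t -> pos x ->
    `|branching_laplace f (picard f n) t x - expR (- u t x)| <=
      2^-1 ^+ n.+1 * expR (k * t).
  move=> IH t x t0 px; rewrite expRN_cumulant//.
  apply: le_trans (ler_dist_expRN _ _) _; rewrite ?addr_ge0 ?branching_term_ge0//.
  rewrite opprD addrACA subrr add0r.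
  have c0 : 0 <= 2^-1 ^+ n :> R by rewrite exprn_ge0.
  have := branchK _ _ _ _ t x (unit_picard n Bf) uw c0 k0 IH.
  by rewrite Kk exprSr.
have conv n : forall t, 0 <= t -> `|picard f n t - offspring_laplace t| <=
    2^-1 ^+ n * expR (k * t).
  elim: n => [t t0|n IH t t0].
    rewrite expr0 mul1r /= ger0_norm ?subr_ge0; last by case/andP: (uw.2 t).
    apply: (@le_trans _ _ 1); first by rewrite gerBl; case/andP: (uw.2 t).
    by have := expR_ge1Dx (k * t); have := mulr_ge0 (ltW k0) t0; lra.
  rewrite /= /picard_step -/(picard f n) /offspring_laplace t0.
  pose a y := branching_laplace f (picard f n) t y.
  pose b y := branching_laplace f offspring_laplace t y.
  have [mf _ fnn] := Bf.
  have ma : measurable_fun (pos : set Rm) a.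
    apply: measurable_funTS; have := measurable_branching_laplace mf (unit_picard n Bf).
    by move=> /measurableT_comp/(_ (pair1_measurable t)).
  have mb : measurable_fun (pos : set Rm) b.
    apply: measurable_funTS; have := measurable_branching_laplace mf uw.
    by move=> /measurableT_comp/(_ (pair1_measurable t)).
  have ia : G.-integrable pos (EFin \o a).
    apply: (ge0_bounded_integrable (M := 1) measurable_pos Gpos ma) => y _.
    exact: branching_laplace_itv.
  have ib : G.-integrable pos (EFin \o b).
    apply: (ge0_bounded_integrable (M := 1) measurable_pos Gpos mb) => y _.
    exact: branching_laplace_itv.
  have -> : \int[G]_(y in pos) expR (- u t y) = \int[G]_(y in pos) b y.
    by apply: eq_Rintegral => y /set_mem py; rewrite expRN_cumulant.
  rewrite -(RintegralB measurable_pos ia ib).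
  have ab y : pos y -> `|a y - b y| <= 2^-1 ^+ n.+1 * expR (k * t).
    by move=> py; rewrite /b -expRN_cumulant//; exact: step.
  have iab : G.-integrable pos (EFin \o (fun y => a y - b y)).
    exact: (bounded_integrable measurable_pos Gpos (measurable_funB ma mb) ab).
  apply: le_trans (le_normr_Rintegral measurable_pos iab) _.
  rewrite -[leRHS]mulr1 -[X in _ <= _ * X]Gpos1; apply: Rintegral_le_cst.
  - exact: measurable_pos.
  - exact: Gpos.
  - exact: (measurableT_comp (@normr_measurable R setT) (measurable_funB ma mb)).
  - by move=> y py; rewrite normr_ge0 ab.
move=> n t x t0 px; apply: le_trans (step n (conv n) t x t0 px) _.
rewrite ler_wpM2r ?expR_ge0// exprSr ler_piMr ?exprn_ge0//.
by rewrite invf_le1// ler1n.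
Qed.

Lemma cvg_picard t x : 0 <= t -> pos x ->
  branching_laplace f (picard f n) t x @[n --> \oo] --> expR (- u t x).
Proof.
move=> t0 px; have [k k0 kP] := picard_dist.
apply/cvgrPdist_le => e e0.
have : (2^-1 ^+ n * expR (k * t)) @[n --> \oo] --> (0 : R).
  rewrite -[X in _ --> X](mul0r (expR (k * t))); apply: cvgM; last exact: cvg_cst.
  by apply: cvg_expr; rewrite ger0_norm ?invf_lt1// ltr1n.
move/cvgr0_norm_le => /(_ e e0); apply: filterS => n; apply: le_trans.
rewrite distrC; apply: le_trans (kP n t x t0 px) _; exact: ler_norm.
Qed.

End Solution.

Lemma cm_birth x (W : (R -> R) -> R) : cm W -> (forall f, Bp f -> 0 <= W f <= 1) ->
  cm (fun f => birth (x, W f)).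
Proof.
move=> cW W01; have [px|px] := pselect (pos x); last first.
  apply: (@cm_eq _ _ _ (@bounded_borel_posD R) (fun=> 0)); last first.
    exact: (cm_cst (@bounded_borel_posD R) (lexx 0)).
  by move=> f _; rewrite /birth_rate patchE memNset//= => -[].
have [A _ /(_ x px)/andP[a0 _]] := alpha_bound ha.
apply: (@cm_eq _ _ _ (@bounded_borel_posD R) (fun f => alpha x * genfun p x (W f))).
  by move=> f Bf; rewrite /birth_rate patchE mem_set//= clip_id// W01.
apply: cmZ => //; try exact: bounded_borel_posD.
apply: (cm_lim (@bounded_borel_posD R)
  (F_ := fun n f => \sum_(0 <= i < n) p x i * W f ^+ i)); last first.
  by move=> f Bf; exact: (cvg_genfun hp px (W01 f Bf)).
move=> n; apply: cm_sum; first exact: bounded_borel_posD.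
move=> i; apply: cmZ; try exact: bounded_borel_posD.
  by have [/(_ x px)[]] := hp.
by apply: cmX => //; exact: bounded_borel_posD.
Qed.

(** In the exponent, the death term does not depend on [f], and the birth term,
    a power series with nonnegative coefficients in [W f], has the favourable
    sign. *)
Lemma cm_branching_laplace (W : (R -> R) -> R -> R) t x :
  (forall f, Bp f -> unit_fun (W f)) -> (forall s, cm (W ^~ s)) ->
  cm (fun f => branching_laplace f (W f) t x).
Proof.
move=> uW cW; pose D := \int[lambda]_(s in `]0, t]) death (x - s).
pose J f := \int[lambda]_(s in `]0, t]) birth (x - s, W f (t - s)).
have cJ : cm J.
  apply: (cm_integral (@bounded_borel_posD R) (mI t)) => [s _|f Bf].
    by apply: cm_birth => // f Bf; exact: (uW f Bf).2.
  by apply: integrable_birth; exact: uW.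
have c1 : cm (fun f => expR (- (f \_ pos) (x - t))).
  apply: (cm_expRN_additive (@bounded_borel_posD R)).
    move=> f [_ _ f0]; rewrite patchE; case: ifPn => // /set_mem; exact: f0.
  by move=> f h _ _; rewrite !patchE; case: ifP => // _; rewrite addr0.
have := cmM (@bounded_borel_posD R) c1
  (cmZ (@bounded_borel_posD R) (expR_ge0 (- D)) (cm_expR (@bounded_borel_posD R) cJ)).
apply: cm_eq; first exact: bounded_borel_posD.
move=> f Bf; rewrite -!expRD /branching_laplace /branching_term; congr expR.
rewrite (RintegralB (mI t) (integrable_death t x) (integrable_birth t x (uW f Bf))).
by rewrite -/D -/(J f) opprD opprB [- D + _]addrC.
Qed.

Lemma cm_picard n t : cm (fun f => picard f n t).
Proof.
elim: n t => [|n IH] t; first exact: (cm_cst (@bounded_borel_posD R) ler01).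
apply: (cm_integral (@bounded_borel_posD R) measurable_pos) => [x _|f Bf].
  by apply: cm_branching_laplace => // f Bf; exact: unit_picard.
have [mf _ f0] := Bf.
apply: (ge0_bounded_integrable (M := 1) measurable_pos Gpos).
  apply: measurable_funTS; have := measurable_branching_laplace mf (unit_picard n Bf).
  by move=> /measurableT_comp/(_ (pair1_measurable t)).
by move=> y _; exact: branching_laplace_itv.
Qed.

(** Probabilistically, [expR (- u f t x)] is the Laplace transform of the
    branching process without immigration started from one individual. *)
Lemma cm_expRN_cumulant (u : (R -> R) -> R -> R -> R) t x :
  (forall f, Bp f -> is_cumulant alpha p G f (u f)) -> 0 <= t -> pos x ->
  cm (fun f => expR (- u f t x)).
Proof.
move=> hu t0 px.
apply: (cm_lim (@bounded_borel_posD R)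
  (F_ := fun n f => branching_laplace f (picard f n) t x)).
  move=> n; apply: cm_branching_laplace => [f Bf|s]; first exact: unit_picard.
  exact: cm_picard.
by move=> f Bf; apply: cvg_picard => //; exact: hu.
Qed.

End Picard.

(** * Exponential decay of the survival probability *)

Section Decay.
Context {R : realType}.
Local Notation Rm := (measurableTypeR R).
Local Notation lambda := (@lebesgue_measure R).
Local Notation Bp := (@bounded_borel_pos R).
Variables (alpha : R -> R) (p : R -> nat -> R) (G : probability Rm R) (alpha1 : R).
Hypothesis ha : C1_pos alpha.
Hypothesis hp : offspring_law p.
Hypothesis hG : continuous_law G.
Hypothesis rho_lt1 :
  (\int[lambda]_(s in pos) mean_birth_rate alpha p G s < 1)%E.
Hypothesis alpha1_gt0 : 0 < alpha1.
Hypothesis tail_dRi : directly_Riemann_integrable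
    (fun t => expR (alpha1 * t) * (1 - cdf_pos G t)).
Hypothesis malthus : (\int[lambda]_(s in pos)
     ((expR (alpha1 * s))%:E * mean_birth_rate alpha p G s) = 1)%E.
Implicit Types (t x s : R).

Let b := alpha1 / 2.

Let b0 : 0 < b. Proof. by rewrite divr_gt0. Qed.

Let alpha1E : alpha1 = b + b. Proof. by rewrite /b; lra. Qed.

(** Each value [e^{alpha1 t} (1 - G t)] is at most one term of the upper sum of
    mesh [1]. *)
Lemma tail_bound : exists2 M : R, 0 <= M &
  forall t, 0 <= t -> 1 - cdf_pos G t <= M * expR (- (alpha1 * t)).
Proof.
pose F t := expR (alpha1 * t) * (1 - cdf_pos G t).
have [F0 /(_ 1 ltr01) fin _] := tail_dRi.
pose a n : \bar R := (1%:E * ereal_sup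
  [set (F x)%:E | x in `[(n.-1%:R * 1)%R, (n%:R * 1)%R]])%E.
have supF n x : (0 < n)%N -> n.-1%:R <= x <= n%:R -> ((F x)%:E <= a n)%E.
  move=> n0 xn; rewrite /a mul1e; apply: ereal_sup_ubound; exists x => //.
  by rewrite /= in_itv/= !mulr1.
have a0 n : (1 <= n)%N -> (0 <= a n)%E.
  move=> n1; apply: le_trans (supF n n%:R n1 _).
    by rewrite lee_fin F0.
  by rewrite lexx andbT ler_nat leq_pred.
have U0 : (0 <= upper_sum F 1)%E by apply: nneseries_ge0 => n n1 _; exact: a0.
exists (fine (upper_sum F 1)); first exact: fine_ge0.
move=> t t0.
suff : F t <= fine (upper_sum F 1).
  rewrite /F => h; rewrite -(@ler_pM2l _ (expR (alpha1 * t))) ?expR_gt0//.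
  by rewrite mulrCA expRN divff ?mulr1// gt_eqF// expR_gt0.
rewrite -lee_fin fineK; last by rewrite ge0_fin_numE.
pose n := (Num.trunc t).+1.
have tn : n.-1%:R <= t <= n%:R.
  have /andP[h1 h2] := archimedean.Num.Theory.truncn_itv t0.
  by rewrite h1 ltW.
apply: le_trans (supF n t (ltn0Sn _) tn) _.
apply: (@le_trans _ _ (\sum_(1 <= i < n.+1) a i)%E).
  rewrite big_nat_recr//= leeDr// big_nat; apply: sume_ge0 => i /andP[i1 _].
  exact: a0.
by apply: (@nneseries_lim_ge _ a) => i i1 _; exact: a0.
Qed.

Definition mean_rate : R -> R := (fun y => alpha y * real_mean_offspring p y) \_ pos.

Lemma mean_rate_bound : exists2 A, 0 < A & forall x, 0 <= mean_rate x <= A.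
Proof.
have [A A0 aA] := alpha_bound ha; have [M M0 mM] := mean_offspring_bounded hp.
exists (A * (M + 1)); first by rewrite mulr_gt0// ltr_wpDl.
move=> x; rewrite /mean_rate patchE; case: ifPn => [/set_mem px|_]; last first.
  by rewrite lexx mulr_ge0 ?(ltW A0)// addr_ge0.
have /andP[a0 a1] := aA x px; have m0 := real_mean_offspring_ge0 hp px.
rewrite mulr_ge0//= ler_pM//.
by have := mM x px; rewrite (mean_offspringE hp px) lee_fin => /le_trans; apply; rewrite lerDl.
Qed.

Lemma measurable_mean_rate : measurable_fun setT (mean_rate : Rm -> R).
Proof.
apply/(measurable_restrictT _ measurable_pos).
apply: measurable_funM; first exact: measurable_alpha.
apply: measurableT_comp; first exact: fine_measurable.
apply: (emeasurable_fun_cvg (fun n (y : Rm) => \sum_(1 <= i < n) (i%:R * p y i)%:E)%E).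
  move=> n; apply: emeasurable_sum => i; apply/measurable_EFinP.
  by apply: measurable_funM; [exact: measurable_cst|exact: measurable_offspring].
move=> y py; apply: is_cvg_ereal_nneg_natsum => i _.
by rewrite lee_fin mulr_ge0//; have [/(_ y py)[]] := hp.
Qed.

Lemma mean_birth_rateE s : 0 <= s ->
  mean_birth_rate alpha p G s = (\int[G]_(x in pos) (mean_rate (x - s))%:E)%E.
Proof.
move=> s0; rewrite /mean_birth_rate.
rewrite integral_mkcond [RHS]integral_mkcond; apply: eq_integral => x _.
rewrite !patchE /mean_rate patchE !mem_setE !in_itv/= !andbT subr_gt0.
case: ifPn => sx; last by case: ifP.
rewrite (le_lt_trans s0 sx) EFinM mean_offspringE//.
by rewrite /pos/= in_itv/= andbT subr_gt0.
Qed.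

Let mb s : \bar R := (\int[G]_(x in pos) (mean_rate (x - s))%:E)%E.

Let mb_ge0 s : (0 <= mb s)%E.
Proof.
have [A A0 mA] := mean_rate_bound.
by apply: integral_ge0 => x _; rewrite lee_fin; case/andP: (mA (x - s)).
Qed.

Let measurable_mb : measurable_fun setT (mb : Rm -> \bar R).
Proof.
have [A A0 mA] := mean_rate_bound.
apply: (@measurable_param_integral R _ _ Rm Rm G pos
  (fun sx => (mean_rate (sx.2 - sx.1))%:E)).
- exact: measurable_pos.
- by move=> s x _; rewrite lee_fin; case/andP: (mA (x - s)).
- apply: measurable_funTS; apply/measurable_EFinP.
  apply: (measurableT_comp measurable_mean_rate).
  by apply: measurable_funB; [exact: measurable_snd|exact: measurable_fst].
Qed.

(** At half the Malthusian exponent the renewal kernel has mass less than [1],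
    since [expR (b s) <= (1 + expR (2 b s)) / 2]. *)
Lemma half_malthus : exists2 q : R, 0 <= q < 1 &
  (\int[lambda]_(s in pos) ((expR (b * s))%:E * mb s) <= q%:E)%E.
Proof.
have mbE s : pos s -> mean_birth_rate alpha p G s = mb s.
  by rewrite /pos/= in_itv/= andbT => /ltW; exact: mean_birth_rateE.
have rho0 : (0 <= \int[lambda]_(s in pos) mb s)%E by exact: integral_ge0.
have rho1 : (\int[lambda]_(s in pos) mb s < 1)%E.
  by move: rho_lt1; under eq_integral => s /set_mem /mbE -> do [].
have malth : (\int[lambda]_(s in pos) ((expR (alpha1 * s))%:E * mb s) = 1)%E.
  by rewrite -malthus; apply: eq_integral => s /set_mem /mbE ->.
set rho := (\int[lambda]_(s in pos) mb s)%E in rho0 rho1.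
have rfin : rho \is a fin_num by rewrite ge0_fin_numE// (lt_trans rho1)// ltry.
exists ((fine rho + 1) / 2).
  rewrite divr_ge0 ?addr_ge0 ?fine_ge0//= ltr_pdivrMr// mul1r.
  have : fine rho < 1 by rewrite -lte_fin fineK.
  by lra.
have mE c : measurable_fun (pos : set Rm) (fun s => (expR (c * s))%:E).
  apply: measurable_funTS; apply/measurable_EFinP.
  by apply: measurableT_comp; [exact: measurable_expR|exact: mulrl_measurable].
apply: (@le_trans _ _ (\int[lambda]_(s in pos)
    ((2^-1)%:E * (mb s + (expR (alpha1 * s))%:E * mb s)))%E).
  apply: ge0_le_integral => //.
  - by move=> s _; rewrite mule_ge0// lee_fin expR_ge0.
  - by apply: emeasurable_funM; [exact: mE|exact: measurable_funTS].
  - apply: measurable_funeM; apply: emeasurable_funD; first exact: measurable_funTS.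
    by apply: emeasurable_funM; [exact: mE|exact: measurable_funTS].
  - move=> s _; rewrite -[X in (X + _)%E]mul1e -ge0_muleDl ?lee_fin ?expR_ge0//.
    rewrite muleA -EFinD -EFinM lee_wpmul2r// lee_fin alpha1E mulrDl expRD.
    have := sqr_ge0 (expR (b * s) - 1); rewrite sqrrB expr1n expr2 mulr1.
    move: (expR (b * s)) => e; lra.
rewrite ge0_integralZl//; last first.
- by move=> s _; rewrite adde_ge0// mule_ge0// lee_fin expR_ge0.
- apply: emeasurable_funD; first exact: measurable_funTS.
  by apply: emeasurable_funM; [exact: mE|exact: measurable_funTS].
rewrite ge0_integralD//; last 3 first.
- exact: measurable_funTS.
- by move=> s _; rewrite mule_ge0// lee_fin expR_ge0.
- by apply: emeasurable_funM; [exact: mE|exact: measurable_funTS].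
by rewrite malth -/rho -(fineK rfin) -EFinD -EFinM mulrC lee_fin.
Qed.

Lemma tonelli_in (m1 m2 : {sigma_finite_measure set Rm -> \bar R}) (D E : set Rm)
    (k : Rm * Rm -> \bar R) : measurable D -> measurable E ->
  (forall z, (0 <= k z)%E) -> measurable_fun setT k ->
  (\int[m1]_(x in D) \int[m2]_(y in E) k (x, y) =
   \int[m2]_(y in E) \int[m1]_(x in D) k (x, y))%E.
Proof.
move=> mD mE k0 mk; pose k' := k \_ (D `*` E).
have mDE : measurable (D `*` E : set (Rm * Rm)) by exact: measurableX.
have mk' : measurable_fun setT k'.
  by apply/(measurable_restrictT _ mDE); exact: measurable_funTS.
have k'0 z : (0 <= k' z)%E by rewrite /k' patchE; case: ifPn.
have DE x y : ((x, y) \in D `*` E) = (x \in D) && (y \in E).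
  by apply/idP/andP; rewrite !inE.
transitivity (\int[m1]_x \int[m2]_y k' (x, y))%E.
  rewrite integral_mkcond; apply: eq_integral => x _; rewrite patchE.
  case: ifPn => xD; last first.
    by rewrite integral0_eq// => y _; rewrite /k' patchE DE (negPf xD).
  rewrite integral_mkcond; apply: eq_integral => y _.
  by rewrite /k' !patchE DE xD.
rewrite (@fubini_tonelli _ _ Rm Rm R m1 m2 k' mk' k'0); symmetry.
rewrite integral_mkcond; apply: eq_integral => y _; rewrite patchE.
case: ifPn => yE; last first.
  by rewrite integral0_eq// => x _; rewrite /k' patchE DE (negPf yE) andbF.
rewrite integral_mkcond; apply: eq_integral => x _.
by rewrite /k' !patchE DE yE andbT.
Qed.

Section Cumulant.
Variables (f : R -> R) (u : R -> R -> R).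
Hypothesis hu : is_cumulant alpha p G f u.

Local Notation w := (offspring_laplace G u).
Local Notation branchw := (branching_term alpha p (offspring_laplace G u)).

Let uw : unit_fun w. Proof. exact: (unit_offspring_laplace hG hu). Qed.

Lemma measurable_cumulant t : 0 <= t -> measurable_fun (pos : set Rm) (u t).
Proof.
move=> t0; have [mu _ _ _] := hu.
have -> : u t = (fun tx : Rm * Rm => u tx.1 tx.2) \o (fun x => (t, x)) by [].
apply: (measurable_comp (F := (`[0, +oo[ `*` pos : set (Rm * Rm)))) mu _.
- by apply: measurableX; [exact: measurable_itv|exact: measurable_pos].
- by move=> _ [x px <-]; split=> //=; rewrite in_itv/= t0.
- by apply: measurable_funTS; exact: pair1_measurable.
Qed.

(** The generating function has slope at most its mean:
    [1 - g (x, z) <= g' (x, 1-) (1 - z)]. *)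
Lemma branching_term_mean_rate t x S : 0 <= S ->
  (forall s, 0 <= s -> s < t -> 1 - w s <= S * expR (- (b * s))) ->
  ((branchw t x)%:E <= (S * expR (- (b * t)))%:E *
    \int[lambda]_(s in `]0%R, t]) (mean_rate (x - s) * expR (b * s))%:E)%E.
Proof.
move=> S0 wS.
have mI : measurable (`]0, t]%classic : set Rm) by exact: measurable_itv.
have muI : (lambda (`]0%R, t]%classic : set R) < +oo)%E.
  by rewrite lebesgue_measure_itv/=; case: ifP => _; rewrite ?ltry.
have iD := integrable_death ha t x; have iB := integrable_birth ha hp t x uw.
have mm : measurable_fun setT (fun s : Rm => (mean_rate (x - s) * expR (b * s))%:E).
  apply/measurable_EFinP; apply: measurable_funM.
    apply: (measurableT_comp measurable_mean_rate).
    by apply: measurable_funB; [exact: measurable_cst|exact: measurable_id].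
  by apply: measurableT_comp; [exact: measurable_expR|exact: mulrl_measurable].
have [A A0 mA] := mean_rate_bound.
have m0 s : (0 <= (mean_rate (x - s) * expR (b * s))%:E)%E.
  by rewrite lee_fin mulr_ge0 ?expR_ge0//; case/andP: (mA (x - s)).
rewrite -ge0_integralZl//; last 2 first.
- exact: measurable_funTS.
- by rewrite lee_fin mulr_ge0 ?expR_ge0.
have iDB : lambda.-integrable `]0, t]%classic (EFin \o
    (fun s => death_rate alpha (x - s) - birth_rate alpha p (x - s, w (t - s)))).
  exact: integrableB iD iB.
rewrite /branching_term EFin_Rintegral//.
apply: ge0_le_integral => //.
- by move=> s _; rewrite lee_fin subr_ge0; case/andP: (birth_rate_le ha hp (x - s) (w (t - s))).
- exact: (measurable_int lambda iDB).
- by apply: measurable_funeM; exact: measurable_funTS.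
move=> s; rewrite /= in_itv/= => /andP[s0 st]; rewrite -EFinM lee_fin.
rewrite birth_rateE; last exact: uw.2.
have [pxs|pxs] := pselect (pos (x - s)); last first.
  by rewrite /mean_rate !patchE memNset//= !mul0r mulr0.
have [B _ /(_ _ pxs)/andP[a0 _]] := alpha_bound ha.
rewrite /mean_rate !patchE mem_set//=.
have /andP[w0 w1] := uw.2 (t - s).
have := genfun_lipschitz hp pxs w0 w1 (lexx 1); rewrite genfun1// => /andP[_ g1].
have := wS (t - s) _ _; rewrite subr_ge0 st gtrBl s0 => /(_ isT isT) ws.
have mo := real_mean_offspring_ge0 hp pxs.
have eE : expR (- (b * t)) * expR (b * s) = expR (- (b * (t - s))).
  by rewrite -expRD; congr expR; ring.
have -> : S * expR (- (b * t)) * (alpha (x - s) * real_mean_offspring p (x - s) * expR (b * s)) =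
    alpha (x - s) * (real_mean_offspring p (x - s) * (S * expR (- (b * (t - s))))).
  by rewrite -eE; ring.
by rewrite ler_wpM2l// (le_trans g1)// ler_wpM2l.
Qed.

Lemma one_sub_expRN_le t x : 0 <= t -> pos x ->
  1 - expR (- u t x) <= \1_(`]t, +oo[%classic : set R) x + branchw t x.
Proof.
move=> t0 px; have br0 := branching_term_ge0 ha hp w t x.
rewrite indicE mem_setE in_itv/= andbT; have [tx|xt] := ltP t x.
  by have := expR_ge0 (- u t x); rewrite /=; lra.
rewrite (cumulant_branching hG hu t0 px) patchE memNset; last first.
  by rewrite /pos/= in_itv/= andbT subr_gt0 ltNge xt.
by rewrite /= !add0r; have := expR_ge1Dx (- branchw t x); lra.
Qed.

(** The renewal inequality for the survival probability [1 - w]: the first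
    individual is still alive, or one of its children has surviving
    descendants. *)
Lemma survival_step t S M q : 0 <= t -> 0 <= S ->
  1 - cdf_pos G t <= M * expR (- (alpha1 * t)) -> 0 <= M ->
  (\int[lambda]_(s in pos) ((expR (b * s))%:E * mb s) <= q%:E)%E ->
  (forall s, 0 <= s -> s < t -> 1 - w s <= S * expR (- (b * s))) ->
  1 - w t <= (M + q * S) * expR (- (b * t)).
Proof.
move=> t0 S0 Gt M0 qb wS.
have Gpos : (G pos < +oo)%E by rewrite hG.1 ltry.
have mut := measurable_cumulant t0.
have u0 x : pos x -> 0 <= u t x by move=> px; have [_ + _ _] := hu; exact.
have mE : measurable_fun (pos : set Rm) (fun x => expR (- u t x)).
  apply: measurableT_comp; first exact: measurable_expR.
  exact: measurable_funN.
have iE : G.-integrable pos (EFin \o (fun x => expR (- u t x))).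
  apply: (ge0_bounded_integrable (M := 1) measurable_pos Gpos mE) => x px.
  by rewrite expR_ge0 expR_le1 oppr_le0 u0.
have i1 : G.-integrable pos (EFin \o (fun=> 1 : R)).
  by apply: (bounded_integrable (M := 1) measurable_pos Gpos) => // x _; rewrite normr1.
have -> : 1 - w t = \int[G]_(x in pos) (1 - expR (- u t x)).
  rewrite (RintegralB measurable_pos i1 iE) /offspring_laplace t0.
  rewrite Rintegral_cst; last exact: measurable_pos.
  by rewrite [X in fine X](hG.1) mulr1.
have iB : G.-integrable pos (EFin \o (fun x => 1 - expR (- u t x))).
  exact: (integrableB measurable_pos i1 iE).
rewrite -lee_fin (EFin_Rintegral measurable_pos iB).
pose k (xs : Rm * Rm) : \bar R := (mean_rate (xs.1 - xs.2) * expR (b * xs.2))%:E.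
have [A A0 mA] := mean_rate_bound.
have k0 z : (0 <= k z)%E.
  by rewrite lee_fin mulr_ge0 ?expR_ge0//; case/andP: (mA (z.1 - z.2)).
have mk : measurable_fun setT k.
  apply/measurable_EFinP; apply: measurable_funM.
    apply: (measurableT_comp measurable_mean_rate).
    by apply: measurable_funB; [exact: measurable_fst|exact: measurable_snd].
  apply: measurableT_comp; first exact: measurable_expR.
  by apply: measurable_funM; [exact: measurable_cst|exact: measurable_snd].
have mI : measurable (`]0, t]%classic : set Rm) by exact: measurable_itv.
pose J x : \bar R := (\int[lambda]_(s in `]0%R, t]) k (x, s))%E.
have J0 x : (0 <= J x)%E by exact: integral_ge0.
have mJ : measurable_fun setT (J : Rm -> \bar R).
  apply: (@measurable_param_integral R _ _ Rm Rm lambda `]0, t]%classic k) => //.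
  exact: measurable_funTS.
have m1t : measurable_fun setT
    (fun x : Rm => (\1_(`]t, +oo[%classic : set R) x : R)%:E).
  by apply/measurable_EFinP; apply: measurable_indic; exact: measurable_itv.
apply: (@le_trans _ _ (\int[G]_(x in pos)
    ((\1_(`]t, +oo[%classic : set R) x : R)%:E + (S * expR (- (b * t)))%:E * J x))%E).
  apply: ge0_le_integral => //.
  - by move=> x px; rewrite lee_fin subr_ge0 expR_le1 oppr_le0 u0.
  - exact: (measurable_int G iB).
  - apply: emeasurable_funD; last by apply: measurable_funeM; exact: measurable_funTS.
    exact: measurable_funTS m1t.
  - move=> x px; apply: le_trans (_ : (\1_(`]t, +oo[%classic : set R) x + branchw t x)%:E <= _)%E.
      by rewrite lee_fin one_sub_expRN_le.
    by rewrite EFinD leeD2l//; exact: branching_term_mean_rate.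
rewrite ge0_integralD//; last 3 first.
- exact: (measurable_funTS m1t).
- by move=> x _; rewrite mule_ge0// lee_fin mulr_ge0 ?expR_ge0.
- by apply: measurable_funeM; exact: measurable_funTS.
rewrite ge0_integralZl//; last 2 first.
- exact: measurable_funTS.
- by rewrite lee_fin mulr_ge0 ?expR_ge0.
rewrite (@tonelli_in G lambda pos `]0, t]%classic k measurable_pos mI k0 mk).
rewrite mulrDl EFinD leeD//.
  apply: (@le_trans _ _ (1 - cdf_pos G t)%:E).
    rewrite integral_indic; [|exact: measurable_pos|exact: measurable_itv].
    rewrite EFinB /cdf_pos fineK; last exact: fin_num_measure.
    rewrite -probability_setC//; apply: le_measure; rewrite ?inE.
    - by apply: measurableI; [exact: measurable_itv|exact: measurable_pos].
    - exact: measurableC.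
    - move=> x [/=]; rewrite !in_itv/= andbT => tx _.
      by rewrite leNgt tx andbF.
  rewrite lee_fin (le_trans Gt)// ler_wpM2l// ler_expR lerN2 alpha1E mulrDl.
  by rewrite lerDl mulr_ge0// ltW.
have -> : q * S * expR (- (b * t)) = S * expR (- (b * t)) * q by ring.
rewrite [leRHS]EFinM; apply: lee_wpmul2l.
  by rewrite lee_fin mulr_ge0 ?expR_ge0.
apply: le_trans qb.
apply: (@le_trans _ _ (\int[lambda]_(s in `]0%R, t]) ((expR (b * s))%:E * mb s))%E).
  rewrite le_eqVlt; apply/orP; left; apply/eqP.
  apply: eq_integral => s _; rewrite /k /mb -ge0_integralZl//.
  - by apply: eq_integral => x _; rewrite -EFinM mulrC.
  - apply: measurable_funTS; apply/measurable_EFinP.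
    apply: (measurableT_comp measurable_mean_rate).
    by apply: measurable_funB; [exact: measurable_id|exact: measurable_cst].
  - by move=> x _; rewrite lee_fin; case/andP: (mA (x - s)).
apply: ge0_subset_integral => //.
- apply: emeasurable_funM; last exact: measurable_funTS.
  apply: measurable_funTS; apply/measurable_EFinP.
  by apply: measurableT_comp; [exact: measurable_expR|exact: mulrl_measurable].
- by move=> s _; rewrite mule_ge0// lee_fin expR_ge0.
- by move=> s; rewrite /pos/= !in_itv/= andbT => /andP[].
Qed.

End Cumulant.

(** The bound reproduces itself through the renewal inequality with a factor
    [q < 1], starting from the trivial bound [1] on a bounded time interval. *)
Lemma survival_decay : exists2 K : R, 0 <= K &
  forall f u, is_cumulant alpha p G f u ->
  forall t, 0 <= t -> 1 - offspring_laplace G u t <= K * expR (- (b * t)).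
Proof.
have [M M0 tailM] := tail_bound; have [q /andP[q0 q1] qb] := half_malthus.
pose K := M / (1 - q); have q1' : 0 < 1 - q by rewrite subr_gt0.
have K0 : 0 <= K by rewrite divr_ge0// ltW.
have KE : M + q * K = K by rewrite /K; field; rewrite gt_eqF.
exists K => // f u hu t t0.
pose E := expR (b * t).
have E0 : 0 <= E by exact: expR_ge0.
have bound n s : 0 <= s -> s <= t ->
    1 - offspring_laplace G u s <= (K + q ^+ n * E) * expR (- (b * s)).
  elim: n s => [|n IH] s s0 st.
    have [_ /(_ s)/andP[w0 _]] := unit_offspring_laplace hG hu.
    rewrite expr0 mul1r mulrDl -[E * _]expRD -mulrBr.
    have : 1 <= expR (b * (t - s)).
      by rewrite -[X in X <= _]expR0 ler_expR mulr_ge0 ?(ltW b0)// subr_ge0.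
    have : 0 <= K * expR (- (b * s)) by rewrite mulr_ge0 ?expR_ge0.
    by move: w0; lra.
  have -> : K + q ^+ n.+1 * E = M + q * (K + q ^+ n * E).
    by rewrite mulrDr addrA KE exprS mulrA.
  apply: (survival_step hu) => //.
  - by rewrite addr_ge0// mulr_ge0// exprn_ge0.
  - exact: tailM.
  - by move=> r r0 rs; apply: IH => //; rewrite (le_trans (ltW rs)).
have : ((K + q ^+ n * E) * expR (- (b * t))) @[n --> \oo] -->
    (K + 0 * E) * expR (- (b * t)).
  apply: cvgM; last exact: cvg_cst.
  apply: cvgD; first exact: cvg_cst.
  apply: cvgM; last exact: cvg_cst.
  by apply: cvg_expr; rewrite ger0_norm.
rewrite mul0r addr0 => /cvgr_to_ge; apply.
by apply: nearW => n; exact: bound.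
Qed.

(** The bound is uniform in [f]: it controls the survival probability. *)
Lemma one_sub_expRN_cumulant_decay : exists2 C : R, 0 <= C &
  forall f u, is_cumulant alpha p G f u ->
  forall t x, 0 <= t -> pos x ->
  1 - expR (- u t x) <= C * expR (- (b * t)) * expR (alpha1 * x).
Proof.
have [K K0 decay] := survival_decay; have [A A0 mA] := mean_rate_bound.
exists (1 + K * A / b).
  by rewrite addr_ge0// divr_ge0 ?(ltW b0)// mulr_ge0 ?(ltW A0).
move=> f u hu t x t0 px; have x0 : 0 < x by move: px; rewrite /pos/= in_itv/= andbT.
apply: le_trans (one_sub_expRN_le hu t0 px) _.
rewrite -mulrA mulrDl mul1r lerD//.
  rewrite -expRD indicE mem_setE in_itv/= andbT; case: ltP => tx /=; last exact: expR_ge0.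
  rewrite -[leLHS]expR0 ler_expR alpha1E mulrDl.
  have : 0 <= b * (x - t) by rewrite mulr_ge0 ?(ltW b0)// subr_ge0 ltW.
  have : 0 <= b * x by rewrite mulr_ge0 ?(ltW b0) ?(ltW x0).
  lra.
rewrite -lee_fin.
have h := branching_term_mean_rate hu x K0 (fun s hs (_ : s < t) => decay f u hu s hs).
apply: le_trans h _.
have mI : measurable (`]0, x]%classic : set Rm) by exact: measurable_itv.
have Kt0 : 0 <= K * expR (- (b * t)) by rewrite mulr_ge0 ?expR_ge0.
have -> : K * A / b * (expR (- (b * t)) * expR (alpha1 * x)) =
    K * expR (- (b * t)) * (A * (expR (alpha1 * x) / b)) by ring.
rewrite [leRHS]EFinM; apply: lee_wpmul2l; first by rewrite lee_fin.
apply: (@le_trans _ _ (\int[lambda]_(s in `]0%R, x]) (A * expR (b * x))%:E)%E).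
  rewrite integral_mkcond [leRHS]integral_mkcond; apply: ge0_le_integral => //.
  - move=> s _; rewrite patchE; case: ifPn => // _.
    by rewrite lee_fin mulr_ge0 ?expR_ge0//; case/andP: (mA (x - s)).
  - apply/(measurable_restrictT _ (measurable_itv `]0, t])).
    apply: measurable_funTS; apply/measurable_EFinP; apply: measurable_funM.
      apply: (measurableT_comp measurable_mean_rate).
      by apply: measurable_funB; [exact: measurable_cst|exact: measurable_id].
    by apply: measurableT_comp; [exact: measurable_expR|exact: mulrl_measurable].
  - by apply/(measurable_restrictT _ mI); exact: measurable_cst.
  - move=> s _; rewrite !patchE !mem_setE !in_itv/=.
    case: ifPn => [/andP[s0 st]|_]; last first.
      by case: ifP => // _; rewrite lee_fin mulr_ge0 ?expR_ge0 ?(ltW A0).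
    rewrite s0 /=; case: (leP s x) => sx /=.
      rewrite lee_fin; have /andP[m0 m1] := mA (x - s).
      by rewrite ler_pM ?expR_ge0// ler_expR ler_wpM2l ?(ltW b0).
    rewrite /mean_rate patchE memNset; first by rewrite mul0r.
    by rewrite /pos/= in_itv/= andbT subr_gt0 ltNge (ltW sx).
rewrite integral_cst//= lebesgue_measure_itv/= lte_fin x0 oppr0 adde0.
rewrite -EFinM lee_fin -mulrA ler_wpM2l ?(ltW A0)// alpha1E mulrDl expRD -mulrA.
rewrite ler_wpM2l ?expR_ge0// ler_pdivlMr// mulrC.
by have := expR_ge1Dx (b * x); lra.
Qed.

End Decay.

(** * Immigration *)

Section NullMeasure.
Context {R : realType}.
Local Notation Rm := (measurableTypeR R).
Local Notation N := (intmeas R).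

(** The fields other than the function itself are propositions. *)
Lemma eq_finite_measure d (T : measurableType d)
    (m1 m2 : {finite_measure set T -> \bar R}) :
  (m1 = m2 :> (set T -> \bar R)) -> m1 = m2.
Proof.
case: m1 => m1 c1; case: m2 => m2 c2 /= m12; rewrite m12 in c1 *.
congr FiniteMeasure.Pack.
case: c1 => [[a1 a2] [a3] [a4] [a5] [a6]].
case: c2 => [[b1 b2] [b3] [b4] [b5] [b6]].
by rewrite (Prop_irrelevance a1 b1) (Prop_irrelevance a2 b2)
  (Prop_irrelevance a3 b3) (Prop_irrelevance a4 b4) (Prop_irrelevance a5 b5)
  (Prop_irrelevance a6 b6).
Qed.

Lemma intmeas_eq0 (nu : N) : nu setT = 0%E -> nu = null_intmeas R.
Proof.
move=> nuT; have nu0 A : nu A = 0%E.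
  have [mA|nmA] := pselect (measurable A); last exact: intmeas_out.
  apply/eqP; rewrite -measure_le0 -nuT; apply: le_measure; rewrite ?inE//.
case: nu nuT nu0 => m o q i /= mT m0.
have mE : m = mzero by apply: eq_finite_measure; apply/funext => A; rewrite m0.
rewrite /null_intmeas; move: o q i; rewrite mE => o q i.
by congr IntMeas; exact: Prop_irrelevance.
Qed.

Lemma measurable_nonnull : measurable (nonnull_intmeas : set N).
Proof.
rewrite /nonnull_intmeas; apply: measurableC.
rewrite (_ : [set _] = (fun nu : N => nu setT) @^-1` [set 0%E]).
  rewrite -[X in measurable X]setTI; exact: measurable_intmeas.
apply/seteqP; split=> nu /=; first by move=> ->.
exact: intmeas_eq0.
Qed.

End NullMeasure.

Section Immigration.
Context {R : realType}.
Local Notation Rm := (measurableTypeR R).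
Local Notation N := (intmeas R).
Local Notation lambda := (@lebesgue_measure R).
Local Notation Bp := (@bounded_borel_pos R).
Local Notation cm := (completely_monotone Bp).
Variables (alpha : R -> R) (p : R -> nat -> R) (G : probability Rm R).
Variables (L : {finite_measure set N -> \bar R}) (u : (R -> R) -> R -> R -> R).
Variables (alpha1 : R).
Hypothesis ha : C1_pos alpha.
Hypothesis hp : offspring_law p.
Hypothesis hG : continuous_law G.
Hypothesis hu : forall f, Bp f -> is_cumulant alpha p G f (u f).
Hypothesis alpha1_gt0 : 0 < alpha1.
Variable C : R.
Hypothesis C0 : 0 <= C.
Hypothesis decay : forall f, Bp f -> forall t x, 0 <= t -> pos x ->
  1 - expR (- u f t x) <= C * expR (- (alpha1 / 2 * t)) * expR (alpha1 * x).
Implicit Types (nu : N) (f : R -> R) (t s x : R).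

Let u_ge0 f t : Bp f -> 0 <= t -> nonneg_on_pos (u f t).
Proof. by move=> Bf t0 x px; have [_ + _ _] := hu Bf; exact. Qed.

Let mu_ f t : Bp f -> 0 <= t -> measurable_fun (pos : set Rm) (u f t).
Proof. by move=> Bf t0; exact: (measurable_cumulant (hu Bf)). Qed.

(** The product over the individuals of [nu], which reproduce independently. *)
Lemma cm_expRN_pair nu t : 0 <= t -> cm (fun f => expR (- pair nu (u f t))).
Proof.
move=> t0; have [s nus] := exists_atoms nu.
apply: (@cm_eq _ _ _ (@bounded_borel_posD R)
    (fun f => \prod_(x <- s) expR (- u f t x))).
  by move=> f Bf; rewrite (pair_atoms nus (mu_ Bf t0)) -sumrN expR_sum.
apply: (cm_prod (@bounded_borel_posD R)) => x xs.
exact: (cm_expRN_cumulant ha hp hG hu t0 (nus.1 x xs)).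
Qed.

Definition weight nu : \bar R := (\int[nu]_(x in pos) (expR (alpha1 * x))%:E)%E.

Let measurable_exp : measurable_fun (pos : set Rm) (fun x => (expR (alpha1 * x))%:E).
Proof.
apply: measurable_funTS; apply/measurable_EFinP.
by apply: measurableT_comp; [exact: measurable_expR|exact: mulrl_measurable].
Qed.

Lemma weight_ge0 nu : (0 <= weight nu)%E.
Proof. by apply: integral_ge0 => x _; rewrite lee_fin expR_ge0. Qed.

Lemma measurable_weight : measurable_fun setT weight.
Proof.
by apply: measurable_integral_intmeas => // x _; rewrite lee_fin expR_ge0.
Qed.

Lemma weight_fin nu : weight nu \is a fin_num.
Proof.
have [s nus] := exists_atoms nu; rewrite /weight (ge0_integral_atoms nus)//.
by rewrite sumEFin.
Qed.

(** With [a_x = expR (- u f t x)], for [x] ranging over the atoms of [nu], this is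
    the union bound [1 - \prod a_x <= \sum (1 - a_x)]. *)
Lemma one_sub_expRN_pair_le nu f t : Bp f -> 0 <= t ->
  1 - expR (- pair nu (u f t)) <=
  C * expR (- (alpha1 / 2 * t)) * fine (weight nu).
Proof.
move=> Bf t0; have [s nus] := exists_atoms nu.
rewrite (pair_atoms nus (mu_ Bf t0)) /weight (ge0_integral_atoms nus)//.
rewrite sumEFin /= mulr_sumr.
have spos := nus.1; elim: s {nus} spos => [|x s IH] spos.
  by rewrite !big_nil oppr0 expR0 subrr.
have px : pos x by apply: spos; rewrite mem_head.
have {}IH := IH (fun y ys => spos y (mem_behead (s := x :: s) ys)).
rewrite !big_cons opprD expRD.
have := decay Bf t0 px.
have : expR (- \sum_(y <- s) u f t y) <= 1.
  rewrite expR_le1 oppr_le0 big_seq; apply: sumr_ge0 => y ys.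
  by apply: u_ge0 => //; apply: spos; rewrite inE ys orbT.
have : expR (- u f t x) <= 1 by rewrite expR_le1 oppr_le0 u_ge0.
have := expR_ge0 (- u f t x); have := expR_ge0 (- \sum_(y <- s) u f t y).
move: IH; move: (expR (- u f t x)) (expR (- \sum_(y <- s) u f t y)) => a b.
move: (\sum_(y <- s) _) (C * _ * _) => c d; nra.
Qed.

Let psi_itv nu f t : Bp f -> 0 <= t -> 0 <= 1 - expR (- pair nu (u f t)) <= 1.
Proof.
move=> Bf t0; have l0 : 0 <= pair nu (u f t) by apply: pair_ge0; exact: u_ge0.
by rewrite subr_ge0 expR_le1 oppr_le0 l0 lerBlDr lerDl expR_ge0.
Qed.

(** Total in time, as measurability of parametric integrals requires. *)
Let ut f s x := if 0 <= s then u f s x else 0.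

Lemma measurable_expRN_pair_time f : Bp f ->
  measurable_fun setT (fun sn : Rm * N => expR (- pair sn.2 (ut f sn.1))).
Proof.
move=> Bf; apply: measurableT_comp; first exact: measurable_expR.
apply: measurable_funN; apply: measurableT_comp; first exact: fine_measurable.
have [mu _ _ _] := hu Bf.
have mTpos : measurable (setT `*` pos : set (Rm * Rm)) by exact: measurableX.
have mDpos : measurable (`[0, +oo[ `*` pos : set (Rm * Rm)) by exact: measurableX.
apply: (@measurable_integral_intmeas2 R _ Rm (fun sx => (ut f sx.1 sx.2)%:E)).
  apply/measurable_EFinP.
  apply: (@measurable_fun_if _ _ _ _ (fun sx : Rm * Rm => u f sx.1 sx.2) (fun=> 0)
    _ mTpos (fun sx : Rm * Rm => 0 <= sx.1)) => //.
  - apply: measurable_funTS; apply: measurable_fun_ler; first exact: measurable_cst.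
    exact: measurable_fst.
  - rewrite [X in measurable_fun X _](_ : _ = `[0, +oo[ `*` pos)//.
    apply/seteqP; split=> [[s x] [[_ /= px] s0]|[s x] [/= s0 px]].
      by split=> //=; rewrite in_itv/= s0.
    by split=> //=; move: s0; rewrite in_itv/= andbT.
move=> s x px; rewrite lee_fin /ut; case: ifP => // s0; exact: u_ge0.
Qed.

Hypothesis weight_lty : (\int[L]_(nu in nonnull_intmeas) weight nu < +oo)%E.

Let W := fine (\int[L]_(nu in nonnull_intmeas) weight nu).

Let W0 : 0 <= W.
Proof. by apply: fine_ge0; apply: integral_ge0 => nu _; exact: weight_ge0. Qed.

Let mL : measurable (nonnull_intmeas : set N).
Proof. exact: measurable_nonnull. Qed.

Let L_lty : (L nonnull_intmeas < +oo)%E.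
Proof. by rewrite ltey_eq fin_num_measure. Qed.

Let measurable_expRN_pair_at f s : Bp f -> 0 <= s ->
  measurable_fun (nonnull_intmeas : set N) (fun nu => expR (- pair nu (u f s))).
Proof.
move=> Bf s0; apply: measurable_funTS.
apply: measurableT_comp; first exact: measurable_expR.
apply: measurable_funN; by apply: measurable_pair; [exact: mu_|exact: u_ge0].
Qed.

Let integrable_expRN f s : Bp f -> 0 <= s ->
  L.-integrable nonnull_intmeas (EFin \o (fun nu => expR (- pair nu (u f s)))).
Proof.
move=> Bf s0; apply: (ge0_bounded_integrable (M := 1) mL L_lty).
  exact: measurable_expRN_pair_at.
move=> nu _; have := psi_itv nu Bf s0.
by rewrite expR_ge0/=; lra.
Qed.

Let integrable_psi f s : Bp f -> 0 <= s ->
  L.-integrable nonnull_intmeas (EFin \o (fun nu => 1 - expR (- pair nu (u f s)))).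
Proof.
move=> Bf s0; apply: (ge0_bounded_integrable (M := 1) mL L_lty).
  by apply: measurable_funB; [exact: measurable_cst|exact: measurable_expRN_pair_at].
by move=> nu _; exact: psi_itv.
Qed.

Lemma measurable_psi f : Bp f ->
  measurable_fun (`[0, +oo[%classic : set Rm) (fun s => psi L (u f s)).
Proof.
move=> Bf; apply: (@eq_measurable_fun _ _ _ _ _ (fun s => psi L (ut f s))).
  move=> s; rewrite inE/= in_itv/= andbT => s0.
  by rewrite /ut s0.
apply: measurable_funTS.
apply: (@measurable_param_Rintegral R _ _ Rm N L nonnull_intmeas
  (fun sn => 1 - expR (- pair sn.2 (ut f sn.1)))) => //.
- move=> s nu _ /=; rewrite /ut; case s0 : (0 <= s).
    by case/andP: (psi_itv nu Bf s0).
  by rewrite subr_ge0 expR_le1 oppr_le0; exact: pair_ge0.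
- apply: measurable_funTS; apply: measurable_funB; first exact: measurable_cst.
  exact: measurable_expRN_pair_time.
Qed.

Lemma psi_ge0 f s : Bp f -> 0 <= s -> 0 <= psi L (u f s).
Proof.
by move=> Bf s0; apply: Rintegral_ge0 => nu _; case/andP: (psi_itv nu Bf s0).
Qed.

Lemma psi_decay f s : Bp f -> 0 <= s ->
  psi L (u f s) <= C * W * expR (- (alpha1 / 2 * s)).
Proof.
move=> Bf s0; rewrite -lee_fin (EFin_Rintegral mL (integrable_psi Bf s0)).
have -> : C * W * expR (- (alpha1 / 2 * s)) =
  C * expR (- (alpha1 / 2 * s)) * W by ring.
have k0 : 0 <= C * expR (- (alpha1 / 2 * s)) by rewrite mulr_ge0 ?expR_ge0.
rewrite EFinM fineK; last first.
  by rewrite ge0_fin_numE//; apply: integral_ge0 => nu _; exact: weight_ge0.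
rewrite -ge0_integralZl//; last 2 first.
- by apply: measurable_funTS; exact: measurable_weight.
- by move=> nu _; exact: weight_ge0.
apply: ge0_le_integral => //.
- by move=> nu _; rewrite lee_fin; case/andP: (psi_itv nu Bf s0).
- exact: (measurable_int L (integrable_psi Bf s0)).
- by apply: measurable_funeM; apply: measurable_funTS; exact: measurable_weight.
- by move=> nu _; rewrite -(fineK (weight_fin nu)) -EFinM lee_fin one_sub_expRN_pair_le.
Qed.

Implicit Types D : set R.

(** Half of the decay rate of [psi_decay] is spent on integrability, the other
    half on the factor in [t]. *)
Lemma integral_psi_tail D t f : measurable (D : set Rm) -> 0 <= t ->
  D `<=` `[t, +oo[ -> Bp f ->
  (\int[lambda]_(s in D) (psi L (u f s))%:E <=
   (C * W / (alpha1 / 4) * expR (- (alpha1 / 4 * t)))%:E)%E.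
Proof.
move=> mD t0 Dt Bf; pose c := alpha1 / 4.
have c0 : 0 < c by rewrite divr_gt0.
have D0 : D `<=` `[0, +oo[.
  by move=> s /Dt; rewrite /= !in_itv/= !andbT; exact: le_trans.
have s0 s : D s -> 0 <= s by move=> /D0; rewrite /= in_itv/= andbT.
have mE : measurable_fun (D : set Rm) (fun s => (expR (- (c * s)))%:E).
  apply: measurable_funTS; apply/measurable_EFinP.
  apply: measurableT_comp; first exact: measurable_expR.
  by apply: measurable_funN; apply: mulrl_measurable.
have k0 : 0 <= C * W * expR (- (c * t)) by rewrite !mulr_ge0 ?expR_ge0.
apply: (@le_trans _ _ (\int[lambda]_(s in D)
    ((C * W * expR (- (c * t)))%:E * (expR (- (c * s)))%:E))%E).
  apply: ge0_le_integral => //.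
  - by move=> s /s0 s0'; rewrite lee_fin psi_ge0.
  - apply/measurable_EFinP; apply: measurable_funS (measurable_psi Bf) => //.
  - exact: measurable_funeM.
  - move=> s Ds; rewrite -EFinM lee_fin (le_trans (psi_decay Bf (s0 _ Ds)))//.
    rewrite -[leRHS]mulrA ler_wpM2l ?mulr_ge0// -expRD ler_expR.
    have := Dt s Ds; rewrite /= in_itv/= andbT => ts.
    have -> : alpha1 / 2 = c + c by rewrite /c; field.
    by rewrite mulrDl opprD lerD2r lerN2 ler_wpM2l// ltW.
rewrite ge0_integralZl// -/c.
have -> : C * W / c * expR (- (c * t)) = C * W * expR (- (c * t)) * c^-1 by ring.
by rewrite [leRHS]EFinM; apply: lee_wpmul2l => //; exact: integral_expRN_le.
Qed.

Lemma integrable_psi_time D f : measurable (D : set Rm) -> D `<=` `[0, +oo[ ->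
  Bp f -> lambda.-integrable D (EFin \o (fun s => psi L (u f s))).
Proof.
move=> mD D0 Bf; apply/integrableP; split.
  by apply/measurable_EFinP; apply: measurable_funS (measurable_psi Bf).
under eq_integral => s /set_mem /D0 s0.
  rewrite /= ger0_norm; first over.
  by rewrite psi_ge0//; move: s0; rewrite /= in_itv/= andbT.
exact: le_lt_trans (integral_psi_tail mD (lexx 0) D0 Bf) (ltry _).
Qed.

(** [- psi L (u f s)] differs from a completely monotone functional of [f] by
    the constant [L nonnull_intmeas]. *)
Lemma cm_expRN_integral_psi D : measurable (D : set Rm) -> D `<=` `[0, +oo[ ->
  (lambda D < +oo)%E -> cm (fun f => expR (- \int[lambda]_(s in D) psi L (u f s))).
Proof.
move=> mD D0 lD; pose L0 := fine (L nonnull_intmeas).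
have D0' s : D s -> 0 <= s by move=> /D0; rewrite /= in_itv/= andbT.
pose ell s f := \int[L]_(nu in nonnull_intmeas) expR (- pair nu (u f s)).
have psiE s f : Bp f -> 0 <= s -> psi L (u f s) = L0 - ell s f.
  move=> Bf s0; rewrite /psi RintegralB//; last exact: integrable_expRN.
    by rewrite Rintegral_cst// mul1r.
  by apply: (bounded_integrable (M := 1) mL L_lty) => // nu _; rewrite normr1.
have iL : forall f, Bp f -> lambda.-integrable D (EFin \o (fun s => ell s f)).
  move=> f Bf; apply: (ge0_bounded_integrable (M := L0) mD lD).
    apply: (@eq_measurable_fun _ _ _ _ _ (fun s => L0 - psi L (u f s))).
      by move=> s /set_mem /D0' s0; rewrite psiE// subKr.
    apply: measurable_funB; first exact: measurable_cst.
    exact: measurable_funS (measurable_psi Bf).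
  move=> s /D0' s0; rewrite Rintegral_ge0//=.
  by have := psi_ge0 Bf s0; rewrite (psiE _ _ Bf s0) subr_ge0.
apply: (@cm_eq _ _ _ (@bounded_borel_posD R) (fun f =>
    expR (- (L0 * fine (lambda D))) * expR (\int[lambda]_(s in D) ell s f))).
  move=> f Bf; rewrite -expRD; congr expR.
  transitivity (- \int[lambda]_(s in D) (L0 - ell s f)).
    rewrite RintegralB//; last 2 first.
    - by apply: (bounded_integrable (M := `|L0|) mD lD).
    - exact: iL.
    by rewrite Rintegral_cst// opprB addrC.
  congr (- _); apply: eq_Rintegral => s /set_mem /D0' s0.
  by rewrite psiE.
apply: (cmZ (@bounded_borel_posD R)); first exact: expR_ge0.
apply: (cm_expR (@bounded_borel_posD R)).
apply: (cm_integral (@bounded_borel_posD R) mD) => [s /D0' s0|]; last exact: iL.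
apply: (cm_integral (@bounded_borel_posD R) mL) => [nu _|f Bf]; first exact: cm_expRN_pair.
exact: integrable_expRN.
Qed.

End Immigration.

(** * Convergence *)

Section Convergence.
Context {R : realType}.
Local Notation Rm := (measurableTypeR R).
Local Notation N := (intmeas R).
Local Notation lambda := (@lebesgue_measure R).
Local Notation Bp := (@bounded_borel_pos R).
Local Notation cm := (completely_monotone Bp).
Implicit Types (f : R -> R) (nu sigma : N).

Lemma cvg_dist_le (T : Type) (F : set_system T) {FF : Filter F} (x g : T -> R)
    (l : R) : (\forall t \near F, `|x t - l| <= g t) ->
  g t @[t --> F] --> (0 : R) -> x t @[t --> F] --> l.
Proof.
move=> xg g0; apply/cvgrPdist_le => e e0; near=> t.
rewrite distrC; apply: (@le_trans _ _ (g t)); first by near: t.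
by apply/ltW; near: t; exact: (cvgr_lt _ g0).
Unshelve. all: by end_near. Qed.

Lemma pair_null_intmeas f : pair (null_intmeas R) f = 0.
Proof. by rewrite /pair /Rintegral integral_measure_zero. Qed.

Lemma integrable_expN_pair (Q : probability N R) f : Bp f ->
  Q.-integrable setT (EFin \o expN_pair f).
Proof.
move=> Bf; apply: (@ge0_bounded_integrable _ _ _ _ _ _ _ _ 1) => //.
- by rewrite [X in (X < _)%E]probability_setT ltry.
- exact: measurable_expN_pair.
- by move=> nu _; exact: expN_pair_itv.
Qed.

Lemma cm_laplace (Q : probability N R) : cm (fun f => \int[Q]_nu expN_pair f nu).
Proof.
apply: (cm_integral (@bounded_borel_posD R) measurableT) => [nu _|f Bf].
  apply: (cm_expRN_additive (@bounded_borel_posD R)) => [f [_ _ f0]|f h Bf Bh].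
    exact: pair_ge0.
  exact: pairD.
exact: integrable_expN_pair.
Qed.

(** If the Laplace functional of [Q] is that of [I] times a completely monotone
    factor [F >= c], that of [Q - c I] is the product of the completely monotone
    functionals [F - c] and that of [I]. *)
Lemma domination_factor (Q I : probability N R) (F : (R -> R) -> R) (c : R) :
  cm F -> (forall f, Bp f -> c <= F f) ->
  (forall f, Bp f -> \int[Q]_nu expN_pair f nu = F f * \int[I]_nu expN_pair f nu) ->
  forall A, measurable A -> ((Num.max 0 c)%:E * I A <= Q A)%E.
Proof.
move=> cF cleF QI A mA; have [c0|c0] := leP c 0; first by rewrite mul0e.
apply: domination_borel => //.
apply: (@cm_eq _ _ _ (@bounded_borel_posD R)
    (fun f => (F f - c) * \int[I]_nu expN_pair f nu)).
  by move=> f Bf; rewrite QI// mulrBl.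
apply: (cmM (@bounded_borel_posD R)); last exact: cm_laplace.
exact: (cm_subr_cst (@bounded_borel_posD R)).
Qed.

Lemma domination_factor_Rintegral (Q I : probability N R) (F : (R -> R) -> R)
    (c : R) (h : N -> R) M :
  cm F -> (forall f, Bp f -> c <= F f) ->
  (forall f, Bp f -> \int[Q]_nu expN_pair f nu = F f * \int[I]_nu expN_pair f nu) ->
  measurable_fun setT h -> (forall nu, `|h nu| <= M) ->
  `|\int[Q]_nu h nu - \int[I]_nu h nu| <= 2 * M * (1 - c).
Proof.
move=> cF cleF QI mh hM.
have M0 : 0 <= M by rewrite (le_trans _ (hM (null_intmeas R))).
have c0 : 0 <= Num.max 0 c by rewrite le_max lexx.
apply: le_trans (dominated_Rintegral c0 (domination_factor cF cleF QI) mh hM) _.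
by rewrite ler_wpM2l ?mulr_ge0// lerD2l lerN2 le_max lexx orbT.
Qed.

(** The transition probabilities of a kernel, as probability measures. *)
Section Law.
Variables (P : R -> R.-pker N ~> N) (t : R) (sigma : N).
Definition law : set N -> \bar R := P t sigma.
HB.instance Definition _ := Measure.on law.
Let law_setT : law setT = 1%E. Proof. exact: prob_kernel. Qed.
HB.instance Definition _ := Measure_isProbability.Build _ _ _ law law_setT.
End Law.

Variables (alpha : R -> R) (p : R -> nat -> R) (G : probability Rm R).
Variables (L : {finite_measure set N -> \bar R}) (u : (R -> R) -> R -> R -> R).
Variables (P : R -> R.-pker N ~> N) (alpha1 : R).
Hypothesis ha : C1_pos alpha.
Hypothesis hp : offspring_law p.
Hypothesis hG : continuous_law G.
Hypothesis hP : is_process alpha p G L u P.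
Hypothesis alpha1_gt0 : 0 < alpha1.
Variable C : R.
Hypothesis C0 : 0 <= C.
Hypothesis decay : forall f, Bp f -> forall t x, 0 <= t -> pos x ->
  1 - expR (- u f t x) <= C * expR (- (alpha1 / 2 * t)) * expR (alpha1 * x).
Hypothesis weight_lty : (\int[L]_(nu in nonnull_intmeas) weight alpha1 nu < +oo)%E.
Implicit Types (s t : R).

Let hu f : Bp f -> is_cumulant alpha p G f (u f).
Proof. by case: hP => _ + _; exact. Qed.

Let W := fine (\int[L]_(nu in nonnull_intmeas) weight alpha1 nu).
Let K := C * W / (alpha1 / 4).

Let K0 : 0 <= K.
Proof.
rewrite /K divr_ge0 ?divr_ge0 ?(ltW alpha1_gt0)// mulr_ge0// fine_ge0//.
by apply: integral_ge0 => nu _; exact: weight_ge0.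
Qed.

Let Psi (D : set R) f := \int[lambda]_(s in D) psi L (u f s).

Let Psi_tail D t f : measurable (D : set Rm) -> 0 <= t -> D `<=` `[t, +oo[ ->
  Bp f -> 0 <= Psi D f <= K * expR (- (alpha1 / 4 * t)).
Proof.
move=> mD t0 Dt Bf.
have D0 : D `<=` `[0, +oo[.
  by move=> s /Dt; rewrite /= !in_itv/= !andbT; exact: le_trans.
rewrite /Psi Rintegral_ge0/=; last first.
  move=> s /D0; rewrite /= in_itv/= andbT => s0.
  exact: (psi_ge0 L hu).
rewrite -lee_fin EFin_Rintegral//; last first.
  exact: (integrable_psi_time hu alpha1_gt0 C0 decay weight_lty).
exact: (integral_psi_tail hu alpha1_gt0 C0 decay weight_lty).
Qed.

Let Psi_split (b : itv_bound R) t f : 0 <= t -> (BRight t <= b)%O -> Bp f ->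
  Psi [set` Interval (BRight 0) b] f =
  Psi `]0, t] f + Psi [set` Interval (BRight t) b] f.
Proof.
move=> t0 tb Bf; rewrite /Psi.
have := @Rintegral_itvB R (fun s => psi L (u f s)) (BRight 0) b t.
move=> <-//; first by rewrite addrC subrK.
apply: (integrable_psi_time hu alpha1_gt0 C0 decay weight_lty) => //.
move=> s /=; rewrite itv_boundlr bnd_simp => /andP[/ltW s0 _].
by rewrite in_itv/= s0.
Qed.

Lemma laplace_law f t sigma : Bp f -> 0 <= t ->
  \int[law P t sigma]_nu expN_pair f nu =
  expR (- pair sigma (u f t)) * expR (- Psi `]0, t] f).
Proof. by move=> Bf t0; rewrite -expRD; case: hP => _ _ /(_ f t sigma Bf t0). Qed.

Let o := null_intmeas R.

Lemma laplace_law_null f t : Bp f -> 0 <= t ->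
  \int[law P t o]_nu expN_pair f nu = expR (- Psi `]0, t] f).
Proof. by move=> Bf t0; rewrite laplace_law// pair_null_intmeas oppr0 expR0 mul1r. Qed.

(** Started from [sigma], the population at time [t] is the independent sum of
    the immigrant population and of the descendants of [sigma], the latter
    being extinct with large probability. *)
Lemma initial_forgetting sigma t (h : N -> R) M : 0 <= t ->
  measurable_fun setT h -> (forall nu, `|h nu| <= M) ->
  `|\int[law P t sigma]_nu h nu - \int[law P t o]_nu h nu| <=
    2 * M * (C * fine (weight alpha1 sigma) * expR (- (alpha1 / 2 * t))).
Proof.
move=> t0 mh hM; set c := C * _ * _.
rewrite -[c](subKr 1).
apply: (@domination_factor_Rintegral _ _ (fun f => expR (- pair sigma (u f t)))) => //.
- exact: (cm_expRN_pair ha hp hG hu).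
- move=> f Bf; have := one_sub_expRN_pair_le hu decay sigma Bf t0.
  by rewrite /c mulrAC; lra.
- by move=> f Bf; rewrite laplace_law// laplace_law_null.
Qed.

Let c_ t := 1 - K * expR (- (alpha1 / 4 * t)).

Let factor t t' : 0 <= t -> t <= t' ->
  [/\ cm (fun f => expR (- Psi `]t, t'] f)),
    forall f, Bp f -> c_ t <= expR (- Psi `]t, t'] f) &
    forall f, Bp f -> \int[law P t' o]_nu expN_pair f nu =
      expR (- Psi `]t, t'] f) * \int[law P t o]_nu expN_pair f nu].
Proof.
move=> t0 tt'; have t'0 : 0 <= t' by rewrite (le_trans t0).
split.
- apply: (cm_expRN_integral_psi L ha hp hG hu) => //.
    by move=> s; rewrite /= !in_itv/= andbT => /andP[/ltW + _]; exact: le_trans.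
  by rewrite lebesgue_measure_itv/=; case: ifP => _; rewrite ltry.
- move=> f Bf; rewrite /c_.
  have sub : `]t, t']%classic `<=` `[t, +oo[%classic.
    by move=> s; rewrite /= !in_itv/= andbT => /andP[/ltW].
  have /andP[_ tail] := Psi_tail (measurable_itv _) t0 sub Bf.
  by have := expR_ge1Dx (- Psi `]t, t'] f); move: tail; lra.
- move=> f Bf; rewrite !laplace_law_null// -expRD (@Psi_split _ t)//; congr expR.
  by rewrite opprD addrC.
Qed.

(** The immigrant population at time [t'] is the independent sum of that at time
    [t] and of the progeny of the other immigrants, who have none left at time
    [t'] with large probability. *)
Lemma immigration_forgetting t t' (h : N -> R) M : 0 <= t -> t <= t' ->
  measurable_fun setT h -> (forall nu, `|h nu| <= M) ->
  `|\int[law P t' o]_nu h nu - \int[law P t o]_nu h nu| <=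
    2 * M * (K * expR (- (alpha1 / 4 * t))).
Proof.
move=> t0 tt' mh hM; have [cF cleF QI] := factor t0 tt'.
apply: le_trans (domination_factor_Rintegral cF cleF QI mh hM) _.
by rewrite /c_ opprB addrC subrK.
Qed.

Lemma expRN_mulr_cvg0 (k : R) : 0 < k -> expR (- (k * t)) @[t --> +oo] --> (0 : R).
Proof.
move=> k0; apply: (@cvg_comp _ _ _ (fun t : R => k * t) (fun t : R => expR (- t)) _ +oo).
  apply: gt0_cvgMry k0 _; exact: cvg_id.
exact: cvgr_expR.
Qed.

Let d0 : 0 < alpha1 / 4. Proof. by rewrite divr_gt0. Qed.

Let tail_cvg0 : K * expR (- (alpha1 / 4 * n%:R)) @[n --> \oo] --> (0 : R).
Proof.
rewrite -[X in _ --> X](mulr0 K); apply: cvgM; first exact: cvg_cst.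
apply: (@cvg_comp _ _ _ (fun n : nat => n%:R : R)
  (fun t : R => expR (- (alpha1 / 4 * t))) _ +oo).
  exact: cvgr_idn.
exact: expRN_mulr_cvg0 d0.
Qed.

(** The law of the immigrant population at each integer time dominates the
    earlier ones, with constants that tend to [1]. *)
Lemma invariant_law : exists eta : probability N R,
  forall n (h : N -> R) M, measurable_fun setT h -> (forall nu, `|h nu| <= M) ->
  `|\int[law P n%:R o]_nu h nu - \int[eta]_nu h nu| <=
    2 * M * (K * expR (- (alpha1 / 4 * n%:R))).
Proof.
have c_le1 n : c_ n%:R <= 1 by rewrite /c_ gerBl mulr_ge0 ?expR_ge0.
have c_ge0 n : 0 <= Num.max 0 (c_ n%:R) by rewrite le_max lexx.
have c_cvg : Num.max 0 (c_ n%:R) @[n --> \oo] --> (1 : R).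
  apply: (@squeeze_cvgr _ _ _ _ (fun n => c_ n%:R) (fun=> 1)).
  - by near=> n; rewrite le_max lexx orbT/= ge_max ler01 c_le1.
  - rewrite -[X in _ --> X]subr0; apply: cvgB; [exact: cvg_cst|exact: tail_cvg0].
  - exact: cvg_cst.
have dom n m A : (n <= m)%N -> measurable A ->
    ((Num.max 0 (c_ n%:R))%:E * law P n%:R o A <= law P m%:R o A)%E.
  move=> nm mA; have nm' : n%:R <= m%:R :> R by rewrite ler_nat.
  have [cF cleF QI] := factor (ler0n R n) nm'.
  exact: (domination_factor cF cleF QI mA).
have [eta etaP] := limit_probability c_cvg dom.
exists eta => n h M mh hM; rewrite distrC.
have M0 : 0 <= M by rewrite (le_trans _ (hM o)).
apply: le_trans (dominated_Rintegral (c_ge0 n) (fun A mA => etaP n A mA) mh hM) _.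
rewrite ler_wpM2l ?mulr_ge0//.
have : c_ n%:R <= Num.max 0 (c_ n%:R) by rewrite le_max lexx orbT.
by rewrite {1}/c_; lra.
Unshelve. all: by end_near. Qed.

Lemma process_ergodic : exists eta : probability N R,
  (forall sigma, weak_cvg (fun t => P t sigma) eta) /\
  (forall f, Bp f -> (\int[eta]_nu (expN_pair f nu)%:E =
     expeR (- \int[lambda]_(s in pos) (psi L (u f s))%:E))%E).
Proof.
have [eta etaP] := invariant_law; exists eta; split.
  move=> sigma h ch [M0 [_ /(_ (M0 + 1)) hM0]].
  pose M := M0 + 1.
  have hM nu : `|h nu| <= M by apply: hM0 => //; rewrite ltrDl.
  have mh : measurable_fun setT h by exact: continuous_intmeas_measurable.
  have M_ge0 : 0 <= M by rewrite (le_trans _ (hM o)).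
  pose A := C * fine (weight alpha1 sigma).
  pose g t := 2 * M * (A * expR (- (alpha1 / 2 * t)) +
                       2 * (K * expR (- (alpha1 / 4 * t)))).
  have g0 : g t @[t --> +oo] --> (0 : R).
    rewrite -[X in _ --> X](mulr0 (2 * M)); apply: cvgM; first exact: cvg_cst.
    rewrite -[X in _ --> X]addr0 -{1}(mulr0 A) -[X in _ --> _ + X](mulr0 2).
    apply: cvgD; first by apply: cvgM; [exact: cvg_cst|apply: expRN_mulr_cvg0; rewrite divr_gt0].
    apply: cvgM; first exact: cvg_cst.
    rewrite -(mulr0 K); apply: cvgM; [exact: cvg_cst|exact: expRN_mulr_cvg0].
  apply: (cvg_dist_le _ g0); near=> t.
  have t0 : 0 <= t by near: t; exact: nbhs_pinfty_ge.
  pose n := (Num.trunc t).+1.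
  have tn : t <= n%:R by have /andP[_ /ltW] := archimedean.Num.Theory.truncn_itv t0.
  have h1 := initial_forgetting sigma t0 mh hM.
  have h2 := immigration_forgetting t0 tn mh hM.
  have h3 := etaP n h M mh hM.
  have h4 : 2 * M * (K * expR (- (alpha1 / 4 * n%:R))) <=
      2 * M * (K * expR (- (alpha1 / 4 * t))).
    rewrite ler_wpM2l ?mulr_ge0// ler_wpM2l// ler_expR lerN2 ler_wpM2l//.
    exact: ltW.
  have alg (a b c e x y z : R) : `|a - b| <= x -> `|c - b| <= y ->
      `|c - e| <= z -> z <= y -> `|a - e| <= x + y + y.
    rewrite !ler_norml => /andP[? ?] /andP[? ?] /andP[? ?] ?.
    by apply/andP; split; lra.
  have h5 := alg _ _ _ _ _ _ _ h1 h2 h3 h4.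
  apply: (le_trans h5); rewrite le_eqVlt; apply/orP; left; apply/eqP.
  by rewrite /g /A; ring.
move=> f Bf.
have iPsi : lambda.-integrable pos (EFin \o (fun s => psi L (u f s))).
  apply: (integrable_psi_time hu alpha1_gt0 C0 decay weight_lty) => //.
  by move=> s; rewrite /pos/= !in_itv/= !andbT => /ltW.
rewrite -(EFin_Rintegral measurable_pos iPsi) -EFinN.
rewrite -(EFin_Rintegral measurableT (integrable_expN_pair eta Bf)); congr EFin.
have cvg1 : \int[law P n%:R o]_nu expN_pair f nu @[n --> \oo] --> \int[eta]_nu expN_pair f nu.
  apply: (cvg_dist_le (g := fun n => 2 * 1 * (K * expR (- (alpha1 / 4 * n%:R))))).
    apply: nearW => n; apply: etaP; first exact: measurable_expN_pair.
    by move=> nu; have /andP[e0 e1] := expN_pair_itv nu Bf; rewrite ger0_norm.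
  by rewrite -[X in _ --> X](mulr0 (2 * 1)); apply: cvgM; [exact: cvg_cst|exact: tail_cvg0].
have cvg2 : expR (- Psi `]0, n%:R] f) @[n --> \oo] --> expR (- Psi pos f).
  apply: continuous_cvg; first exact: continuous_expR.
  apply: cvgN; apply: (cvg_dist_le _ tail_cvg0); apply: nearW => n.
  have := @Psi_split +oo%O n%:R f (ler0n _ n) isT Bf; rewrite -[Psi _ f]/(Psi pos f).
  move=> ->; rewrite opprD addrA subrr sub0r normrN.
  have sub : `]n%:R, +oo[%classic `<=` `[n%:R : R, +oo[%classic.
    by move=> s; rewrite /= !in_itv/= !andbT => /ltW.
  have /andP[T0 T1] := Psi_tail (measurable_itv _) (ler0n R n) sub Bf.
  by rewrite ger0_norm.
have E : (fun n : nat => expR (- Psi `]0, n%:R] f)) =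
    (fun n : nat => \int[law P n%:R o]_nu expN_pair f nu).
  by apply/funext => n; rewrite laplace_law_null.
rewrite E in cvg2.
by rewrite -(cvg_lim (@Rhausdorff R) cvg1) -(cvg_lim (@Rhausdorff R) cvg2).
Unshelve. all: by end_near. Qed.

End Convergence.
Theorem theorem4p10 (R : realType) (alpha : R -> R) (p : R -> nat -> R)
    (G : probability (measurableTypeR R) R)
    (L : {finite_measure set (intmeas R) -> \bar R})
    (u : (R -> R) -> R -> R -> R)
    (P : R -> R.-pker (intmeas R) ~> (intmeas R))
    (alpha1 : R) :
  C1_pos alpha ->
  offspring_law p ->
  continuous_law G ->
  L [set null_intmeas R] = 0%E ->
  is_process alpha p G L u P ->
  (\int[@lebesgue_measure R]_(s in pos) mean_birth_rate alpha p G s < 1)%E ->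
  0 < alpha1 ->
  directly_Riemann_integrable
    (fun t => expR (alpha1 * t) * (1 - cdf_pos G t)) ->
  (\int[@lebesgue_measure R]_(s in pos)
     ((expR (alpha1 * s))%:E * mean_birth_rate alpha p G s) = 1)%E ->
  (\int[L]_(nu in nonnull_intmeas)
     \int[nu]_(x in pos) (expR (alpha1 * x))%:E < +oo)%E ->
  exists eta : probability (intmeas R) R,
    (forall sigma : intmeas R, weak_cvg (fun t => P t sigma) eta) /\
    (forall f : R -> R, bounded_borel_pos f ->
       (\int[eta]_nu (expR (- pair nu f))%:E =
        expeR (- \int[@lebesgue_measure R]_(s in pos) (psi L (u f s))%:E))%E).
Proof.
move=> ha hp hG _ hP rho_lt1 alpha1_gt0 tail_dRi malthus weight_lty.
have [C C0 decay] :=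
  one_sub_expRN_cumulant_decay ha hp hG rho_lt1 alpha1_gt0 tail_dRi malthus.
have [_ hu _] := hP.
exact: (process_ergodic ha hp hG hP alpha1_gt0 C0
  (fun f Bf => decay f (u f) (hu f Bf)) weight_lty).
Qed.
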